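(* Let $n\ge2$ and $k\in\mathbb{Z}$. Define \[ F_{k,n}(x):=\prod_{\substack{i,j=1\\ i\ne j}}^n\frac{(x_ix_j^{-1};q)_\infty}{(zx_ix_j^{-1};q)_\infty}\sum_{i=1}^n x_i^k \] and let $C_k(z)$ be the coefficient of $x_1^0x_2^0\cdots x_{n-1}^0$ in $F_{k,n}(x_1,\dots,x_{n-1},(x_1\cdots x_{n-1})^{-1})$. Then $C_k(z)=0$ whenever $k\not\equiv0\pmod n$, and for every $m\in\mathbb{Z}$, \[ C_{nm}(z)=n!(-1)^{(n-1)m}q^{(n-1)m(m-1)/2}\Big(1+\sum_{l=1}^{n-1}\prod_{i=1}^l\frac{(q^m-z^i)(1-z^{n-i})}{(1-q^mz^{n-i})(1-z^i)}\Big)\frac{(z;q)_\infty^{n-1}}{(q;q)_\infty^{n-2}(qz^{n-1};q)_\infty(z;z)_{n-1}}\prod_{i=1}^{n-1}\frac{(z^iq^{1-m},z^iq^m;q)_\infty}{(z^{i+1},z^{i-1}q;q)_\infty}. \]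
   Context: $q,z$ are indeterminates (with $|q|<1$, $|z|<1$); $(a;q)_\infty=\prod_{k\ge0}(1-aq^k)$, $(a;q)_n=\prod_{k=0}^{n-1}(1-aq^k)$, $(a_1,\dots,a_r;q)_\infty=\prod_i(a_i;q)_\infty$. The products are expanded as formal power series in $z$ and $q$ whose coefficients are Laurent polynomials in $x_1,\dots,x_n$, and the coefficient extraction is taken coefficientwise. *)

(* Defs.v *)
From Stdlib Require Import ClassicalEpsilon.
From HB Require Import structures.
From mathcomp Require Import all_boot all_order all_algebra.
Set Implicit Arguments. Unset Strict Implicit. Unset Printing Implicit Defensive.
Import Order.TTheory GRing.Theory Num.Theory.
Local Open Scope ring_scope.

(* [ser n]: formal series  sum_{a:nat, b:int, al:Z^n} c(a,b,al) z^a q^b x^al,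
   given by its coefficient function  c a b al  (coefficient of z^a q^b x^al).
   The q-exponent is allowed to be an integer (needed for q^(1-m) etc.). *)
Definition ser (n : nat) := nat -> int -> ('I_n -> int) -> int.

Definition evlim (s : nat -> int) : int :=
  epsilon (inhabits 0) (fun v => exists N, forall M, (N <= M)%N -> s M = v).

Definition zwin (N : nat) : seq int := [seq (i%:Z - N%:Z) | i <- iota 0 (N.*2.+1)].
Definition vwin (n N : nat) : seq ('I_n -> int) :=
  [seq (fun i => (val (t i))%:Z - N%:Z) | t : {ffun 'I_n -> 'I_(N.*2.+1)} <- enum {ffun 'I_n -> 'I_(N.*2.+1)}].

Section Ser.
Variable n : nat.

Definition szero : ser n := fun _ _ _ => 0.
Definition smono (a : nat) (b : int) (al : 'I_n -> int) : ser n :=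
  fun a' b' al' => if (a' == a) && (b' == b) && [forall i, al' i == al i] then 1 else 0.
Definition sone : ser n := smono 0 0 (fun _ => 0).
Definition sadd (f g : ser n) : ser n := fun a b al => f a b al + g a b al.
Definition sopp (f : ser n) : ser n := fun a b al => - f a b al.
Definition ssub (f g : ser n) : ser n := sadd f (sopp g).
Definition sscale (c : int) (f : ser n) : ser n := fun a b al => c * f a b al.

(* Cauchy product: the (in the relevant cases finite) convolution sum,
   computed as the eventual value of the sums over growing windows *)
Definition smul (f g : ser n) : ser n := fun a b al =>
  evlim (fun N => \sum_(a1 < a.+1) \sum_(b1 <- zwin N) \sum_(al1 <- vwin n N)
           f a1 b1 al1 * g (a - a1)%N (b - b1) (fun i => al i - al1 i)).

Definition spow (f : ser n) (k : nat) : ser n := iter k (smul f) sone.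

Definition slim (u : nat -> ser n) : ser n := fun a b al => evlim (fun M => u M a b al).

Definition wsupp (f : ser n) : Prop :=
  forall a, exists b0 : int, forall b al, b < b0 -> f a b al = 0.

Definition sinv (f : ser n) : ser n :=
  epsilon (inhabits szero) (fun g => wsupp g /\ smul f g = sone).
Definition sdiv (f g : ser n) : ser n := smul f (sinv g).

Definition zS : ser n := smono 1 0 (fun _ => 0).
Definition qS : ser n := smono 0 1 (fun _ => 0).
Definition qpow (b : int) : ser n := smono 0 b (fun _ => 0).
Definition zpow (a : nat) : ser n := smono a 0 (fun _ => 0).

Definition poch (f g : ser n) (M : nat) : ser n :=
  \big[smul/sone]_(k < M) ssub sone (smul f (spow g k)).
Definition pochinf (f g : ser n) : ser n := slim (poch f g).
End Ser.

Unset Implicit Arguments.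

Definition xratio {n} (i j : 'I_n) : ser n :=
  smono 0 0 (fun l => (if l == i then 1 else 0) - (if l == j then 1 else 0)).
Definition xpow {n} (i : 'I_n) (k : int) : ser n :=
  smono 0 0 (fun l => if l == i then k else 0).

Definition Fkn (n : nat) (k : int) : ser n :=
  smul (\big[@smul n/@sone n]_(i : 'I_n) \big[@smul n/@sone n]_(j : 'I_n | i != j)
          sdiv (pochinf (xratio i j) (@qS n)) (pochinf (smul (@zS n) (xratio i j)) (@qS n)))
       (\big[@sadd n/@szero n]_(i : 'I_n) xpow i k).

Definition lastexp (n : nat) : ('I_n -> int) -> int :=
  match n as n0 return ('I_n0 -> int) -> int with
  | 0 => fun _ => 0
  | p.+1 => fun al => al ord_max
  end.

(* substitution x_n := (x_1 ... x_{n-1})^{-1}:  x^al |-> prod_{j<n-1} x_j^(al_j - al_n) *)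
Definition substlast (n : nat) (F : ser n) : ser n.-1 := fun a b be =>
  evlim (fun N => \sum_(al <- vwin n N |
            [forall j : 'I_n.-1, al (widen_ord (leq_pred n) j) - lastexp n al == be j])
            F a b al).

Definition cterm (n : nat) (G : ser n) : ser 0 := fun a b _ => G a b (fun _ => 0).

Definition Ck (n : nat) (k : int) : ser 0 := cterm n.-1 (substlast n (Fkn n k)).

(* right-hand side for C_{nm}(z), as an element of Z((q))[[z]] *)
Definition Crhs (n : nat) (m : int) : ser 0 :=
  let z := @zS 0 in let q := @qS 0 in
  let one := @sone 0 in
  let Pi := @smul 0 in
  smul (sscale (n`!%:Z * (-1) ^ ((n.-1)%:Z * m)) (@qpow 0 ((n.-1)%:Z * ((m * (m - 1)) %/ 2)%Z)))
  (smul
    (sadd one (\big[@sadd 0/@szero 0]_(1 <= l < n)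
       \big[Pi/one]_(1 <= i < l.+1)
          sdiv (smul (ssub (@qpow 0 m) (@zpow 0 i)) (ssub one (@zpow 0 (n - i))))
               (smul (ssub one (smul (@qpow 0 m) (@zpow 0 (n - i)))) (ssub one (@zpow 0 i)))))
  (smul
    (sdiv (spow (pochinf z q) n.-1)
          (smul (spow (pochinf q q) (n - 2))
                (smul (pochinf (smul q (@zpow 0 n.-1)) q) (poch z z n.-1))))
    (\big[Pi/one]_(1 <= i < n)
       sdiv (smul (pochinf (smul (@zpow 0 i) (@qpow 0 (1 - m))) q)
                  (pochinf (smul (@zpow 0 i) (@qpow 0 m)) q))
            (smul (pochinf (@zpow 0 i.+1) q)
                  (pochinf (smul (@zpow 0 i.-1) q) q))))).

(* Main.v *)
(** Write [t = z], [D(y) = (y; q)_oo / (t y; q)_oo], let [Delta] be the product of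
    [D(x_i / x_j)] over [i <> j], and let [Delta'] be the product of
    [D(x_i / x_j) D(q x_j / x_i)] over [i < j].  As [F_(k,n)] is homogeneous of degree
    [k], the coefficient extracted vanishes unless [k = n m], and then it is the constant
    term (CT) of [p_(n m) (x_1 ... x_n)^-m Delta], with [p] the power sum.

    Two relations govern [CT (g Delta')]: it vanishes for [g = (t x_i - x_(i+1)) h] with
    [h] symmetric in [x_i, x_(i+1)], and it is invariant under the substitution
    [x_1 -> x_2 -> ... -> x_n -> q^-1 x_1], which fixes [Delta'].  By the second one the
    [n] terms of the power sum contribute a geometric progression of ratio [q^m].  By both,
    raising the exponents one at a time, the term of [x_n] satisfies a first-order
    recursion in [m].

    The initial value [CT Delta'] is found by induction on [n].  If the factors
    [D(x_i / x_n)] are replaced by [(x_i / x_n; q)_oo / (A x_i / x_n; q)_oo], the constant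
    term [I(A)] satisfies [(1 - q A) I(q A) = (1 - q A t^(n-1)) I(A)].  Along [A = q^M] it
    starts from the constant term for [n - 1] variables, along [A = t q^M] from the one for
    [n] variables, and both sequences have the same limit [I(0)].

    Antisymmetrization replaces [Delta'] by [Delta], at the cost of the factor
    [n! / [n]_t!].  The bracket in the formula is summed in closed form by recursion on [n]
    with the Pascal rules for Gaussian binomials. *)

Require Import Defs.
From Stdlib Require Import ClassicalEpsilon.
From HB Require Import structures.
From mathcomp Require Import all_boot all_order all_fingroup all_algebra.
From mathcomp Require Import boolp classical_sets cardinality fsbigop.
From mathcomp Require Import zify ring.
Set Implicit Arguments. Unset Strict Implicit. Unset Printing Implicit Defensive.
Import Order.TTheory GRing.Theory Num.Theory.
Local Open Scope ring_scope.

(** * Convolution of series on the exponent lattice *)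

(** Each power of [z] in the weights carries infinitely many monomials in [x], so a product of
    series need not be a finite sum, and the argument also rescales variables by [q]. The ring
    [gser] is shaped for both: at bounded [z]-degree the exponent of [q] must outgrow every multiple
    of the [x]-weight. The infinite products qualify because the [x^N] part of [(x; q)_oo] carries
    [q^(N(N-1)/2)]. The units needed are monomials, series [1 + O(z)] and [(q; q)_oo]; identities
    are proved multiplied out and such units are cancelled at the end.

    [Delta'] carries a [q] on one of any two opposite factors, so that the rotation of the variables
    permutes its factors. It is no longer symmetric; the relation with [t x_i - x_(i+1)] is what
    remains of the symmetry.

    Indices start at 0: [N] variables rotate and [sp] marks a further one. With [y_i = x_i / x_sp]
    the products [y_0 ... y_(l-1)], for [l] from 0 to [N], interpolate between the exponents [m] and
    [m - 1]. The rotation links the product of length [l] to that of length [l + 1], once the other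
    relation has moved the new factor to the place [l]. *)

Notation idx n := (int * int * {ffun 'I_n -> int})%type.

(** The value is 0 when the support is infinite; [fsumE] turns the sum into one over any
    duplicate-free list that contains the support. *)
Definition fsum (T : choiceType) (F : T -> int) : int :=
  \sum_(u \in [set: T]%classic) F u.

Lemma fsumE (T : choiceType) (r : seq T) (F : T -> int) :
  uniq r -> (forall u, F u != 0 -> u \in r) -> fsum F = \sum_(u <- r) F u.
Proof.
move=> ur Fr; rewrite /fsum (fsbigE r) //.
- by apply: eq_bigl => i; rewrite in_setT.
- by move=> i _; apply: contraNeq => /Fr.
Qed.

Lemma eq_fsum (T : choiceType) (F H : T -> int) : F =1 H -> fsum F = fsum H.
Proof. by move=> /funext ->. Qed.

Lemma fsum_neq0 (T : choiceType) (F : T -> int) :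
  fsum F != 0 -> exists u, F u != 0.
Proof.
move=> F0; case: (pselect (exists u, F u != 0)) => // nF.
case/eqP: F0; apply: fsbig1 => u _; apply/eqP; apply/negPn/negP => Fu.
by apply: nF; exists u.
Qed.

Lemma exchange_fsum (T : choiceType) (r : seq T) (F : T -> T -> int) :
  uniq r -> (forall u v : T, F u v != 0 -> u \in r /\ v \in r) ->
  fsum (fun u => fsum (F u)) = fsum (fun v => fsum (fun u => F u v)).
Proof.
move=> ur hr.
have h u : fsum (F u) = \sum_(v <- r) F u v.
  by apply: fsumE => // v /hr[].
have k v : fsum (fun u => F u v) = \sum_(u <- r) F u v.
  by apply: fsumE => // u /hr[].
rewrite (eq_fsum h) (eq_fsum k) (fsumE ur) ?(fsumE (F := fun v => \sum_(u <- r) F u v) ur).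
- exact: exchange_big.
- by move=> v; rewrite -k => /fsum_neq0[u /hr[]].
- by move=> v; rewrite -h => /fsum_neq0[u /hr[]].
Qed.

Section Supports.
Variable n : nat.
Implicit Types (F H K : idx n -> int) (P Q : idx n -> Prop) (c u v : idx n).

Definition wt (al : {ffun 'I_n -> int}) : nat := \sum_i `|al i|%N.

Lemma wtD (al be : {ffun 'I_n -> int}) : (wt (al + be)%R <= wt al + wt be)%N.
Proof.
rewrite /wt -big_split /=; apply: leq_sum => i _; rewrite ffunE.
by move: (al i) (be i) => a b; lia.
Qed.

Lemma wt_ge (al : {ffun 'I_n -> int}) i : (`|al i| <= wt al)%N.
Proof. by rewrite /wt (bigD1 i) //= leq_addr. Qed.

Lemma wt0 : wt 0 = 0%N.
Proof. by rewrite /wt big1 // => i _; rewrite ffunE. Qed.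

(** [vwin] with finite functions, which unlike plain functions have decidable equality; [vwinE]
    relates the two. *)
Definition fvwin (L : nat) : seq {ffun 'I_n -> int} :=
  [seq [ffun i => (val ((t : {ffun 'I_n -> 'I_(L.*2.+1)}) i))%:Z - L%:Z]
     | t <- enum {ffun 'I_n -> 'I_(L.*2.+1)}].

Definition box (L : nat) : seq (idx n) :=
  [seq (ab.1, ab.2, al) | ab <- [seq (a, b) | a <- zwin L, b <- zwin L],
                          al <- fvwin L].

Lemma zwin_uniq L : uniq (zwin L).
Proof. by rewrite map_inj_uniq ?iota_uniq // => i j; lia. Qed.

Lemma mem_zwin L (a : int) : (a \in zwin L) = (`|a| <= L)%N.
Proof.
apply/mapP/idP => [[i]|aL].
  by rewrite mem_iota => ? ->; lia.
by exists (absz (a + L%:Z)); rewrite ?mem_iota; lia.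
Qed.

Lemma fvwin_uniq L : uniq (fvwin L).
Proof.
rewrite map_inj_uniq ?enum_uniq // => s t /ffunP st; apply/ffunP => i.
by have := st i; rewrite !ffunE /= => h; apply/val_inj => /=; move: (s i) (t i) h => [a ?] [b ?] /=; lia.
Qed.

Lemma mem_fvwin L (al : {ffun 'I_n -> int}) :
  (al \in fvwin L) = [forall i, `|al i| <= L]%N.
Proof.
apply/mapP/forallP => [[t _ ->] i|h].
  by rewrite ffunE /=; case: (t i) => a ? /=; lia.
exists [ffun i => inord (absz (al i + L%:Z))]; rewrite ?mem_enum //.
by apply/ffunP => i; rewrite !ffunE /= inordK; have := h i; move: (al i) => a; lia.
Qed.

Lemma box_uniq L : uniq (box L).
Proof.
apply: allpairs_uniq; rewrite ?fvwin_uniq //.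
  by apply: allpairs_uniq; rewrite ?zwin_uniq // => -[? ?] [? ?].
by case=> [[? ?] ?] [[? ?] ?] _ _ /= [-> -> ->].
Qed.

Lemma mem_box L c :
  (c \in box L) = [&& (`|c.1.1| <= L)%N, (`|c.1.2| <= L)%N
                    & [forall i, `|c.2 i| <= L]%N].
Proof.
case: c => [[a b] al] /=; rewrite -mem_fvwin -!mem_zwin.
apply/allpairsP/idP => [[[[a' b'] al'] [h alL E]]|].
  case/(allpairsP (f := fun x y => (x, y))): h => [[x y] /= [xa yb [ex ey]]].
  by case: E => -> -> ->; rewrite ex ey; apply/and3P.
case/and3P=> ? ? ?; exists ((a, b), al); split=> //.
by apply/allpairsP; exists (a, b).
Qed.

Lemma box_le L M c : (L <= M)%N -> c \in box L -> c \in box M.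
Proof.
rewrite !mem_box => LM /and3P[? ? /forallP h]; apply/and3P; split; try lia.
by apply/forallP => i; have := h i; move: (c.2 i) => a; lia.
Qed.

(* [wsup] only asks for a lower bound on the exponent of [q]: this is all that is
   known of the inverse chosen by [sinv], and [convA] admits such a third factor. *)
Definition wsup P : Prop := (forall c, P c -> 0 <= c.1.1) /\
  forall a : int, exists b0 : int, forall c, P c -> c.1.1 <= a -> b0 <= c.1.2.

(* The slope [s] is arbitrary so that the class is stable under the
   substitutions [x^al |-> q^(la . al) x^al]; slope 1 already makes every
   coefficient of [z^a q^b] a Laurent polynomial. *)
Definition gsup P : Prop := (forall c, P c -> 0 <= c.1.1) /\
  forall (a : int) (s : nat), exists b0 : int, forall c, P c -> c.1.1 <= a ->
    (s * wt c.2)%N%:Z + b0 <= c.1.2.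

Lemma gsup_wsup P : gsup P -> wsup P.
Proof.
case=> P0 gP; split=> // a; have [b0 h] := gP a 0%N.
by exists b0 => c Pc ca; have := h c Pc ca; lia.
Qed.

Lemma gsup_sub P Q : (forall c, P c -> Q c) -> gsup Q -> gsup P.
Proof.
move=> PQ [Q0 gQ]; split=> [c /PQ/Q0//|a s].
by have [b0 h] := gQ a s; exists b0 => c /PQ; apply: h.
Qed.

Lemma wsup_sub P Q : (forall c, P c -> Q c) -> wsup Q -> wsup P.
Proof.
move=> PQ [Q0 gQ]; split=> [c /PQ/Q0//|a].
by have [b0 h] := gQ a; exists b0 => c /PQ; apply: h.
Qed.

Lemma gsupU P Q : gsup P -> gsup Q -> gsup (fun c => P c \/ Q c).
Proof.
move=> [P0 gP] [Q0 gQ]; split=> [c [/P0|/Q0]//|a s].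
have [b0 h] := gP a s; have [b1 k] := gQ a s; exists (- (`|b0|%N + `|b1|%N)%:Z).
by move=> c [/h|/k] /[apply]; lia.
Qed.

Definition sumset P Q c := exists u v, [/\ P u, Q v & c = u + v].

Lemma gsupD P Q : gsup P -> gsup Q -> gsup (sumset P Q).
Proof.
move=> [P0 gP] [Q0 gQ]; split=> [c [u [v [/P0 ? /Q0 ? ->]]]/=|a s]; first lia.
have [b0 h] := gP a s; have [b1 k] := gQ a s; exists (b0 + b1).
move=> _ [u [v [Pu Qv ->]]] /= le_a; have := P0 _ Pu; have := Q0 _ Qv => q0 p0.
have := h _ Pu ltac:(lia); have := k _ Qv ltac:(lia); have := wtD u.2 v.2.
by nia.
Qed.

Lemma wsupD P Q : wsup P -> wsup Q -> wsup (sumset P Q).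
Proof.
move=> [P0 gP] [Q0 gQ]; split=> [c [u [v [/P0 ? /Q0 ? ->]]]/=|a]; first lia.
have [b0 h] := gP a; have [b1 k] := gQ a; exists (b0 + b1).
move=> _ [u [v [Pu Qv ->]]] /= le_a; have := P0 _ Pu; have := Q0 _ Qv => q0 p0.
by have := h _ Pu ltac:(lia); have := k _ Qv ltac:(lia); lia.
Qed.

(** Why convolutions are finite: the lower bound on [Q] caps the exponent of [q] in [u] from above,
    and the slope 1 bound on [P] turns this cap into a bound on the weight of [u]. *)
Lemma gsup_fin P Q c : gsup P -> wsup Q ->
  exists L, forall u, P u -> Q (c - u) -> u \in box L.
Proof.
move=> [P0 gP] [Q0 gQ]; have [b0 h] := gP c.1.1 1%N; have [b1 k] := gQ c.1.1.
exists (`|c.1.1| + `|c.1.2| + `|b0| + `|b1|)%N => u Pu Qu.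
have := P0 _ Pu; have := Q0 _ Qu => /= q0 p0.
have := h _ Pu ltac:(lia); have /= := k _ Qu ltac:(move=> /=; lia) => b1u b0u.
rewrite mem_box; apply/and3P; split; try lia.
by apply/forallP => i; have := wt_ge u.2 i; lia.
Qed.

Definition nz F c : Prop := F c != 0.
Definition good F := gsup (nz F).
Definition weak F := wsup (nz F).

Definition conv F H c : int := fsum (fun u => F u * H (c - u)).

Lemma conv_box F H c : good F -> weak H ->
  exists L, forall M, (L <= M)%N ->
    conv F H c = \sum_(u <- box M) F u * H (c - u).
Proof.
move=> gF wH; have [L hL] := gsup_fin c gF wH; exists L => M LM.
apply: fsumE (box_uniq _) _ => u; rewrite mulf_eq0 negb_or => /andP[? ?].
exact: box_le (hL _ _ _).
Qed.

Lemma conv_nz F H c : nz (conv F H) c -> sumset (nz F) (nz H) c.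
Proof.
case/fsum_neq0 => u; rewrite mulf_eq0 negb_or => /andP[? ?].
by exists u, (c - u); split=> //; rewrite addrC subrK.
Qed.

Lemma good_conv F H : good F -> good H -> good (conv F H).
Proof. by move=> gF gH; apply: gsup_sub (gsupD gF gH) => c /conv_nz. Qed.

Lemma weak_conv F H : weak F -> weak H -> weak (conv F H).
Proof. by move=> gF gH; apply: wsup_sub (wsupD gF gH) => c /conv_nz. Qed.

Lemma fsum_shift (F : idx n -> int) u : fsum (fun v => F (v - u)) = fsum F.
Proof.
rewrite /fsum [RHS](reindex_fsbigT (fun v => v - u)) //.
by exists (fun v => v + u) => v; rewrite ?addrK ?subrK.
Qed.

Lemma fsum_opp (F : idx n -> int) u : fsum (fun v => F (u - v)) = fsum F.
Proof.
rewrite /fsum [RHS](reindex_fsbigT (fun v => u - v)) //.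
by exists (fun v => u - v) => v; rewrite opprB addrC subrK.
Qed.

Lemma convC F H : conv F H = conv H F.
Proof.
apply/funext => c; rewrite /conv -[LHS](fsum_opp _ c); apply: eq_fsum => u.
by rewrite subKr mulrC.
Qed.

Lemma convA F H K : good F -> good H -> weak K ->
  conv F (conv H K) = conv (conv F H) K.
Proof.
move=> gF gH wK; apply/funext => c.
have [L1 h1] := gsup_fin c gF (wsupD (gsup_wsup gH) wK).
have [L2 h2] := gsup_fin c (gsupD gF gH) wK.
transitivity (fsum (fun u => fsum (fun w => F u * H (w - u) * K (c - w)))).
  apply: eq_fsum => u; rewrite {1}/conv -(fsum_shift _ u) /fsum mulr_fsumr.
  by apply: eq_fsum => w; rewrite opprB subrKA mulrA.
rewrite (exchange_fsum (box_uniq (L1 + L2))).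
  by apply: eq_fsum => w; rewrite /conv /fsum mulr_fsuml.
move=> u w; rewrite !mulf_eq0 !negb_or -andbA => /and3P[Fu Hu Kw]; split.
  apply: box_le (leq_addr _ _) (h1 _ Fu _); exists (w - u), (c - w).
  by split=> //; rewrite [RHS]addrC subrKA.
apply: box_le (leq_addl _ _) (h2 _ _ Kw); exists u, (w - u).
by split=> //; rewrite [RHS]addrC subrK.
Qed.

Lemma good0 : good (fun=> 0).
Proof. by split=> [c /eqP|a s] //; exists 0 => c /eqP. Qed.

Lemma goodD F H : good F -> good H -> good (fun c => F c + H c).
Proof.
move=> gF gH; apply: gsup_sub (gsupU gF gH) => c; rewrite /nz => /eqP FH.
case: (eqVneq (F c) 0) => F0; [right|by left].
by apply/eqP => H0; rewrite F0 H0 in FH.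
Qed.

Lemma goodN F : good F -> good (fun c => - F c).
Proof. by apply: gsup_sub => c; rewrite /nz oppr_eq0. Qed.

Definition monf (g : idx n) : idx n -> int := fun c => (c == g)%:R.

Lemma good_monf g : 0 <= g.1.1 -> good (monf g).
Proof.
move=> g0; have E c : nz (monf g) c -> c = g.
  by rewrite /nz /monf; case: (c =P g).
split=> [c /E-> //|a s].
by exists (g.1.2 - (s * wt g.2)%N%:Z) => c /E -> _; rewrite addrC subrK.
Qed.

Lemma conv_mon g F c : conv (monf g) F c = F (c - g).
Proof.
rewrite /conv (fsumE (r := [:: g])) ?big_seq1 /monf ?eqxx ?mul1r // => u.
by rewrite inE; case: (u == g); rewrite ?mul0r ?eqxx.
Qed.

Lemma convDl F H K : good F -> good H -> weak K ->
  conv (fun c => F c + H c) K = fun c => conv F K c + conv H K c.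
Proof.
move=> gF gH wK; apply/funext => c.
have [L1 h1] := conv_box c gF wK; have [L2 h2] := conv_box c gH wK.
have [L3 h3] := conv_box c (goodD gF gH) wK.
set L := (L1 + L2 + L3)%N.
rewrite (h1 L) 1?(h2 L) 1?(h3 L); try by rewrite /L; lia.
by rewrite -big_split; apply: eq_bigr => u _; rewrite mulrDl.
Qed.

End Supports.

(** * The ring of series *)

Record gser n := Gser { gval :> idx n -> int; gvalP : good gval }.

HB.instance Definition _ n := gen_eqMixin (gser n).
HB.instance Definition _ n := gen_choiceMixin (gser n).

Section Ring.
Variable n : nat.
Implicit Types f g h : gser n.

Lemma gserP f g : (f : idx n -> int) =1 g -> f = g.
Proof.
case: f g => [f gf] [g gg] /= /funext fg; rewrite {}fg in gf *.
by congr Gser; apply: Prop_irrelevance.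
Qed.

Definition gzero := Gser (@good0 n).
Definition gadd f g := Gser (goodD (gvalP f) (gvalP g)).
Definition gopp f := Gser (goodN (gvalP f)).
Lemma gaddA : associative gadd.
Proof. by move=> f g h; apply: gserP => c /=; rewrite addrA. Qed.
Lemma gaddC : commutative gadd.
Proof. by move=> f g; apply: gserP => c /=; rewrite addrC. Qed.
Lemma gadd0 : left_id gzero gadd.
Proof. by move=> f; apply: gserP => c /=; rewrite add0r. Qed.
Lemma gaddN : left_inverse gzero gopp gadd.
Proof. by move=> f; apply: gserP => c /=; rewrite addNr. Qed.
HB.instance Definition _ := GRing.isZmodule.Build (gser n) gaddA gaddC gadd0 gaddN.

Definition gmul f g := Gser (good_conv (gvalP f) (gvalP g)).
Definition mon (g : idx n) (g0 : 0 <= g.1.1) := Gser (good_monf g0).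
Definition gone := @mon 0 (lexx 0).
Lemma gmulA : associative gmul.
Proof.
move=> f g h; apply: gserP => c; congr (_ c).
by apply: convA; [exact: gvalP | exact: gvalP | exact: gsup_wsup (gvalP h)].
Qed.
Lemma gmulC : commutative gmul.
Proof. by move=> f g; apply: gserP => c; rewrite /= convC. Qed.
Lemma gmul1 : left_id gone gmul.
Proof. by move=> f; apply: gserP => c; rewrite /= conv_mon subr0. Qed.
Lemma gmulD : left_distributive gmul gadd.
Proof.
move=> f g h; apply: gserP => c.
by rewrite /= convDl //; [exact: gvalP | exact: gvalP | exact: gsup_wsup (gvalP h)].
Qed.
Lemma gone_neq0 : gone != gzero.
Proof. by apply/eqP => /(congr1 (fun f : gser n => f 0)); rewrite /= /monf eqxx. Qed.
HB.instance Definition _ := GRing.Zmodule_isComNzRing.Build (gser n)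
  gmulA gmulC gmul1 gmulD gone_neq0.

Definition gunit f : bool := `[< exists g, g * f = 1 >].
Definition ginv f : gser n :=
  match pselect (exists g, g * f = 1) with
  | left h => sval (cid h)
  | right _ => f
  end.
Lemma gmulV : {in gunit, left_inverse 1 ginv *%R}.
Proof.
move=> f /asboolP uf; rewrite /ginv; case: pselect => // h.
by case: cid.
Qed.
Lemma gunitPl f g : g * f = 1 -> gunit f.
Proof. by move=> gf; apply/asboolP; exists g. Qed.
Lemma ginv_out : {in [predC gunit], ginv =1 id}.
Proof. by move=> f /asboolPn nf; rewrite /ginv; case: pselect. Qed.
HB.instance Definition _ := GRing.ComNzRing_hasMulInverse.Build (gser n)
  gmulV gunitPl ginv_out.

Lemma gaddE f g c : (f + g) c = f c + g c. Proof. by []. Qed.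
Lemma goppE f c : (- f) c = - f c. Proof. by []. Qed.
Lemma gmulE f g c : (f * g) c = conv f g c. Proof. by []. Qed.
Lemma gvalM f g : conv f g = (f * g : gser n). Proof. by []. Qed.
Lemma gval1 : gval 1 = monf 0. Proof. by []. Qed.
Lemma gzeroE c : (0 : gser n) c = 0. Proof. by []. Qed.
Lemma goneE c : (1 : gser n) c = (c == 0)%:R. Proof. by []. Qed.

Lemma gsumE (I : Type) (r : seq I) (P : pred I) (F : I -> gser n) c :
  (\sum_(i <- r | P i) F i) c = \sum_(i <- r | P i) F i c.
Proof. by elim/big_rec2: _ => // i x y _ <-. Qed.

Lemma unitrP_ex f : (exists g, f * g = 1) -> f \is a GRing.unit.
Proof. by case=> g fg; apply/unitrPr; exists g. Qed.

End Ring.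

(* [X b al] stands for the monomial [q^b x^al]; [Z] and [Q] are the series [z] and [q]. *)
Lemma X_ge0 n b (al : {ffun 'I_n -> int}) : 0 <= ((0, b, al) : idx n).1.1.
Proof. by []. Qed.
Definition X n b (al : {ffun 'I_n -> int}) : gser n := mon (@X_ge0 n b al).
Lemma Z_ge0 n : 0 <= ((1, 0, 0) : idx n).1.1. Proof. by []. Qed.
Definition Z n : gser n := mon (Z_ge0 n).

Section Mon.
Variable n : nat.
Implicit Types (f g : gser n) (al be : {ffun 'I_n -> int}).

Lemma mon_mulE (g : idx n) (g0 : 0 <= g.1.1) f c : (mon g0 * f) c = f (c - g).
Proof. exact: conv_mon. Qed.

Lemma monE (g : idx n) (g0 : 0 <= g.1.1) c : mon g0 c = (c == g)%:R.
Proof. by []. Qed.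

Lemma X_mulE b al f c : (X b al * f) c = f (c - (0, b, al)).
Proof. exact: mon_mulE. Qed.

Lemma monM (g h : idx n) (g0 : 0 <= g.1.1) (h0 : 0 <= h.1.1) (gh0 : 0 <= (g + h).1.1) :
  mon g0 * mon h0 = mon gh0.
Proof.
by apply: gserP => c; rewrite mon_mulE /= /monf subr_eq addrC.
Qed.

Lemma mon_eq (g h : idx n) (g0 : 0 <= g.1.1) (h0 : 0 <= h.1.1) :
  g = h -> mon g0 = mon h0.
Proof. by move=> E; apply: gserP => c; rewrite /= E. Qed.

Lemma XM b b' al be : X b al * X b' be = X (b + b') (al + be).
Proof. by apply: gserP => c; rewrite mon_mulE /= /monf subr_eq addrC. Qed.
Lemma X00 : X 0 (0 : {ffun 'I_n -> int}) = 1.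
Proof. exact: mon_eq. Qed.
Lemma X_unit b al : X b al \is a GRing.unit.
Proof. by apply: unitrP_ex; exists (X (- b) (- al)); rewrite XM !subrr X00. Qed.
Lemma XV b al : (X b al)^-1 = X (- b) (- al).
Proof. by apply: (mulrI (X_unit b al)); rewrite divrr ?X_unit // XM !subrr X00. Qed.
Lemma XX b al k : X b al ^+ k = X (b *+ k) (al *+ k).
Proof. by elim: k => [|k IH]; rewrite ?X00 // exprS IH XM !mulrS. Qed.
End Mon.
#[global] Opaque gadd gopp gmul ginv gunit.

(** * Limits and units *)

Section Limits.
Variable n : nat.
Implicit Types (f g : gser n) (U V : nat -> gser n) (L K : gser n) (c u v : idx n).
Implicit Types P Q : idx n -> Prop.

Definition supported P f := forall c, nz f c -> P c.

Lemma supported0 P : supported P 0.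
Proof. by move=> c; rewrite /nz gzeroE eqxx. Qed.

Lemma supportedD P f g : supported P f -> supported P g -> supported P (f + g).
Proof.
move=> Pf Pg c; rewrite /nz gaddE => fg; case: (eqVneq (f c) 0) => [f0|/Pf//].
by apply: Pg; move: fg; rewrite f0 add0r.
Qed.

Lemma supportedN P f : supported P f -> supported P (- f).
Proof. by move=> Pf c; rewrite /nz goppE oppr_eq0; apply: Pf. Qed.

Lemma supportedM P Q (R : idx n -> Prop) f g :
  (forall u v, P u -> Q v -> R (u + v)) ->
  supported P f -> supported Q g -> supported R (f * g).
Proof. by move=> PQR Pf Qg c /conv_nz[u [v [/Pf ? /Qg ? ->]]]; apply: PQR. Qed.

Lemma supported_sum P I (r : seq I) (F : I -> gser n) :
  (forall i, supported P (F i)) -> supported P (\sum_(i <- r) F i).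
Proof.
by move=> PF; elim/big_rec: _ => [|i x _]; [exact: supported0|exact: supportedD].
Qed.

Lemma supported_mon (g : idx n) (g0 : 0 <= g.1.1) P : P g -> supported P (mon g0).
Proof. by move=> Pg c; rewrite /nz /= /monf; case: (c =P g) => [->|]. Qed.

Definition usupp U : idx n -> Prop := fun c => exists M, nz (U M) c.
Definition ugood U := gsup (usupp U).
(** Coefficients are eventually constant, and one growth bound holds for all supports together. The
    second condition keeps the limit in the ring and makes multiplication continuous. *)
Definition gcvg U L := ugood U /\
  forall c, exists M0, forall M, (M0 <= M)%N -> U M c = L c.

Lemma gcvg_supp U L P : gcvg U L -> (forall M, supported P (U M)) -> supported P L.
Proof.
move=> [_ UL] PU c; have [M0 h] := UL c; rewrite /nz -(h _ (leqnn _)); exact: PU.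
Qed.

Lemma gcvg_usupp U L : gcvg U L -> supported (usupp U) L.
Proof. by move=> UL; apply: (gcvg_supp UL) => M c ?; exists M. Qed.

Lemma gcvg_unique U L K : gcvg U L -> gcvg U K -> L = K.
Proof.
move=> [_ UL] [_ UK]; apply: gserP => c; have [M0 h] := UL c; have [M1 k] := UK c.
by rewrite -(h (M0 + M1)%N) ?leq_addr // -(k (M0 + M1)%N) ?leq_addl.
Qed.

Lemma gcvg_ex U : ugood U ->
  (forall c, exists M0, forall M, (M0 <= M)%N -> U M c = U M0 c) ->
  exists L, gcvg U L.
Proof.
move=> gU h; pose F c := U (sval (cid (h c))) c.
have FE c : exists M0, forall M, (M0 <= M)%N -> U M c = F c.
  by rewrite /F; case: cid => M0 /= hM; exists M0.
have gF : good F.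
  by apply: gsup_sub gU => c; have [M0 h0] := FE c; exists M0; rewrite /nz h0.
by exists (Gser gF); split.
Qed.

Lemma gcvg_cst f : gcvg (fun=> f) f.
Proof.
split=> [|c]; last by exists 0%N.
by apply: gsup_sub (gvalP f) => c [].
Qed.

Lemma gcvg_shift U L k : gcvg U L -> gcvg (fun M => U (M + k)%N) L.
Proof.
move=> [gU UL]; split=> [|c].
  by apply: gsup_sub gU => c [M ?]; exists (M + k)%N.
by have [M0 h] := UL c; exists M0 => M M0M; apply: h; apply: leq_trans (leq_addr _ _).
Qed.

Lemma gcvg_eq U V L : U =1 V -> gcvg U L -> gcvg V L.
Proof. by move=> /funext ->. Qed.

Lemma gcvg_seq U L (r : seq (idx n)) : gcvg U L ->
  exists M0, forall M, (M0 <= M)%N -> forall u, u \in r -> U M u = L u.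
Proof.
move=> [_ UL]; elim: r => [|u r [M0 h]]; first by exists 0%N.
have [M1 k] := UL u; exists (M0 + M1)%N => M le_M v; rewrite inE => /predU1P[->|].
  by apply: k; apply: leq_trans le_M; apply: leq_addl.
by apply: h; apply: leq_trans le_M; apply: leq_addr.
Qed.

Lemma gcvgM U V L K : gcvg U L -> gcvg V K -> gcvg (fun M => U M * V M) (L * K).
Proof.
move=> UL VK; split=> [|c].
  apply: gsup_sub (gsupD UL.1 VK.1) => c [M /conv_nz[u [v [? ? ->]]]].
  by exists u, v; split=> //; exists M.
have [B hB] := gsup_fin c UL.1 (gsup_wsup VK.1).
have [M0 h] := gcvg_seq (box n B) UL.
have [M1 k] := gcvg_seq [seq c - u | u <- box n B] VK.
exists (M0 + M1)%N => M le_M; rewrite !gmulE /conv !(fsumE (box_uniq _ B)).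
- apply: eq_big_seq => u uB; rewrite h //; last by apply: leq_trans le_M; apply: leq_addr.
  rewrite k //; first by apply: leq_trans le_M; apply: leq_addl.
  exact: map_f.
- move=> u; rewrite mulf_eq0 negb_or => /andP[Lu Ku].
  by apply: hB; [exact: gcvg_usupp UL _ Lu | exact: gcvg_usupp VK _ Ku].
- by move=> u; rewrite mulf_eq0 negb_or => /andP[Lu Ku]; apply: hB; exists M.
Qed.

Lemma gcvg_prod I (r : seq I) (P : pred I) (U : I -> nat -> gser n) (L : I -> gser n) :
  (forall i, P i -> gcvg (U i) (L i)) ->
  gcvg (fun M => \prod_(i <- r | P i) U i M) (\prod_(i <- r | P i) L i).
Proof.
move=> UL; elim: r => [|i r IH].
  by rewrite big_nil; apply: gcvg_eq (gcvg_cst 1) => M; rewrite big_nil.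
case Pi: (P i); rewrite big_cons Pi.
  by apply: gcvg_eq (gcvgM (UL i Pi) IH) => M; rewrite big_cons Pi.
by apply: gcvg_eq IH => M; rewrite big_cons Pi.
Qed.

Lemma gsup_bigU (P : nat -> idx n -> Prop) k : (forall i, gsup (P i)) ->
  gsup (fun c => exists2 i, (i < k)%N & P i c).
Proof.
move=> gP; elim: k => [|k IH]; first by split=> [c []|a s] //; exists 0 => c [].
apply: gsup_sub (gsupU IH (gP k)) => c [i]; rewrite ltnS leq_eqVlt => /predU1P[->|ik] Pi.
  by right.
by left; exists i.
Qed.

Lemma neumann f : ugood (fun k => f ^+ k) ->
  (forall c, exists k0 : nat, forall k, (k0 <= k)%N -> (f ^+ k) c = 0) ->
  1 - f \is a GRing.unit /\ gcvg (fun M => \sum_(k < M) f ^+ k) (1 - f)^-1.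
Proof.
move=> gf f0; pose U M := \sum_(k < M) f ^+ k.
have [L UL] : exists L, gcvg U L.
  apply: gcvg_ex => [|c].
    apply: gsup_sub gf => c [M]; apply: supported_sum => i {}c ?; by exists i.
  have [k0 h] := f0 c; exists k0 => M /subnKC <-.
  rewrite /U big_split_ord gaddE [X in _ + X]gsumE [X in _ + X]big1 ?addr0 // => i _.
  by rewrite h ?leq_addr.
have L1 : (1 - f) * L = 1.
  apply: gserP => c.
  have [M0 h] := (gcvgM (gcvg_cst (1 - f)) UL).2 c; have [k0 k] := f0 c.
  rewrite -(h (M0 + k0)%N) ?leq_addr // /U.
  have -> : (1 - f) * (\sum_(i < M0 + k0) f ^+ i) = 1 - f ^+ (M0 + k0).
    by rewrite -[RHS]opprB subrX1 -mulNr opprB.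
  by rewrite gaddE goppE k ?leq_addl // subr0.
have fu : 1 - f \is a GRing.unit by apply: unitrP_ex; exists L.
by split=> //; have -> : (1 - f)^-1 = L by apply: (mulrI fu); rewrite divrr // L1.
Qed.

Definition zpos f := supported (fun c => 1 <= c.1.1) f.
(** No [x] is allowed here: in the geometric series of [q x_i] the exponent of [q] grows only
    linearly with the [x]-weight, so that the series is not in the ring. *)
Definition qpos f := supported (fun c => [/\ c.1.1 = 0, c.2 = 0 & 1 <= c.1.2]) f.

Lemma zpos_neumann f : zpos f ->
  1 - f \is a GRing.unit /\ gcvg (fun M => \sum_(k < M) f ^+ k) (1 - f)^-1.
Proof.
move=> zf.
have zk k : supported (fun c => k%:Z <= c.1.1) (f ^+ k).
  elim: k => [|k IH]; first by apply: supported_mon.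
  rewrite exprS; apply: supportedM zf IH => -[[a ?] ?] [[b ?] ?] /=; lia.
apply: neumann => [|c].
  (* In [z]-degree at most [a] only the powers [f ^+ i] with [i <= a] contribute, hence a finite
     union of supports. *)
  have g a := gsup_bigU (absz a).+1 (fun i => gvalP (f ^+ i)).
  split=> [c [k /zk]|a s]; first by lia.
  have [_ /(_ a s)[b0 h]] := g a; exists b0 => c [k nzk] ca; apply: h => //.
  by exists k => //; have := zk _ _ nzk; lia.
exists (absz c.1.1).+1 => k le_k; apply/eqP/negPn/negP => /zk; lia.
Qed.

Lemma zpos_unit f : zpos f -> 1 - f \is a GRing.unit.
Proof. by case/zpos_neumann. Qed.

Lemma supported_neumann P f : zpos f -> P 0 -> (forall u v, P u -> P v -> P (u + v)) ->
  supported P f -> supported P (1 - f)^-1.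
Proof.
move=> /zpos_neumann[_ fV] P0 PD Pf; apply: (gcvg_supp fV) => M.
apply: supported_sum => k; elim: (k : nat) => [|i IH]; first exact: supported_mon.
by rewrite exprS; apply: supportedM PD Pf IH.
Qed.

Lemma qpos_unit f : qpos f -> 1 - f \is a GRing.unit.
Proof.
move=> qf.
have qk k : supported (fun c => [/\ c.1.1 = 0, c.2 = 0 & k%:Z <= c.1.2]) (f ^+ k).
  elim: k => [|k IH]; first by apply: supported_mon.
  rewrite exprS; apply: supportedM qf IH => -[[a ?] ?] [[b ?] ?] /= [-> -> ?] [-> -> ?].
  by split; rewrite ?addr0 //; lia.
apply: (proj1 (neumann _ _)) => [|c].
  split=> [c [k /qk[-> _ _]]//|a s]; exists 0 => c [k /qk[_ -> kc] _].
  by rewrite wt0; lia.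
exists (absz c.1.2).+1 => k le_k; apply/eqP/negPn/negP => /qk[_ _]; lia.
Qed.
End Limits.

(** * Infinite products *)

Definition Q n : gser n := X 1 0.

Section Poch.
Variable n : nat.
Implicit Types (f g : gser n) (c u v : idx n).
Local Notation q := (Q n).
Local Notation z := (Z n).

Definition gpoch f g M : gser n := \prod_(k < M) (1 - f * g ^+ k).

Lemma gpochS f g M : gpoch f g M.+1 = gpoch f g M * (1 - f * g ^+ M).
Proof. by rewrite /gpoch big_ord_recr. Qed.

Lemma gpochSl f g M : gpoch f g M.+1 = (1 - f) * gpoch (f * g) g M.
Proof.
rewrite /gpoch big_ord_recl expr0 mulr1; congr (_ * _).
by apply: eq_bigr => i _; rewrite -mulrA -exprS.
Qed.

Lemma gpochD f g M k : gpoch f g (M + k) = gpoch f g M * gpoch (f * g ^+ M) g k.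
Proof.
rewrite /gpoch big_split_ord /=; congr (_ * _).
by apply: eq_bigr => i _; rewrite exprD mulrA.
Qed.

Definition ismon f := exists (g : idx n) (g0 : 0 <= g.1.1), f = mon g0.

Lemma ismonX b al : ismon (X b al). Proof. by eexists; eexists. Qed.
Lemma ismonZ : ismon z. Proof. by eexists; eexists. Qed.
Lemma ismonQ : ismon q. Proof. exact: ismonX. Qed.
Lemma ismon1 : ismon 1. Proof. by exists 0, (lexx 0). Qed.
Lemma ismonM f g : ismon f -> ismon g -> ismon (f * g).
Proof.
move=> [u [u0 ->]] [v [v0 ->]].
have uv0 : 0 <= (u + v).1.1 by rewrite addr_ge0.
by exists (u + v), uv0; apply: monM.
Qed.
Lemma ismonXn f k : ismon f -> ismon (f ^+ k).
Proof.
by move=> mf; elim: k => [|k IH]; [exact: ismon1|rewrite exprS; apply: ismonM].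
Qed.

Lemma Q_expE k : q ^+ k = X k%:Z 0.
Proof. by rewrite XX mul0rn; congr X; rewrite -mulr_natr mul1r natz. Qed.

(* The [x^N] part of a (partial) product is divisible by [q^(N(N-1)/2)]. *)
Definition gauss (g : idx n) M k : idx n -> Prop := fun c => exists N e : nat,
  [/\ (N <= M)%N, (N * N <= e.*2 + N)%N & c = g *+ (N + k) + (0, (e + k * M)%N%:Z, 0)].

Lemma gauss_shift (g : idx n) (g0 : 0 <= g.1.1) M f :
  supported (gauss g M 0) f -> supported (gauss g M 1) (f * (mon g0 * q ^+ M)).
Proof.
move=> sf; rewrite Q_expE.
apply: (supportedM (Q := fun c => c = g + (0, M%:Z, 0)) _ sf); last first.
  by apply: (supportedM (P := fun c => c = g) (Q := fun c => c = (0, M%:Z, 0)));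
    [move=> _ _ -> -> | exact: supported_mon | exact: supported_mon].
move=> _ _ [N [e [? ? ->]]] ->; exists N, e; split=> //.
rewrite addn0 addn1 mulrSr mul0n mul1n addn0 PoszD addrACA; congr (_ + _).
by congr (_, _, _); rewrite /= ?addr0.
Qed.

Lemma gpoch_supp (g : idx n) (g0 : 0 <= g.1.1) M :
  supported (gauss g M 0) (gpoch (mon g0) q M).
Proof.
elim: M => [|M IH].
  by rewrite /gpoch big_ord0; apply: supported_mon; exists 0%N, 0%N; split=> //; rewrite mulr0n add0r.
rewrite gpochS mulrBr mulr1; apply: supportedD.
  by move=> c /IH[N [e [? ? ->]]]; exists N, e; split=> //; lia.
apply: supportedN => c /(gauss_shift IH)[N [e [? ? ->]]].
by exists N.+1, (e + M)%N; split; rewrite ?mul0n ?addn0 ?addn1 ?mul1n //; lia.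
Qed.

Lemma mulrn_fst (g : idx n) N : (g *+ N).1.1 = g.1.1 *+ N.
Proof. by elim: N => // N IH; rewrite !mulrS /= IH. Qed.
Lemma mulrn_snd (g : idx n) N : (g *+ N).1.2 = g.1.2 *+ N.
Proof. by elim: N => // N IH; rewrite !mulrS /= IH. Qed.
Lemma intMn (b : int) N : b *+ N = N%:Z * b.
Proof. by rewrite -mulr_natl natz. Qed.
Lemma mulrn_al (g : idx n) N : (g *+ N).2 = g.2 *+ N.
Proof. by elim: N => // N IH; rewrite !mulrS /= IH. Qed.
Lemma wt_muln (al : {ffun 'I_n -> int}) N : (wt (al *+ N) <= N * wt al)%N.
Proof.
elim: N => [|N IH]; first by rewrite wt0.
by rewrite mulrS mulSn; apply: leq_trans (wtD _ _) _; rewrite leq_add2l.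
Qed.

Lemma gpoch_cvg f : ismon f -> exists L, gcvg (gpoch f q) L.
Proof.
case=> g [g0 ->]; apply: gcvg_ex.
  split=> [c [M /gpoch_supp[N [e [_ _ ->]]]]|a s] /=.
    by rewrite mulrn_fst addr0 mulrn_wge0.
  (* [N] copies of the monomial come with a [q]-exponent of at least [N(N-1)/2 - N |b|], where
     [b = g.1.2], and this has to beat [s N wt g.2] up to a constant. So [N(N-1)/2 - N K] must be
     bounded below, which [h1] gives: two consecutive integers have a nonnegative product. *)
  pose K := (s * wt g.2 + absz g.1.2)%N.
  exists (- (K.+1 * K.+1)%N%:Z) => c [M /gpoch_supp[N [e [_ Ne ->]]]] _ /=.
  rewrite mulrn_snd mulrn_al addr0 intMn addn0 ?addr0.
  have := wt_muln g.2 N; move: (wt _) => w hw.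
  have : (s * w <= N * (s * wt g.2))%N by rewrite mulnCA leq_mul2l hw orbT.
  move: (s * w)%N => sw hsw; rewrite /K.
  move: (s * wt g.2)%N hsw => sv hsw; move: (g.1.2) => b; clear -hsw Ne.
  rewrite mul0n addn0.
  set k := (sv + absz b)%N; have h1 : 0 <= (N%:Z - k%:Z) * (N%:Z - k%:Z - 1).
    by case: (lerP N%:Z k%:Z) => ?; [rewrite mulr_le0 //; lia | rewrite mulr_ge0 //; lia].
  have h2 : - (N * absz b)%N%:Z <= N%:Z * b by nia.
  have h3 : (N * k = N * sv + N * absz b)%N by rewrite mulnDr.
  nia.
(* The term added at step [M] has [q]-exponent at least [M + N(N-1)/2 - (N+1) |b|]; beyond this
   threshold it exceeds that of [c] for every [N]. *)
move=> c; exists (absz c.1.2 + (absz g.1.2).+1 * (absz g.1.2).+2)%N => M.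
move=> /subnKC <-; elim: (M - _)%N => [|k IH]; first by rewrite addn0.
rewrite addnS gpochS mulrBr mulr1 gaddE IH goppE.
set T := (X in - X); suff -> : T = 0 by rewrite subr0.
apply/eqP/negPn/negP; rewrite {}/T => /(gauss_shift (@gpoch_supp _ g0 _))[N [e [_ Ne E]]].
move/(congr1 (fun c : idx n => c.1.2)): E; rewrite /= mulrn_snd intMn mul1n.
move: (c.1.2) (g.1.2) => cb b; clear -Ne => E.
have : (e%:Z + (absz cb)%:Z + ((absz b).+1 * (absz b).+2)%N%:Z + (N.+1)%:Z * b <= cb)%R.
  by rewrite E; nia.
nia.
Qed.
End Poch.

Lemma fsum_inj (S T : choiceType) (h : S -> T) (F : T -> int) : injective h ->
  (forall v, F v != 0 -> exists u, v = h u) -> fsum F = fsum (fun u => F (h u)).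
Proof.
move=> hI Fh; rewrite /fsum -(@fsbig_image _ _ _ _ _ [set: S]%classic h); last by move=> ? ? _ _ /hI.
apply/esym/fsbig_widen => // v [_ nv] /=; apply/eqP/negPn/negP => /Fh[u vu].
by apply: nv; exists u.
Qed.

Section Pinf.
Variable n : nat.
Implicit Types (f g : gser n).
Local Notation q := (Q n).

Definition pinf f : gser n :=
  match pselect (exists L, gcvg (gpoch f q) L) with
  | left h => sval (cid h)
  | right _ => 0
  end.

Lemma pinf_cvg f : ismon f -> gcvg (gpoch f q) (pinf f).
Proof. by move/gpoch_cvg; rewrite /pinf; case: pselect => // h _; case: cid. Qed.

Lemma pinf_gpoch f M : ismon f -> pinf f = gpoch f q M * pinf (f * q ^+ M).
Proof.
move=> mf; apply: (gcvg_unique (gcvg_shift M (pinf_cvg mf))).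
have mfM : ismon (f * q ^+ M) by apply/ismonM/ismonXn/ismonQ.
apply: gcvg_eq (gcvgM (gcvg_cst _) (pinf_cvg mfM)) => k /=.
by rewrite -gpochD addnC.
Qed.

Lemma pinfS f : ismon f -> pinf f = (1 - f) * pinf (f * q).
Proof. by move/(pinf_gpoch 1); rewrite /gpoch big_ord1 expr0 expr1 mulr1. Qed.

Lemma zposM f g : zpos f -> zpos (f * g).
Proof.
move=> zf; apply: (supportedM (Q := fun c => 0 <= c.1.1) _ zf).
  by move=> u v /=; lia.
by case: (gvalP g).
Qed.

Lemma zposMl f g : zpos g -> zpos (f * g).
Proof. by rewrite mulrC; apply: zposM. Qed.

Lemma zposZ : zpos (Z n). Proof. exact: supported_mon. Qed.
Lemma zposZX k : zpos (Z n ^+ k.+1). Proof. by rewrite exprS; apply/zposM/zposZ. Qed.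

Lemma unit_sub1 f : zpos (f - 1) -> f \is a GRing.unit.
Proof.
move=> zf; have -> : f = 1 - (1 - f) by rewrite subKr.
by apply: zpos_unit; rewrite -opprB; apply: supportedN.
Qed.

Lemma gpoch_zpos f g M : zpos f -> zpos (gpoch f g M - 1).
Proof.
move=> zf; elim: M => [|M IH].
  by rewrite /gpoch big_ord0 subrr; apply: supported0.
rewrite gpochS mulrBr mulr1 addrAC; apply: supportedD => //.
by apply: supportedN; apply: zposMl; apply: zposM.
Qed.

Lemma gpoch_unit f g M : zpos f -> gpoch f g M \is a GRing.unit.
Proof. by move=> zf; apply/unit_sub1/gpoch_zpos. Qed.

Lemma gcvg_sub U L f : gcvg U L -> gcvg (fun M => U M - f) (L - f : gser n).
Proof.
move=> UL; split=> [|c].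
  apply: gsup_sub (gsupU UL.1 (gvalP f)) => c [M]; rewrite /nz gaddE goppE => h.
  case: (eqVneq (U M c) 0) => [U0|]; [right|by left; exists M].
  by move: h; rewrite U0 sub0r oppr_eq0.
by have [M0 h] := UL.2 c; exists M0 => M /h; rewrite !gaddE => ->.
Qed.

Lemma pinf_unit f : ismon f -> zpos f -> pinf f \is a GRing.unit.
Proof.
move=> mf zf; apply: unit_sub1; apply: gcvg_supp (gcvg_sub 1 (pinf_cvg mf)) _ => M.
exact: gpoch_zpos.
Qed.

Lemma qposM f g : qpos f -> qpos g -> qpos (f * g).
Proof.
apply: supportedM => -[[a ?] ?] [[b ?] ?] /= [-> -> ?] [-> -> ?].
by split; rewrite ?addr0 //; lia.
Qed.

(** Not covered by [pinf_unit], as [q] has no positive [z]-degree: here the difference from 1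
    consists of positive powers of [q] alone. *)
Lemma pinfQ_unit : pinf q \is a GRing.unit.
Proof.
have qq : qpos q by apply: supported_mon.
have qX k : qpos (q ^+ k.+1).
  by elim: k => // k IH; rewrite exprS; apply: qposM.
have h : qpos (pinf q - 1).
  apply: gcvg_supp (gcvg_sub 1 (pinf_cvg (ismonQ n))) _ => M.
  elim: M => [|M IH]; first by rewrite /gpoch big_ord0 subrr; apply: supported0.
  rewrite gpochS; have -> : gpoch q q M * (1 - q * q ^+ M) - 1 =
      (gpoch q q M - 1) - ((gpoch q q M - 1) * q ^+ M.+1 + q ^+ M.+1).
    by rewrite exprS; ring.
  apply: supportedD => //; apply: supportedN.
  by apply: supportedD; [exact: qposM IH (qX M) | exact: qX].
have -> : pinf q = 1 - (1 - pinf q) by rewrite subKr.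
by apply: qpos_unit; rewrite -opprB; apply: supportedN.
Qed.
End Pinf.

(** * Ring morphisms induced by injective additive maps of exponents *)

Record imap n m := Imap {
  ifun :> idx n -> idx m;
  ifunD : forall u v, ifun (u + v) = ifun u + ifun v;
  ifun_fst : forall u, (ifun u).1.1 = u.1.1;
  ifunI : injective ifun;
  ifun_bnd : exists C : nat, forall u, (wt (ifun u).2 <= C * wt u.2)%N /\
    u.1.2 - (C * wt u.2)%N%:Z <= (ifun u).1.2 }.

Section Push.
Variables (n m : nat) (psi : imap n m).
Implicit Types (f g : gser n) (c : idx m) (u v : idx n).

Lemma ifun0 : psi 0 = 0.
Proof. by apply: (addrI (psi 0)); rewrite -ifunD !addr0. Qed.
Lemma ifunN u : psi (- u) = - psi u.
Proof. by apply: (addrI (psi u)); rewrite -ifunD !subrr ifun0. Qed.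
Lemma ifunB u v : psi (u - v) = psi u - psi v.
Proof. by rewrite ifunD ifunN. Qed.

Definition pushf (f : idx n -> int) : idx m -> int :=
  fun c => fsum (fun u => if psi u == c then f u else 0).

Lemma pushfE f u : pushf f (psi u) = f u.
Proof.
rewrite /pushf (fsumE (r := [:: u])) ?big_seq1 ?eqxx // => v.
by case: (psi v =P psi u) => [/ifunI -> _|/=]; rewrite ?inE ?eqxx.
Qed.

Lemma pushf_nz f c : nz (pushf f) c -> exists u, c = psi u.
Proof. by case/fsum_neq0 => u; case: (psi u =P c) => // <-; exists u. Qed.

Lemma pushf_gsup (P : idx n -> Prop) :
  gsup P -> gsup (fun c => exists2 u, P u & c = psi u).
Proof.
move=> [P0 gP]; split=> [c [u /P0 ? ->]|a s]; first by rewrite ifun_fst.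
(* Of the slope [s * C + C], the part [C] pays for the drop of the [q]-exponent and the part [s * C]
   for the growth of the weight. *)
have [C hC] := ifun_bnd psi; have [b0 h] := gP a (s * C + C)%N.
exists b0 => c [u Pu ->]; rewrite ifun_fst => ua; have := h u Pu ua.
have [h1 h2] := hC u; move: h1 h2; move: (wt u.2) (u.1.2) ((psi u).1.2) => w b b' h1 h2 h3.
have h4 : (s * wt (psi u).2 <= s * (C * w))%N by rewrite leq_mul2l h1 orbT.
by move: h4 h3 h2; rewrite mulnDl mulnA; lia.
Qed.

Lemma push_good f : good (pushf f).
Proof.
apply: gsup_sub (pushf_gsup (gvalP f)) => c nc; have [u cu] := pushf_nz nc.
by exists u => //; move: nc; rewrite cu /nz pushfE.
Qed.

Definition push f := Gser (push_good f).

Lemma pushE f u : push f (psi u) = f u. Proof. exact: pushfE. Qed.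
Lemma push_nz f c : nz (push f) c -> exists2 u, nz f u & c = psi u.
Proof.
move=> nc; have [u cu] := pushf_nz nc; exists u => //.
by move: nc; rewrite cu /nz pushE.
Qed.

Lemma push_out f c : (forall u, c <> psi u) -> push f c = 0.
Proof. by move=> h; apply/eqP/negPn/negP => /push_nz[u _ /h]. Qed.

Lemma pushP f (g : gser m) : (forall u, g (psi u) = f u) ->
  (forall c, nz g c -> exists u, c = psi u) -> push f = g.
Proof.
move=> h k; apply: gserP => c; case: (pselect (exists u, c = psi u)) => [[u ->]|nc].
  by rewrite pushE h.
rewrite push_out => [|u cu]; last by apply: nc; exists u.
by apply/esym/eqP/negPn/negP => /k/nc.
Qed.

Lemma conv_push f (g : gser m) (c : idx m) :
  (push f * g) c = fsum (fun u => f u * g (c - psi u)).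
Proof.
rewrite gmulE /conv (fsum_inj (@ifunI _ _ psi)).
  by apply: eq_fsum => u; rewrite pushE.
by move=> v; rewrite mulf_eq0 negb_or => /andP[/push_nz[u _ ->] _]; exists u.
Qed.

Lemma push_mon (g : idx n) (g0 : 0 <= g.1.1) (g0' : 0 <= (psi g).1.1) :
  push (mon g0) = mon g0'.
Proof.
apply: pushP => [u|c]; rewrite /nz /= /monf.
  by rewrite (inj_eq (@ifunI _ _ psi)).
by case: (c =P psi g) => [-> _|//]; exists g.
Qed.

Lemma push_is_zmod : zmod_morphism push.
Proof.
move=> f g; apply: pushP => [u|c]; first by rewrite gaddE goppE !pushE.
rewrite /nz gaddE goppE => h; case: (eqVneq (push f c) 0) => [f0|/push_nz[u _ ->]].
  by move: h; rewrite f0 sub0r oppr_eq0 => /push_nz[u _ ->]; exists u.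
by exists u.
Qed.
Lemma push_is_monoid : monoid_morphism push.
Proof.
split=> [|f g].
  have h : 0 <= (psi 0).1.1 by rewrite ifun_fst.
  by rewrite (@push_mon 0 (lexx 0) h); apply: mon_eq; rewrite ifun0.
apply: pushP => [u|c].
  by rewrite conv_push gmulE; apply: eq_fsum => v; rewrite -ifunB pushE.
case/conv_nz => u [v [/push_nz[u' _ ->] /push_nz[v' _ ->] ->]].
by exists (u' + v'); rewrite ifunD.
Qed.
HB.instance Definition _ :=
  GRing.isZmodMorphism.Build (gser n) (gser m) push push_is_zmod.
HB.instance Definition _ :=
  GRing.isMonoidMorphism.Build (gser n) (gser m) push push_is_monoid.

Lemma push_cvg U L : gcvg U L -> gcvg (fun M => push (U M)) (push L).
Proof.
move=> [gU UL]; split=> [|c].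
  apply: gsup_sub (pushf_gsup gU) => c [M /push_nz[u nu ->]].
  by exists u => //; exists M.
case: (pselect (exists u, c = psi u)) => [[u ->]|nc].
  by have [M0 h] := UL u; exists M0 => M /h; rewrite !pushE.
by exists 0%N => M _; rewrite !push_out // => u cu; apply: nc; exists u.
Qed.

Lemma push_ismon f : ismon f -> ismon (push f).
Proof.
move=> [g [g0 ->]]; have g0' : 0 <= (psi g).1.1 by rewrite ifun_fst.
by rewrite (push_mon g0 g0'); exists (psi g), g0'.
Qed.

Hypothesis psiQ : push (Q n) = Q m.

Lemma push_pinf f : ismon f -> push (pinf f) = pinf (push f).
Proof.
move=> mf; apply: (gcvg_unique (push_cvg (pinf_cvg mf))).
apply: gcvg_eq (pinf_cvg (push_ismon mf)) => M.
by rewrite /gpoch rmorph_prod; apply: eq_bigr => k _; rewrite rmorphB rmorph1 rmorphM rmorphXn /= psiQ.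
Qed.
End Push.

(** * Constant terms and monomial substitutions *)

Section Iota.
Variable n : nat.

Definition iota_fun (u : idx 0) : idx n := (u.1, 0).

Lemma ffun0_eq (al : {ffun 'I_0 -> int}) : al = 0.
Proof. by apply/ffunP => -[]. Qed.

Lemma iotaD u v : iota_fun (u + v) = iota_fun u + iota_fun v.
Proof. by rewrite /iota_fun; congr (_, _); rewrite /= addr0. Qed.
Lemma iotaI : injective iota_fun.
Proof. by move=> [u al] [v be] [->]; rewrite (ffun0_eq al) (ffun0_eq be). Qed.
Lemma iota_bnd : exists C : nat, forall u, (wt (iota_fun u).2 <= C * wt u.2)%N /\
    u.1.2 - (C * wt u.2)%N%:Z <= (iota_fun u).1.2.
Proof. by exists 0%N => u; rewrite wt0 mul0n subr0. Qed.
Definition iota_imap : imap 0 n := Imap iotaD (fun=> erefl) iotaI iota_bnd.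

(** Series in [z] and [q] alone serve as scalars; [CT] is linear over them by [CT_scM]. *)
Definition sc : gser 0 -> gser n := push iota_imap.
HB.instance Definition _ := GRing.RMorphism.copy sc (push iota_imap).

Lemma sc_X b : sc (X b 0) = X b 0. Proof. by apply: push_mon. Qed.
Lemma sc_Q : sc (Q 0) = Q n. Proof. exact: sc_X. Qed.
Lemma sc_Z : sc (Z 0) = Z n. Proof. by apply: push_mon. Qed.
Definition ctf (f : gser n) : idx 0 -> int := fun c => f (iota_fun c).

Lemma ct_good f : good (ctf f).
Proof.
have [f0 gf] := gvalP f; split=> [c /f0 //|a s].
have [b0 h] := gf a s; exists b0 => c /h; rewrite wt0 => /[apply].
by rewrite [X in wt X]ffun0_eq wt0.
Qed.
Definition CT f : gser 0 := Gser (ct_good f).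

Lemma CT_zmod : zmod_morphism CT.
Proof. by move=> f g; apply: gserP. Qed.
HB.instance Definition _ := GRing.isZmodMorphism.Build (gser n) (gser 0) CT CT_zmod.

Lemma CT_scM s f : CT (sc s * f) = s * CT f.
Proof.
apply: gserP => c; rewrite gmulE; apply: etrans (conv_push _ _ _ _) _.
apply: eq_fsum => u; congr (_ * f _); rewrite /iota_fun; congr (_, _); exact: subrr.
Qed.

Lemma CT1 : CT 1 = 1.
Proof.
apply: gserP => c; rewrite /= /ctf /= /monf [in RHS](surjective_pairing c) (ffun0_eq c.2).
by rewrite /iota_fun !xpair_eqE !eqxx.
Qed.

Lemma CT_push (psi : imap n n) f :
  (forall c, psi (iota_fun c) = iota_fun c) -> CT (push psi f) = CT f.
Proof. by move=> h; apply: gserP => c; rewrite /= /ctf -[in LHS]h; apply: pushE. Qed.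
End Iota.

Section Lin.
Variables (n : nat) (s : {perm 'I_n}) (la : 'I_n -> int).
Implicit Types (al be : {ffun 'I_n -> int}).

Definition shear al : int := \sum_j la j * al j.
Definition pal al : {ffun 'I_n -> int} := [ffun j => al ((s^-1)%g j)].
(** The substitution [x_j -> q^(la j) x_(s j)], seen on exponents. *)
Definition lin_fun (u : idx n) : idx n := (u.1.1, u.1.2 + shear u.2, pal u.2).

Lemma shearD al be : shear (al + be) = shear al + shear be.
Proof. by rewrite -big_split; apply: eq_bigr => j _; rewrite ffunE mulrDr. Qed.
Lemma palD al be : pal (al + be) = pal al + pal be.
Proof. by apply/ffunP => j; rewrite !ffunE. Qed.
Lemma lin_funD u v : lin_fun (u + v) = lin_fun u + lin_fun v.
Proof.
rewrite /lin_fun /= shearD palD; congr (_, _).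
by rewrite addrACA.
Qed.
Lemma palI : injective pal.
Proof.
by move=> al be /ffunP E; apply/ffunP => j; have := E (s j); rewrite !ffunE permK.
Qed.
Lemma lin_funI : injective lin_fun.
Proof.
move=> [[a b] al] [[a' b'] be] [/= -> E /palI E']; move: E; rewrite E'.
by move=> /addIr ->.
Qed.
Lemma wt_pal al : wt (pal al) = wt al.
Proof.
rewrite /wt (reindex_inj (@perm_inj _ s)); apply: eq_bigr => j _.
by rewrite ffunE permK.
Qed.
Lemma lin_bnd : exists C : nat, forall u, (wt (lin_fun u).2 <= C * wt u.2)%N /\
    u.1.2 - (C * wt u.2)%N%:Z <= (lin_fun u).1.2.
Proof.
exists (1 + \sum_j `|la j|%N)%N => -[[a b] al]; rewrite /= wt_pal; split.
  by rewrite mulSn leq_addr.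
suff : `|shear al| <= ((\sum_j `|la j|%N) * wt al)%N%:Z.
  rewrite /= mulnDl mul1n; move: (shear al) (wt al) (_ * wt al)%N => w y x; lia.
apply: le_trans (ler_norm_sum _ _ _) _.
rewrite big_distrl /= (big_morph _ PoszD (erefl 0%:Z)); apply: ler_sum => j _.
by rewrite normrM PoszM -abszE ler_wpM2l // -abszE lez_nat wt_ge.
Qed.
Definition lin : imap n n := Imap lin_funD (fun=> erefl) lin_funI lin_bnd.
End Lin.

(** * The weight functions *)

Notation aut s la := (push (lin s la)).

Lemma mulr_divM (R : comUnitRingType) (a b c : R) :
  a \is a GRing.unit -> b \is a GRing.unit -> a * (c / (a * b)) = c / b.
Proof. by move=> ua ub; rewrite invrM // mulrCA [a * _]mulrCA divrr // mulr1. Qed.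

HB.lock Definition gD (n : nat) (f : gser n) : gser n := pinf f / pinf (Z n * f).
(** The common part of [gD f = (1 - f) gK f] and [gD (q f) = (1 - z f) gK f]. It isolates from
    [pr i j] a factor symmetric in [i] and [j]. *)
HB.lock Definition gK (n : nat) (f : gser n) : gser n := pinf (f * Q n) / pinf (Z n * f).
Arguments gD {n} f.
Arguments gK {n} f.

Section Vars.
Variable n : nat.
Implicit Types (f g h : gser n) (i j k : 'I_n) (s : {perm 'I_n}) (la : 'I_n -> int).
Local Notation q := (Q n).
Local Notation z := (Z n).
Local Notation qi b := (X b (0 : {ffun 'I_n -> int})).

Definition ex i : {ffun 'I_n -> int} := [ffun j => (j == i)%:R].
Definition x i : gser n := X 0 (ex i).

Lemma x_unit i : x i \is a GRing.unit. Proof. exact: X_unit. Qed.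

Lemma aut_X s la b al :
  aut s la (X b al) = X (b + shear la al) (pal s al).
Proof. exact: push_mon. Qed.
#[global] Opaque X mon pinf push Z.

Lemma aut_x s la i : aut s la (x i) = qi (la i) * x (s i).
Proof.
rewrite /x aut_X XM addr0 add0r add0r; congr X.
  rewrite /shear (bigD1 i) //= big1 ?addr0 ?ffunE ?eqxx ?mulr1 // => j ji.
  by rewrite ffunE (negPf ji) mulr0.
apply/ffunP => j; rewrite !ffunE; congr (_%:R).
by rewrite -(inj_eq (@perm_inj _ s)) permKV.
Qed.

Lemma lin_iota s la c : lin s la (iota_fun n c) = iota_fun n c.
Proof.
rewrite /= /lin_fun /iota_fun; congr (_, _); last by apply/ffunP => j; rewrite !ffunE.
by rewrite [in RHS](surjective_pairing c.1) /shear big1 ?addr0 // => j _; rewrite ffunE mulr0.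
Qed.

Lemma CT_aut s la f : CT (aut s la f) = CT f.
Proof. by apply: CT_push => c; apply: lin_iota. Qed.

Lemma aut_sc s la (f : gser 0) : aut s la (sc n f) = sc n f.
Proof.
apply/esym; rewrite /sc; apply: pushP => [u|c].
  rewrite -[iota_imap n u](lin_iota s la) pushE; exact: (pushE (iota_imap n)).
move=> /push_nz[u nu ->]; have [v _ ->] := push_nz nu.
by exists v; apply: lin_iota.
Qed.

Lemma aut_qi s la b : aut s la (qi b) = qi b.
Proof. by rewrite -sc_X aut_sc. Qed.
Lemma aut_Q s la : aut s la q = q.
Proof. exact: aut_qi. Qed.
Lemma aut_Z s la : aut s la z = z.
Proof. by rewrite -sc_Z aut_sc. Qed.

Definition isX f := exists b al, f = X b al.
Lemma xE i : x i = X 0 (ex i). Proof. by []. Qed.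
Lemma isX_x i : isX (x i). Proof. by do 2!eexists. Qed.
#[global] Opaque x.
Lemma isX_qi b : isX (qi b). Proof. by do 2!eexists. Qed.
Lemma isX_M f g : isX f -> isX g -> isX (f * g).
Proof. by move=> [? [? ->]] [? [? ->]]; rewrite XM; do 2!eexists. Qed.
Lemma isX_V f : isX f -> isX f^-1.
Proof. by move=> [? [? ->]]; rewrite XV; do 2!eexists. Qed.
Lemma isX_mon f : isX f -> ismon f.
Proof. by move=> [? [? ->]]; apply: ismonX. Qed.
Lemma ismonzX f : isX f -> ismon (z * f).
Proof. by move=> /isX_mon; apply: ismonM; apply: ismonZ. Qed.
Lemma pinfz_unit f : isX f -> pinf (z * f) \is a GRing.unit.
Proof. by move=> /ismonzX mf; apply: pinf_unit => //; apply/zposM/zposZ. Qed.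

Lemma aut_pinf s la f : ismon f -> aut s la (pinf f) = pinf (aut s la f).
Proof. by apply: push_pinf; apply: aut_Q. Qed.

Lemma aut_gD s la f : isX f -> aut s la (gD f) = gD (aut s la f).
Proof.
move=> Xf; rewrite !gD.unlock rmorphM rmorphV ?pinfz_unit //= !aut_pinf ?rmorphM /= ?aut_Z //.
  exact: ismonzX.
exact: isX_mon.
Qed.

Lemma aut_gK s la f : isX f -> aut s la (gK f) = gK (aut s la f).
Proof.
move=> Xf; rewrite !gK.unlock rmorphM rmorphV ?pinfz_unit //= !aut_pinf ?rmorphM /= ?aut_Z ?aut_Q //.
  exact: ismonzX.
by apply: ismonM; [apply: isX_mon | apply: ismonQ].
Qed.

Lemma gD_K f : isX f -> gD f = (1 - f) * gK f.
Proof. by move=> Xf; rewrite gD.unlock gK.unlock pinfS ?mulrA //; apply: isX_mon. Qed.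

Lemma gDq_K f : isX f -> gD (q * f) = (1 - z * f) * gK f.
Proof.
move=> Xf; rewrite gD.unlock gK.unlock [pinf (z * f)]pinfS; last exact: ismonzX.
have Xqf : isX (q * f) by apply: isX_M => //; apply: isX_qi.
have u1 : 1 - z * f \is a GRing.unit by apply/zpos_unit/zposM/zposZ.
have := pinfz_unit Xqf; rewrite [q * f]mulrC mulrA => u2.
by rewrite mulr_divM.
Qed.

Lemma gD_q f : isX f -> (1 - z * f) * gD f = (1 - f) * gD (q * f).
Proof. by move=> Xf; rewrite gD_K // gDq_K // mulrCA. Qed.

Definition pr i j : gser n := gD (x i / x j) * gD (q * (x j / x i)).

Lemma isX_xx i j : isX (x i / x j).
Proof. by apply/isX_M/isX_V; apply: isX_x. Qed.
Lemma isX_qxx i j : isX (q * (x j / x i)).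
Proof. by apply/isX_M/isX_xx; apply: isX_qi. Qed.

Lemma aut_xx s la i j :
  aut s la (x i / x j) = qi (la i - la j) * (x (s i) / x (s j)).
Proof.
rewrite rmorphM rmorphV ?x_unit //= !aut_x invrM ?x_unit ?X_unit // XV oppr0.
have -> : qi (la i - la j) = qi (la i) * qi (- la j) by rewrite XM addr0.
ring.
Qed.

Lemma aut_pr0 s la i j : la i = la j -> aut s la (pr i j) = pr (s i) (s j).
Proof.
move=> lij; have E k l : la k = la l -> aut s la (x k / x l) = x (s k) / x (s l).
  by move=> kl; rewrite aut_xx kl subrr X00 mul1r.
rewrite /pr rmorphM /= (aut_gD _ _ (isX_xx i j)) (aut_gD _ _ (isX_qxx i j)) (E i j lij).
by rewrite rmorphM /= aut_Q (E j i (esym lij)).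
Qed.

Lemma prE i j : pr i j = (1 - x i / x j) * (1 - z * (x j / x i)) *
  (gK (x i / x j) * gK (x j / x i)).
Proof.
by rewrite /pr (gD_K (isX_xx i j)) (gDq_K (isX_xx j i)) mulrACA.
Qed.
End Vars.

Section Weights.
Variable n : nat.
Implicit Types (f g h : gser n) (i j k : 'I_n) (s : {perm 'I_n}) (la : 'I_n -> int).
Local Notation q := (Q n).
Local Notation z := (Z n).
Local Notation qi b := (X b (0 : {ffun 'I_n -> int})).

Lemma CT_antisym s la f : aut s la f = - f -> CT f = 0.
Proof.
move=> h; apply: gserP => c.
have /(congr1 (fun f : gser 0 => f c)) : - CT f = CT f by rewrite -[in RHS](CT_aut s la f) h raddfN.
rewrite goppE gzeroE; lia.
Qed.

Definition swp i j := aut (tperm i j) (fun=> 0).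
HB.instance Definition _ i j := GRing.RMorphism.copy (swp i j) (swp i j).

Lemma swp_x i j k : swp i j (x k) = x (tperm i j k).
Proof. by rewrite /swp aut_x X00 mul1r. Qed.

Lemma swp_xx i j k l : swp i j (x k / x l) = x (tperm i j k) / x (tperm i j l).
Proof. by rewrite /swp aut_xx subr0 X00 mul1r. Qed.

Lemma swpM i j f g : swp i j (f * g) = swp i j f * swp i j g.
Proof. exact: rmorphM. Qed.
Lemma swpB i j f g : swp i j (f - g) = swp i j f - swp i j g.
Proof. exact: rmorphB. Qed.
Lemma swp_xV i j k : swp i j (x k)^-1 = (x (tperm i j k))^-1.
Proof. by rewrite -swp_x; apply/rmorphV/x_unit. Qed.
Lemma swp_z i j : swp i j z = z.
Proof. exact: aut_Z. Qed.

Lemma swp_gK i j f : isX f -> swp i j (gK f) = gK (swp i j f).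
Proof. exact: aut_gK. Qed.

Lemma swp_gD i j f : isX f -> swp i j (gD f) = gD (swp i j f).
Proof. exact: aut_gD. Qed.

Lemma swp_pr i j k l : swp i j (pr k l) = pr (tperm i j k) (tperm i j l).
Proof. exact: aut_pr0. Qed.

Lemma xVx i j : x i / x j * (x j / x i) = 1 :> gser n.
Proof. by rewrite mulrACA [x i * _]mulrC mulrACA !divrr ?x_unit ?mulr1. Qed.

(* Besides a part symmetric in [x_i, x_j], the integrand is
   [(z x_i - x_j) (x_j - x_i) (x_i - z x_j)], which is antisymmetric. *)
Lemma hecke i j h R : swp i j h = h -> swp i j R = R ->
  CT ((z * x i - x j) * h * (pr i j * R)) = 0.
Proof.
move=> hh hR; apply: (@CT_antisym (tperm i j) (fun=> 0)); rewrite -/(swp i j).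
rewrite prE; set K := gK _ * gK _.
have hK : swp i j K = K.
  by rewrite swpM (swp_gK i j (isX_xx i j)) (swp_gK i j (isX_xx j i)) !swp_xx tpermL tpermR mulrC.
clearbody K; have -> : (z * x i - x j) * h * ((1 - x i / x j) * (1 - z * (x j / x i)) * K * R) =
   ((z * x i - x j) * (x j - x i) * (x i - z * x j)) * ((x j)^-1 * (x i)^-1) * (h * K * R).
  have -> : 1 - x i / x j = (x j - x i) / x j.
    by rewrite mulrBl divrr ?x_unit.
  have -> : 1 - z * (x j / x i) = (x i - z * x j) / x i.
    by rewrite mulrBl divrr ?x_unit // mulrA.
  ring.
rewrite !(swpM, swpB) hh hR hK !swp_xV !swp_x swp_z tpermL tpermR.
ring.
Qed.

(** [Delta'] in the first [N] of [n] variables, so that the induction on the number of variables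
    takes place in one ring. *)
Definition dlt N : gser n :=
  \prod_(e : 'I_n * 'I_n | (e.1 < e.2 < N)%N) pr e.1 e.2.

(** A transposition of neighbours permutes the other ordered pairs without reversing any of them. *)
Lemma dlt_split N i j : j = i.+1 :> nat -> (j < N)%N ->
  exists2 R, dlt N = pr i j * R & swp i j R = R.
Proof.
move=> ji jN; rewrite /dlt (bigD1 (i, j)) /=; last by rewrite jN andbT ji ltnSn.
eexists; first by [].
rewrite rmorph_prod /=; under eq_bigr do rewrite swp_pr.
pose t (e : 'I_n * 'I_n) := (tperm i j e.1, tperm i j e.2).
have tI : injective t by move=> [a b] [c d] [/perm_inj -> /perm_inj ->].
rewrite [RHS](reindex_inj tI); apply: eq_bigl => -[a b].
rewrite /t /= !xpair_eqE.
have sN c : (tperm i j c < N)%N = (c < N)%N.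
  by case: tpermP => [->|->|//]; lia.
rewrite sN; case: (b < N)%N; last by rewrite !andbF.
rewrite !andbT -!val_eqE /=.
case: (tpermP i j a) => [->|->|/eqP + /eqP +]; case: (tpermP i j b) => [->|->|/eqP + /eqP +] //=;
 rewrite -?val_eqE /=; lia.
Qed.

Variables (N : nat) (sp : 'I_n) (Ef : gser n -> gser n) (A : gser 0).
Hypothesis Nsp : (N <= sp)%N.
Hypothesis EfA : forall s la f, isX f -> aut s la (Ef f) = Ef (aut s la f).
(** The functional equation of [(y; q)_oo / (A y; q)_oo]. *)
Hypothesis EfS : forall f, isX f -> (1 - f) * Ef (q * f) = (1 - sc n A * f) * Ef f.

(* With [Ef = gD] and [sp] the index [N] this is [dlt N.+1]; with [Ef = 1] it has the
   same constant term as [dlt N]. *)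
Definition wgt : gser n :=
  (\prod_(i : 'I_n | (i < N)%N) (Ef (x i / x sp) * gD (q * (x sp / x i)))) * dlt N.

Local Notation L g := (CT (g * wgt)).
Local Notation y i := (x i / x sp).

Lemma tperm_lt i j k : (i < N)%N -> (j < N)%N -> (tperm i j k < N)%N = (k < N)%N.
Proof. by case: tpermP => [->|->|//] -> ->. Qed.

Lemma tperm_sp i j : (i < N)%N -> (j < N)%N -> tperm i j sp = sp.
Proof.
by move=> iN jN; apply: tpermD; rewrite -val_eqE neq_ltn (leq_trans _ Nsp).
Qed.

(** The factors that involve [x sp] form a product symmetric in the first [N] variables, so [hecke]
    applies with this product in its symmetric part. *)
Lemma wgt_hecke i j h : j = i.+1 :> nat -> (j < N)%N -> swp i j h = h ->
  L (y j * h) = Z 0 * L (y i * h).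
Proof.
move=> ji jN hh; have iN : (i < N)%N by rewrite (ltn_trans _ jN) // ji.
have [R RE hR] := dlt_split ji jN.
apply/esym/eqP; rewrite -subr_eq0 -CT_scM -raddfB /= sc_Z /wgt RE.
set P := \prod_(_ < _ | _) _.
have hP : swp i j P = P.
  rewrite /P rmorph_prod [RHS](reindex_inj (@perm_inj _ (tperm i j))) /=.
  apply: eq_big => [k|k _]; first by rewrite tperm_lt.
  rewrite rmorphM /= (swp_gD i j (isX_qxx k sp)) [swp i j (Ef _)]EfA; last exact: isX_xx.
  rewrite -[aut _ _ (_ / _)]/(swp i j (x k / x sp)) swp_xx tperm_sp // rmorphM /= swp_xx.
  by rewrite [swp i j q]aut_Q tperm_sp.
rewrite (_ : _ - _ = (z * x i - x j) * (h / x sp) * (pr i j * (P * R))); last by ring.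
apply/eqP; apply: hecke; last by rewrite swpM hP hR.
by rewrite swpM hh swp_xV tperm_sp.
Qed.
End Weights.

(** For the one factor of the weight whose arguments the rotation multiplies by powers of [q]; there
    [u = q^-1 x_0 / x_sp] and [v = u^-1]. The factors [1 - u] and [1 - v] of the two functional
    equations differ by [-u], so they cancel without being inverted. *)
Lemma shift_weight_step (R : comNzRingType) (a t u v E0 E1 D1 D2 : R) :
  (1 - u) * E1 = (1 - a * u) * E0 -> (1 - t * v) * D1 = (1 - v) * D2 ->
  v * u = 1 -> (1 - a * u) * (E0 * D2) = (t - u) * (E1 * D1).
Proof.
move=> e1 e2 vu; have -> : (1 - a * u) * (E0 * D2) = (1 - u) * E1 * D2 by rewrite e1 mulrA.
have -> : (1 - u) * E1 * D2 = (v * u - u) * E1 * D2 by rewrite vu.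
have -> : (t - u) * (E1 * D1) = - u * E1 * ((1 - t * v) * D1).
  have -> : t - u = - u * (1 - t * v).
    by rewrite [RHS](_ : _ = t * (v * u) - u); [rewrite vu mulr1 | ring].
  by ring.
by rewrite e2; ring.
Qed.

Lemma mulr_congr (R : comNzRingType) (a b c d : R) : a = b -> c = d -> a * c = b * d.
Proof. by move=> -> ->. Qed.

(** * The rotation of the first [N] variables *)

Section Cyc.
Variables (n N : nat).
Hypothesis Nn : (N <= n)%N.
Implicit Types (f g h : gser n) (i j k : 'I_n) (la : 'I_n -> int).
Local Notation q := (Q n).
Local Notation z := (Z n).
Local Notation qi b := (X b (0 : {ffun 'I_n -> int})).

Definition cycn (i : nat) : nat :=
  if (i < N)%N then (if i.+1 == N then 0 else i.+1) else i.
Definition cycf i : 'I_n := insubd i (cycn i).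

Lemma cycfE i : cycf i = cycn i :> nat.
Proof.
rewrite /cycf val_insubd; case: ifP => // /negP[]; rewrite /cycn; have iN := ltn_ord i.
by case: (ltnP i N) => // ?; case: (i.+1 =P N); lia.
Qed.

Lemma cycn_last i : i.+1 = N -> cycn i = 0%N.
Proof. by move=> iN; rewrite /cycn -iN ltnSn eqxx. Qed.
Lemma cycnS (i : nat) : (i.+1 < N)%N -> cycn i = i.+1.
Proof. by move=> iN; rewrite /cycn (ltnW iN) ltn_eqF. Qed.
Lemma cycn_id (i : nat) : (N <= i)%N -> cycn i = i.
Proof. by move=> iN; rewrite /cycn ltnNge iN. Qed.

Lemma cycn_inj : injective cycn.
Proof.
move=> i j; rewrite /cycn.
by case: (ltnP i N); case: (ltnP j N); case: (i.+1 =P N); case: (j.+1 =P N); lia.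
Qed.

Lemma cycfI : injective cycf.
Proof. by move=> i j /(congr1 (@nat_of_ord n)); rewrite !cycfE => /cycn_inj/val_inj. Qed.

Definition cyc : {perm 'I_n} := perm cycfI.
Definition cycla i : int := if i.+1 == N then -1 else 0.
(* The substitution [x_0 -> x_1 -> ... -> x_(N-1) -> q^-1 x_0]. *)
Definition om := aut cyc cycla.
HB.instance Definition _ := GRing.RMorphism.copy om om.

Lemma cycE i : cyc i = cycn i :> nat.
Proof. by rewrite permE cycfE. Qed.

Lemma cyc_lt i : (cyc i < N)%N = (i < N)%N.
Proof.
rewrite cycE /cycn; case: (ltnP i N) => ?; last by lia.
by case: eqP => ?; lia.
Qed.

Lemma omM f g : om (f * g) = om f * om g. Proof. exact: rmorphM. Qed.
Lemma omB f g : om (f - g) = om f - om g. Proof. exact: rmorphB. Qed.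

Lemma om_xx i j : i.+1 != N -> j.+1 != N -> om (x i / x j) = x (cyc i) / x (cyc j).
Proof.
by move=> iN jN; rewrite /om aut_xx /cycla (negPf iN) (negPf jN) subr0 X00 mul1r.
Qed.

Lemma om_xxl i j : i.+1 = N -> j.+1 != N ->
  om (x i / x j) = qi (-1) * (x (cyc i) / x (cyc j)).
Proof.
by move=> iN jN; rewrite /om aut_xx /cycla iN eqxx (negPf jN) subr0.
Qed.

Lemma om_xxr i j : i.+1 != N -> j.+1 = N ->
  om (x i / x j) = q * (x (cyc i) / x (cyc j)).
Proof.
by move=> iN jN; rewrite /om aut_xx /cycla jN eqxx (negPf iN) sub0r opprK.
Qed.

Lemma om_gD f : isX f -> om (gD f) = gD (om f). Proof. exact: aut_gD. Qed.
Lemma om_q : om q = q. Proof. exact: aut_Q. Qed.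
Lemma CT_om f : CT (om f) = CT f. Proof. exact: CT_aut. Qed.

Lemma q_qV : q * qi (-1) = 1.
Proof. by rewrite XM subrr addr0 X00. Qed.

(** A pair with the last index is reversed: [x_i / x_j] becomes [q x_(i+1) / x_0], the second
    argument in [pr] of the pair [(0, i+1)], while the [q] of the other argument is cancelled. *)
Lemma om_pr i j : (i < j < N)%N ->
  om (pr i j) = if j.+1 == N then pr (cyc j) (cyc i) else pr (cyc i) (cyc j).
Proof.
move=> /andP[ij jN]; have iN : i.+1 != N by lia.
case: eqP => [jE|/eqP jE]; last by apply: aut_pr0; rewrite /cycla (negPf iN) (negPf jE).
rewrite /pr omM (om_gD (isX_xx i j)) (om_gD (isX_qxx i j)) (om_xxr iN jE) omM om_q.
by rewrite (om_xxl jE iN) [q * (qi _ * _)]mulrA q_qV mul1r mulrC.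
Qed.

Lemma om_dlt : om (dlt n N) = dlt n N.
Proof.
(* The bijection induced on pairs [i < j < N], reordering those that contain the last index; in its
   inverse [h'] the index 0 plays that part. *)
pose h (e : 'I_n * 'I_n) := if e.2.+1 == N then (cyc e.2, cyc e.1) else (cyc e.1, cyc e.2).
pose si := (cyc^-1)%g.
pose h' (e : 'I_n * 'I_n) := if e.1 == 0%N :> nat then (si e.2, si e.1) else (si e.1, si e.2).
pose P (e : 'I_n * 'I_n) := (e.1 < e.2 < N)%N.
have Ph e : P e -> P (h e) /\ h' (h e) = e.
  case: e => i j; rewrite /P /h /h' /= => /andP[ij jN].
  have ci : cycn i = i.+1 by apply: cycnS; lia.
  case: (j.+1 =P N) => [jE|jE] /=; rewrite !cycE ci !permK.
    by rewrite (cycn_last jE) eqxx; split=> //; lia.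
  by rewrite cycnS; [split=> //; lia | lia].
have Ph' e : P e -> P (h' e) /\ h (h' e) = e.
  case: e => i j; rewrite -[i](permKV cyc) -[j](permKV cyc) -/si.
  move: (si i) (si j) => a b; rewrite /P /h /h' /= !permK !cycE.
  case: (ltnP b N) => bN; last by rewrite (cycn_id bN); lia.
  case: (ltnP a N) => aN; last by rewrite (cycn_id aN) /cycn bN; case: (b.+1 =P N); lia.
  rewrite /cycn aN bN.
  case: (a.+1 =P N) => [aE|aE]; case: (b.+1 =P N) => [bE|bE] //=; rewrite ?aE ?eqxx.
  - by move=> bN'; split=> //; lia.
  - by move=> bN'; split=> //; lia.
rewrite /dlt rmorph_prod [RHS](reindex_onto h h') => [|e /Ph'[]//].
apply: eq_big => [e|e]; last first.
  by move=> Pe; rewrite [LHS](om_pr Pe) /h; case: eqP.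
apply/idP/andP => [/Ph[h1 h2]|[/Ph'[h1 _] /eqP E]].
  by split; [exact: h1 | rewrite h2].
by rewrite E in h1.
Qed.

Variables (sp : 'I_n) (Ef : gser n -> gser n) (A : gser 0).
Hypothesis Nsp : (N <= sp)%N.
Hypothesis EfA : forall s la f, isX f -> aut s la (Ef f) = Ef (aut s la f).
Hypothesis EfS : forall f, isX f -> (1 - f) * Ef (q * f) = (1 - sc n A * f) * Ef f.
Local Notation W := (wgt N sp Ef).
Local Notation L g := (CT (g * W)).
Local Notation y i := (x i / x sp).

Lemma cyc_sp : cyc sp = sp.
Proof. by apply/val_inj; rewrite /= cycE /cycn ltnNge Nsp. Qed.
Lemma sp_last : sp.+1 != N. Proof. by lia. Qed.

Variables l o : 'I_n.
Hypotheses (lN : l.+1 = N) (o0 : o = 0%N :> nat).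

Lemma cyc_l : cyc l = o.
Proof. by apply/val_inj; rewrite /= cycE /cycn lN leqnn eqxx o0. Qed.

Lemma om_wgt : (1 - sc n A * (qi (-1) * y o)) * om W = (z - qi (-1) * y o) * W.
Proof.
pose F (i : 'I_n) := Ef (y i) * gD (q * (x sp / x i)).
have lN' : (l < N)%N by rewrite -lN.
rewrite /wgt omM om_dlt [LHS]mulrA [RHS]mulrA; apply: mulr_congr (erefl _).
rewrite [X in _ = _ * X](reindex_inj (@perm_inj _ cyc)) rmorph_prod.
rewrite (bigD1 l) //= [X in _ = _ * X](bigD1 l) /=; last by rewrite cyc_lt.
rewrite [LHS]mulrA [RHS]mulrA; apply: mulr_congr; last first.
  apply: eq_big => [i|i /andP[iN il]]; first by rewrite cyc_lt.
  have il' : i.+1 != N by apply: contra_neq il => E; apply/val_inj => /=; lia.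
  rewrite omM [om (Ef _)]EfA; last exact: isX_xx.
  rewrite -/om (om_xx il' sp_last) (om_gD (isX_qxx i sp)) omM om_q (om_xx sp_last il').
  by rewrite cyc_sp.
rewrite omM [om (Ef _)]EfA; last exact: isX_xx.
rewrite -/om (om_xxl lN sp_last) (om_gD (isX_qxx l sp)) omM om_q (om_xxr sp_last lN).
rewrite cyc_sp cyc_l.
have X1 : isX (qi (-1) * y o) by apply/isX_M/isX_xx; apply: isX_qi.
have X2 : isX (q * (x sp / x o)) := isX_qxx o sp.
have e1 := EfS X1; have e2 := gD_q X2.
rewrite [q * (qi _ * _)]mulrA q_qV mul1r in e1.
have E3 : q * (x sp / x o) * (qi (-1) * y o) = 1.
  by rewrite mulrACA q_qV xVx mulr1.
exact: shift_weight_step e1 e2 E3.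
Qed.

(** The factor [1 - A y_l] is chosen so that its image under [om] is exactly the factor by which
    [om_wgt] turns [om W] into a multiple of [W]. *)
Lemma wgt_om g :
  CT ((1 - sc n A * y l) * g * W) = CT ((z - qi (-1) * y o) * om g * W).
Proof.
rewrite -[LHS]CT_om; congr CT; rewrite [LHS]omM.
have -> : om ((1 - sc n A * y l) * g) = (1 - sc n A * (qi (-1) * y o)) * om g.
  by rewrite [LHS]omM omB [om 1]rmorph1 omM [om (sc n A)]aut_sc
     (om_xxl lN sp_last) cyc_l cyc_sp.
by rewrite -[LHS]mulrA [om g * _]mulrC [LHS]mulrA om_wgt -[LHS]mulrA [W * _]mulrC [LHS]mulrA.
Qed.
End Cyc.

(** * Gaussian binomials *)

Section Gauss.
Variables (R : comNzRingType) (t : R).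

(** The truncated subtraction is harmless: it differs from the true one only for [l' > N'], where
    [gb N' l'] is 0. *)
Fixpoint gb (N l : nat) : R :=
  match N, l with
  | _, 0 => 1
  | 0, _.+1 => 0
  | N'.+1, l'.+1 => gb N' l'.+1 + t ^+ (N' - l') * gb N' l'
  end.

Lemma gb0 N : gb N 0 = 1. Proof. by case: N. Qed.
Lemma gbS N l : gb N.+1 l.+1 = gb N l.+1 + t ^+ (N - l) * gb N l.
Proof. by []. Qed.

Lemma gb_small N l : (N < l)%N -> gb N l = 0.
Proof.
elim: N l => [|N IH] [|l] //; rewrite ltnS gbS => Nl.
by rewrite !IH ?mulr0 ?addr0 // ltnW.
Qed.

Lemma gb_ratio N l : (l <= N)%N ->
  (1 - t ^+ l.+1) * gb N l.+1 = (1 - t ^+ (N - l)) * gb N l.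
Proof.
elim: N l => [|N IH] l lN.
  by move: lN; rewrite leqn0 => /eqP ->; rewrite /= subrr mulr0 mul0r.
have top k : (k <= N)%N -> (1 - t ^+ k.+1) * gb N.+1 k.+1 = (1 - t ^+ N.+1) * gb N k.
  move=> kN; have := IH k kN; rewrite gbS.
  have -> : t ^+ N.+1 = t ^+ (N - k) * t ^+ k.+1 by rewrite -exprD addnS subnK.
  by move: (t ^+ (N - k)) (t ^+ k.+1) => a b h; rewrite mulrDr h; ring.
move: lN; rewrite leq_eqVlt => /predU1P[->|].
  by rewrite gb_small // mulr0 subnn subrr mul0r.
rewrite ltnS => lN; rewrite top //.
case: l lN => [|l] lN; first by rewrite !gb0 subn0.
have := IH l (ltnW lN); rewrite gbS subSS.
have -> : t ^+ N.+1 = t ^+ (N - l) * t ^+ l.+1 by rewrite -exprD addnS subnK // ltnW.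
by move: (t ^+ (N - l)) (t ^+ l.+1) => a b h; rewrite mulrDr mulrCA -h; ring.
Qed.

(** Consecutive terms have ratio [y (1 - t^(N-l)) / (1 - y t^(N-l-1))]; for such a sum the tail
    starting at [N - k] is [(1 - y t^k) / (1 - y)] times its first term. *)
Lemma gauss_sum (A y c : R) N (J : nat -> R) : y = c * A ->
  (forall l, (l < N)%N ->
     J l.+1 * (1 - y * t ^+ (N - l.+1)) = - c * J l * (1 - t ^+ l.+1)) ->
  (1 - y) * \sum_(l < N.+1) (- A) ^+ l * gb N l * J l = (1 - y * t ^+ N) * J 0%N.
Proof.
move=> yE HJ; pose T l := (- A) ^+ l * gb N l * J l.
have HT l : (l < N)%N ->
    T l.+1 * (1 - y * t ^+ (N - l.+1)) = y * T l * (1 - t ^+ (N - l)).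
  move=> lN; rewrite /T.
  have := HJ l lN; have := gb_ratio (ltnW lN); rewrite [(- A) ^+ _.+1]exprS yE.
  move: ((- A) ^+ l) (gb N l.+1) (gb N l) (J l) (J l.+1) => a g g' j j'.
  move: (t ^+ l.+1) (t ^+ (N - l)) (1 - c * A * _) => u v w e1 e2.
  rewrite [LHS](_ : _ = - A * a * g * (j' * w)); last by ring.
  rewrite e2 [LHS](_ : _ = A * a * c * j * ((1 - u) * g)); last by ring.
  by rewrite e1; ring.
(* The tail sums telescope, so no denominator has to be inverted. *)
have tail k : (k <= N)%N ->
    (1 - y) * \sum_(N - k <= l < N.+1) T l = (1 - y * t ^+ k) * T (N - k)%N.
  elim: k => [|k IH] kN; first by rewrite subn0 big_nat1 mulr1.
  rewrite big_ltn; last by lia.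
  rewrite mulrDr.
  rewrite (_ : (N - k.+1).+1 = N - k)%N; last by lia.
  rewrite IH; last by lia.
  have := HT (N - k.+1)%N; rewrite (_ : (N - k.+1).+1 = N - k)%N; last by lia.
  rewrite (_ : N - (N - k) = k)%N; last by lia.
  rewrite (_ : N - (N - k.+1) = k.+1)%N; last by lia.
  by rewrite [(1 - y * t ^+ k) * _]mulrC => ->; [ring | lia].
have := tail N (leqnn N); rewrite subnn big_mkord => ->.
by rewrite /T gb0 expr0 !mul1r.
Qed.
End Gauss.

(** * Closed form of the bracket *)

Section Qsum.
Variables (R : comUnitRingType) (t q : R).

Lemma gbS2 N l : (l <= N)%N -> gb t N.+1 l.+1 = t ^+ l.+1 * gb t N l.+1 + gb t N l.
Proof.
move=> lN; rewrite gbS; have := gb_ratio t lN.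
move: (t ^+ l.+1) (t ^+ (N - l)) (gb t N l.+1) (gb t N l) => a b g h E.
by apply/eqP; rewrite -subr_eq0 (_ : _ - _ = (1 - a) * g - (1 - b) * h); [rewrite E subrr|ring].
Qed.

Lemma sum_gb_pascal N (H : nat -> R) :
  \sum_(l < N.+2) gb t N.+1 l * H l =
  \sum_(l < N.+1) gb t N l * (H l + t ^+ (N - l) * H l.+1).
Proof.
rewrite big_ord_recl gb0 mul1r /=.
under eq_bigr => l _ do rewrite /bump /= add1n add0n mulrDl.
rewrite big_split addrA /= (_ : H 0%N + _ = \sum_(l < N.+1) gb t N l * H l).
  by rewrite -big_split; apply: eq_bigr => l _ /=; ring.
by rewrite big_ord_recr /= gb_small // mul0r addr0 [RHS]big_ord_recl gb0 mul1r.
Qed.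

Lemma sum_gb_pascal2 N (H : nat -> R) :
  \sum_(l < N.+2) gb t N.+1 l * H l =
  \sum_(l < N.+1) gb t N l * (t ^+ l * H l + H l.+1).
Proof.
rewrite big_ord_recl gb0 mul1r.
rewrite (eq_bigr (fun l : 'I_N.+1 => t ^+ l.+1 * gb t N l.+1 * H l.+1 + gb t N l * H l.+1)); last first.
  by move=> [l lN] _; rewrite lift0 gbS2 // mulrDl.
rewrite big_split addrA /= (_ : H 0%N + _ = \sum_(l < N.+1) t ^+ l * gb t N l * H l).
  by rewrite -big_split; apply: eq_bigr => l _ /=; ring.
by rewrite big_ord_recr /= gb_small // mulr0 mul0r addr0 [RHS]big_ord_recl gb0 !mul1r.
Qed.

Definition Pq l := \prod_(i < l) (q - t ^+ i.+1).
Definition Rr k := \prod_(i < k) (1 - q * t ^+ i.+1).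
Definition tfac k := \prod_(i < k) (1 - t ^+ i.+1).
Lemma PqS l : Pq l.+1 = Pq l * (q - t ^+ l.+1). Proof. exact: big_ord_recr. Qed.
Lemma RrS l : Rr l.+1 = Rr l * (1 - q * t ^+ l.+1). Proof. exact: big_ord_recr. Qed.
Lemma tfacS l : tfac l.+1 = tfac l * (1 - t ^+ l.+1). Proof. exact: big_ord_recr. Qed.

(** The bracket times its common denominator [Rr N]. One Pascal rule expresses [fsm] at [N + 1]
    through [fsm] and the companion [gsm] at [N]; the other Pascal rule gives [gsm] a recursion of
    its own. *)
Definition fsm N := \sum_(l < N.+1) gb t N l * (Pq l * Rr (N - l)).
Definition gsm N := \sum_(l < N.+1) gb t N l * (t ^+ (N - l) * Pq l * Rr (N - l)).

Lemma gsmS N : gsm N.+1 = q * (1 - t ^+ N.+2) * gsm N.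
Proof.
rewrite /gsm (sum_gb_pascal2 N (fun l => t ^+ (N.+1 - l) * Pq l * Rr (N.+1 - l))) mulr_sumr.
apply: eq_bigr => -[l lN] _ /=.
rewrite subSS subSn // RrS PqS.
have -> : t ^+ N.+2 = t ^+ (N - l).+1 * t ^+ l * t by rewrite -exprD -exprSr; congr (_ ^+ _); lia.
rewrite !exprS; ring.
Qed.

Lemma fsmS N : fsm N.+1 = (1 - t ^+ N.+1) * fsm N + q * (1 - t) * gsm N.
Proof.
rewrite /fsm /gsm (sum_gb_pascal N (fun l => Pq l * Rr (N.+1 - l))) !mulr_sumr -big_split.
apply: eq_bigr => -[l lN] _ /=.
rewrite subSS subSn // RrS PqS.
have -> : t ^+ N.+1 = t ^+ (N - l) * t ^+ l.+1 by rewrite -exprD; congr (_ ^+ _); lia.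
rewrite [t ^+ (N - l).+1]exprS; ring.
Qed.

Lemma gsmE N : (1 - t) * gsm N = q ^+ N * tfac N.+1.
Proof.
elim: N => [|N IH].
  by rewrite /gsm /tfac /Pq /Rr !big_ord1 !big_ord0 /= expr1 !mulr1 mul1r.
by rewrite gsmS mulrCA IH [tfac N.+2]tfacS [q ^+ N.+1]exprS; ring.
Qed.

Lemma fsmE N : fsm N = (\sum_(j < N.+1) q ^+ j) * tfac N.
Proof.
elim: N => [|N IH]; first by rewrite /fsm /tfac /Pq /Rr !big_ord1 !big_ord0 /= !mulr1.
rewrite fsmS -mulrA gsmE IH [\sum_(j < N.+2) _]big_ord_recr /= [tfac N.+1]tfacS [q ^+ N.+1]exprS; ring.
Qed.

Hypothesis tu : forall i, 1 - t ^+ i.+1 \is a GRing.unit.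
Hypothesis qu : forall i, 1 - q * t ^+ i.+1 \is a GRing.unit.

Lemma qsum N :
  (1 + \sum_(l < N) \prod_(i < l.+1)
     ((q - t ^+ i.+1) * (1 - t ^+ (N - i)) / ((1 - q * t ^+ (N - i)) * (1 - t ^+ i.+1))))
  * Rr N = (\sum_(j < N.+1) q ^+ j) * tfac N.
Proof.
rewrite -fsmE; pose U l := \prod_(i < l)
  ((q - t ^+ i.+1) * (1 - t ^+ (N - i)) / ((1 - q * t ^+ (N - i)) * (1 - t ^+ i.+1))).
have UE l : (l <= N)%N -> U l * Rr N = gb t N l * (Pq l * Rr (N - l)).
  elim: l => [|l IH] lN; first by rewrite /U /Pq !big_ord0 gb0 subn0 !mul1r.
  rewrite /U big_ord_recr /= -/(U l) mulrAC IH ?(ltnW lN) //.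
  have := gb_ratio t (ltnW lN); have := tu l; have := qu (N - l.+1).
  have -> : (N - l = (N - l.+1).+1)%N by rewrite subnSK.
  rewrite PqS RrS.
  move: (t ^+ l.+1) (t ^+ (N - l.+1).+1) (gb t N l.+1) (gb t N l) (Pq l) (Rr _) => a b g h p r ub ua E.
  apply: (mulIr ub); apply: (mulIr ua).
  rewrite -!mulrA [_^-1 * _](_ : _ = 1) ?mulr1.
    by rewrite [RHS](_ : _ = p * r * (q - a) * (1 - q * b) * ((1 - a) * g)); [rewrite E|]; ring.
  by rewrite mulVr // unitrM ub ua.
rewrite (_ : 1 + _ = \sum_(l < N.+1) U l).
  rewrite mulr_suml /fsm; apply: eq_bigr => l _; apply: UE; by rewrite -ltnS.
by rewrite [RHS]big_ord_recl /U big_ord0.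
Qed.
End Qsum.

Section Tnum.
Variable R : comNzRingType.
Implicit Types (t y : R) (P : {poly R}).

Definition tnum t k : R := \sum_(j < k) t ^+ j.

Lemma tnumS t k : tnum t k.+1 = tnum t k + t ^+ k.
Proof. exact: big_ord_recr. Qed.

(** For [P] a product of factors [X + x_l], the coefficients of [P * (X + y)] are symmetric in the
    [x_l] and [y] together, which is what [poinc] needs. The term of index [i] exceeds
    [(- t y)^i P_i] by [T i - T (i + 1)], and this telescopes. *)
Lemma horner_tnum t y P k : (size P <= k.+1)%N ->
  P.[- (t * y)] = \sum_(i < k.+1) tnum t i.+1 * (- y) ^+ i * (P * ('X + y%:P))`_i.+1.
Proof.
move=> sP; rewrite (horner_coef_wide _ sP).
pose T i := tnum t i * (- y) ^+ i * P`_i.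
have T0 : T 0%N = 0 by rewrite /T /tnum big_ord0 !mul0r.
have Tk : T k.+1 = 0 by rewrite /T nth_default ?mulr0.
have S0 : \sum_(i < k.+1) (T i - T i.+1) = 0.
  rewrite (eq_bigr (fun i : 'I_k.+1 => - (T i.+1 - T i))) => [|i _]; last by rewrite opprB.
  by rewrite sumrN -(big_mkord xpredT (fun i => T i.+1 - T i)) telescope_sumr // T0 Tk subrr oppr0.
rewrite -[LHS]addr0 -[X in _ + X = _]S0 -big_split; apply: eq_bigr => i _ /=.
rewrite mulrDr coefD coefMX coefMC /= /T !tnumS !exprS -mulrN exprMn; ring.
Qed.
End Tnum.

(** * The recursion of coefficients *)

Section Rec.
Variables (n N : nat) (sp : 'I_n) (Ef : gser n -> gser n) (A : gser 0).
Hypothesis N0 : (0 < N)%N.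
Hypothesis Nsp : (N <= sp)%N.
Hypothesis EfA : forall s la f, isX f -> aut s la (Ef f) = Ef (aut s la f).
Hypothesis EfS : forall f, isX f -> (1 - f) * Ef (Q n * f) = (1 - sc n A * f) * Ef f.
Implicit Types (f g h : gser n) (i j k l : nat).
Local Notation W := (wgt N sp Ef).
Local Notation qi b := (X b (0 : {ffun 'I_n -> int})).
Local Notation qi0 b := (X b (0 : {ffun 'I_0 -> int})).
Local Notation t := (Z 0).
Definition Lw g := CT (g * W).
Local Notation L := Lw.
Definition oi k : 'I_n := insubd sp k.
Definition yn k : gser n := x (oi k) / x sp.
Definition pre l : gser n := \prod_(i < l) yn i.

Lemma oiE k : (k < N)%N -> oi k = k :> nat.
Proof. by move=> kN; rewrite val_insubd ifT //; have := ltn_ord sp; lia. Qed.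

Lemma preS l : pre l.+1 = pre l * yn l. Proof. exact: big_ord_recr. Qed.

Lemma LB f g : L (f - g) = L f - L g. Proof. by rewrite /Lw mulrBl raddfB. Qed.
Lemma Lsc s f : L (sc n s * f) = s * L f. Proof. by rewrite /Lw -mulrA CT_scM. Qed.

Definition sw k := swp (oi k) (oi k.+1).
Lemma swM k f g : sw k (f * g) = sw k f * sw k g. Proof. exact: swpM. Qed.
Lemma sw1 k : sw k 1 = 1. Proof. exact: rmorph1. Qed.
Lemma sw_y k j : (k.+1 < N)%N -> (j < N)%N -> j != k -> j != k.+1 -> sw k (yn j) = yn j.
Proof.
move=> kN jN jk jk1; rewrite /sw /yn swp_xx (tperm_sp Nsp) ?oiE ?(ltnW kN) //.
by rewrite tpermD // -val_eqE /= !oiE // ?(ltnW kN) // eq_sym.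
Qed.
Lemma sw_yl k : (k.+1 < N)%N -> sw k (yn k) = yn k.+1.
Proof. by move=> kN; rewrite /sw /yn swp_xx tpermL (tperm_sp Nsp) ?oiE ?(ltnW kN). Qed.
Lemma sw_yr k : (k.+1 < N)%N -> sw k (yn k.+1) = yn k.
Proof. by move=> kN; rewrite /sw /yn swp_xx tpermR (tperm_sp Nsp) ?oiE ?(ltnW kN). Qed.

Lemma sw_prod k (r : seq nat) : (k.+1 < N)%N ->
  (forall j, j \in r -> [/\ (j < N)%N, j != k & j != k.+1]) ->
  sw k (\prod_(j <- r) yn j) = \prod_(j <- r) yn j.
Proof.
move=> kN h; rewrite /sw rmorph_prod; apply: eq_big_seq => j /h[? ? ?].
exact: sw_y.
Qed.

Lemma preE l : pre l = \prod_(0 <= i < l) yn i. Proof. by rewrite big_mkord. Qed.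

Lemma sw_pre k l : (k.+1 < N)%N -> (l <= N)%N -> l != k.+1 -> sw k (pre l) = pre l.
Proof.
move=> kN lN lk; rewrite preE; have [lk'|lk'] := leqP l k.
  by apply: sw_prod => // j; rewrite mem_index_iota => ?; split; lia.
have -> : \prod_(0 <= i < l) yn i =
    \prod_(0 <= i < k) yn i * (yn k * (yn k.+1 * \prod_(k.+2 <= i < l) yn i)).
  have k1 : (k.+1 < l)%N by lia.
  by rewrite -[in RHS]big_ltn // -[in RHS]big_ltn ?(ltnW k1) // -big_cat_nat // ltnW.
have e1 : sw k (\prod_(0 <= i < k) yn i) = \prod_(0 <= i < k) yn i.
  by apply: sw_prod => // j; rewrite mem_index_iota => ?; split; lia.
have e2 : sw k (\prod_(k.+2 <= i < l) yn i) = \prod_(k.+2 <= i < l) yn i.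
  by apply: sw_prod => // j; rewrite mem_index_iota => ?; split; lia.
rewrite (swM k (\prod_(0 <= i < k) _)) (swM k (yn k)) (swM k (yn k.+1)) e1 e2.
by rewrite sw_yl // sw_yr //; congr (_ * _); apply: mulrCA.
Qed.

Lemma L_step k h : (k.+1 < N)%N -> sw k h = h -> L (yn k.+1 * h) = t * L (yn k * h).
Proof.
by move=> kN hh; apply: (wgt_hecke Nsp EfA) => //; rewrite !oiE // ltnW.
Qed.

Lemma L_slide a d h : (a + d < N)%N ->
  (forall k, (a <= k)%N -> (k < a + d)%N -> sw k h = h) ->
  L (yn (a + d) * h) = t ^+ d * L (yn a * h).
Proof.
elim: d => [|d IH] adN hh; first by rewrite addn0 mul1r.
rewrite addnS in adN *.
have hd : sw (a + d) h = h by apply: hh; lia.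
rewrite (L_step adN hd) exprS -mulrA IH ?(ltnW adN) // => k ? ?.
by apply: hh; lia.
Qed.

Definition symm h := forall k, (k.+1 < N)%N -> sw k h = h.

Lemma L_shifted l h : (l < N)%N -> symm h ->
  L (\prod_(0 <= i < l) yn i.+1 * h) = t ^+ l * L (pre l * h).
Proof.
(* [d] counts the factors already raised, from the top down: when [y_j] is raised to [y_(j+1)], the
   remaining product must be invariant under the exchange of [j] and [j + 1]. *)
move=> lN hh; suff H d : (d <= l)%N ->
  L (pre (l - d) * \prod_(l - d <= i < l) yn i.+1 * h) = t ^+ d * L (pre l * h).
  by have := H l (leqnn l); rewrite subnn /pre big_ord0 mul1r.
elim: d => [|d IH] dl; first by rewrite subn0 big_geq // mulr1 mul1r.
have := IH (ltnW dl); set j := (l - d.+1)%N.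
have -> : (l - d = j.+1)%N by rewrite /j; lia.
rewrite preS => IHd; rewrite exprS -[RHS]mulrA -IHd.
set h' := pre j * \prod_(j.+1 <= i < l) yn i.+1 * h.
rewrite big_ltn; last by rewrite /j; lia.
have -> : pre j * (yn j.+1 * \prod_(j.+1 <= i < l) yn i.+1) * h = yn j.+1 * h'.
  by rewrite /h'; ring.
rewrite L_step; first by congr (_ * L _); rewrite /h'; ring.
  by rewrite /j; lia.
have jN : (j.+1 < N)%N by rewrite /j; lia.
rewrite /h' (swM j (_ * _) h) (swM j (pre j)) hh // sw_pre //; [|by lia|by lia].
congr (_ * _ * _); rewrite -(big_map S xpredT yn); apply: sw_prod => // k.
by case/mapP => i; rewrite mem_index_iota => ? ->; split; lia.
Qed.


Let Nn : (N <= n)%N. Proof. exact: leq_trans Nsp (ltnW (ltn_ord sp)). Qed.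
Local Notation om := (om Nn).

Lemma om_y k : (k.+1 < N)%N -> om (yn k) = yn k.+1.
Proof.
move=> kN; have kE : oi k = k :> nat by rewrite oiE // ltnW.
have k1 : (oi k).+1 != N by rewrite kE ltn_eqF.
rewrite /yn (om_xx Nn k1 (sp_last Nn Nsp)) (cyc_sp Nn Nsp).
suff -> : cyc Nn (oi k) = oi k.+1 by [].
by apply/val_inj; rewrite /= cycE kE cycnS // oiE.
Qed.

Lemma om_pre l : (l < N)%N -> om (pre l) = \prod_(0 <= i < l) yn i.+1.
Proof.
move=> lN; rewrite preE rmorph_prod; apply: eq_big_nat => i /andP[_ il].
by apply: om_y; lia.
Qed.

Lemma sc_qi b : sc n (qi0 b) = qi b. Proof. exact: sc_X. Qed.

(* [wgt_om] for [g = y_0 ... y_(l-1) h]: both sides reduce to the two products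
   [y_0 ... y_l h] and [y_0 ... y_(l-1) h] by [L_slide] and [L_shifted]. *)
Lemma shiftJ h c l : symm h -> om h = sc n c * h -> (l < N)%N ->
  L (pre l.+1 * h) * (A * t ^+ (N - l.+1) - c * qi0 (-1)) =
  L (pre l * h) * (1 - c * t ^+ l.+1).
Proof.
move=> sh oh lN.
have lE : (oi N.-1).+1 = N by rewrite oiE ?prednK.
have E := wgt_om Nn Nsp EfA EfS lE (oiE N0) (pre l * h).
rewrite -/(Lw _) -/(Lw _) in E.
have L1 : L (yn N.-1 * (pre l * h)) = t ^+ (N - l.+1) * L (pre l.+1 * h).
  have -> : N.-1 = (l + (N - l.+1))%N by lia.
  rewrite L_slide; [congr (_ * L _); rewrite preS; ring | by lia |].
  by move=> k lk kN; rewrite swM sh ?sw_pre //; lia.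
have L2 : L ((1 - sc n A * yn N.-1) * (pre l * h)) =
    L (pre l * h) - A * (t ^+ (N - l.+1) * L (pre l.+1 * h)).
  by rewrite mulrBl mul1r LB -mulrA (Lsc A) L1.
have L3 : L ((Z n - qi (-1) * yn 0) * om (pre l * h)) =
   c * (t * (t ^+ l * L (pre l * h)) - qi0 (-1) * L (pre l.+1 * h)).
  rewrite omM oh om_pre // -L_shifted // -!sc_qi -sc_Z.
  set P := \prod_(_ <= _ < _) _.
  have -> : (sc n t - sc n (qi0 (-1)) * yn 0) * (P * (sc n c * h)) =
     sc n c * (sc n t * (P * h) - sc n (qi0 (-1)) * (yn 0 * P * h)) by ring.
  have -> : yn 0 * P = pre l.+1 by rewrite preE big_nat_recl.
  by rewrite (Lsc c) LB (Lsc t) (Lsc (qi0 (-1))).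
move: E; rewrite L2 L3 exprS.
move: (L (pre l * h)) (L (pre l.+1 * h)) (t ^+ l) (t ^+ (N - l.+1)) (qi0 (-1)) => a b u v w E.
have -> : a * (1 - c * (t * u)) = a - A * (v * b) + A * (v * b) - c * (t * (u * a)) by ring.
by rewrite E; ring.
Qed.

(** When the last factor is split off, its [y_p] slides down to the first free place [l] at the cost
    of [t^(p-l)]: this is the Pascal rule that defines [gb]. *)
Lemma L_expand p h : (p <= N)%N -> (forall k, (k.+1 < p)%N -> sw k h = h) ->
  L (\prod_(i < p) (1 - sc n A * yn i) * h) =
  \sum_(l < p.+1) (- A) ^+ l * gb t p l * L (pre l * h).
Proof.
elim: p h => [|p IH] h pN hh.
  by rewrite big_ord0 big_ord1 /pre big_ord0 !mul1r.
have hs k : (k.+1 < p)%N -> sw k h = h by move=> kp; apply: hh; lia.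
rewrite big_ord_recr /= -mulrA mulrBl mul1r mulrBr LB IH; [|by lia|by []].
rewrite [_ * (sc n A * yn p * h)](_ : _ =
    sc n A * (\prod_(i < p) (1 - sc n A * yn i) * (yn p * h))); last by ring.
rewrite (Lsc A) IH; [|by lia|]; last first.
  by move=> k kp; rewrite swM hs // sw_y //; lia.
have E (l : 'I_p.+1) : L (pre l * (yn p * h)) = t ^+ (p - l) * L (pre l.+1 * h).
  rewrite [pre l * _]mulrCA -{1}(subnKC (ltn_ord l : (l <= p)%N)) L_slide.
  - by congr (_ * L _); rewrite preS; ring.
  - by rewrite subnKC // -ltnS.
  - move=> k lk kp; have ? := ltn_ord l; have kp' : (k < p)%N by lia.
    by rewrite swM hh ?sw_pre //; lia.
rewrite [RHS]big_ord_recl /= ?gb0 expr0 !mul1r.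
under [X in _ - A * X]eq_bigr do rewrite E.
rewrite [X in X - _]big_ord_recl /= ?gb0 expr0 !mul1r -addrA; congr (_ + _).
rewrite (_ : \sum_(i < p) _ =
    \sum_(i < p.+1) (- A) ^+ i.+1 * gb t p i.+1 * L (pre i.+1 * h)); last first.
  by rewrite [RHS]big_ord_recr /= gb_small // mulr0 mul0r addr0.
rewrite mulr_sumr -sumrB; apply: eq_bigr => i _.
by rewrite /bump /= ?add0n ?add1n [(- A) ^+ i.+1]exprS; ring.
Qed.
End Rec.

(** * Homogeneity from rescaling the variables *)

Section Degree.
Variable n : nat.
Implicit Types (f g : gser n) (la : 'I_n -> int).
Local Notation qi b := (X b (0 : {ffun 'I_n -> int})).

Lemma shear_supp la f b : aut 1%g la f = qi b * f ->
  supported (fun c => shear la c.2 = b) f.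
Proof.
(* Otherwise [f] would be periodic along the exponents of [q], against [good]. *)
move=> E [[a e] al] nf /=; apply/eqP/negPn/negP => neq.
pose d := shear la al - b.
have p1 : pal 1%g al = al by apply/ffunP => j; rewrite ffunE invg1 perm1.
have step e' : f (a, e', al) = f (a, e' + d, al).
  have := pushE (lin 1%g la) f (a, e', al); rewrite E X_mulE => <-; congr (f _).
  by rewrite /= /lin_fun /= p1; congr (_, _, _); rewrite /= ?subr0 // /d addrA.
have step' e' (k : nat) : f (a, e', al) = f (a, e' + d * k%:Z, al).
  elim: k => [|k ->]; first by rewrite mulr0 addr0.
  by rewrite step; congr (f (_, _, _)); rewrite intS; ring.
have [_ gf] := gvalP f; have [b0 h] := gf a 0%N.
have d0 : d != 0 by rewrite subr_eq0.
pose k := absz (e - b0 + 1); have := nf; rewrite /nz.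
case: (ltrP d 0) => [dn|dp].
  rewrite (step' e k) => /h /= /(_ (lexx _)); rewrite mul0n add0r.
  have : k%:Z >= e - b0 + 1 by rewrite /k; lia.
  move: (k) => k'; nia.
have -> : f (a, e, al) = f (a, e - d * k%:Z, al) by rewrite (step' (e - _) k) subrK.
move/h => /= /(_ (lexx _)); rewrite mul0n add0r.
have : k%:Z >= e - b0 + 1 by rewrite /k; lia.
by move: (k) d0 dp => k' d0 dp; nia.
Qed.
End Degree.

Section CTlim.
Variable n : nat.
Lemma CT_cvg U (L : gser n) : gcvg U L -> gcvg (fun M => CT (U M)) (CT L).
Proof.
move=> [gU UL]; split=> [|c]; last by have [M0 h] := UL (iota_fun n c); exists M0.
have [U0 hU] := gU; split=> [c [M nM]|a s].
  exact: (U0 (iota_fun n c) (ex_intro _ M nM)).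
have [b0 h] := hU a s; exists b0 => c [M nM] ca.
have := h (iota_fun n c) (ex_intro _ M nM) ca.
by rewrite wt0 [X in wt X]ffun0_eq wt0.
Qed.
End CTlim.

(** * The recursion in the parameter [A] *)

Section Norm.
Variable n : nat.
Implicit Types (f g : gser n).
Local Notation q := (Q n).
Local Notation z := (Z n).
Local Notation t := (Z 0).
Local Notation q0 := (Q 0).

(* The factor [(y; q)_oo / (A y; q)_oo] for [A = q^M] and for [A = z q^M]. *)
Definition efac1 M f := gpoch f q M.
Definition efac2 M f := gpoch (z * f) q M * gD f.

Lemma aut_gpoch s la f M : aut s la (gpoch f q M) = gpoch (aut s la f) q M.
Proof.
rewrite /gpoch rmorph_prod; apply: eq_bigr => k _.
by rewrite rmorphB rmorph1 rmorphM rmorphXn /= aut_Q.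
Qed.

Lemma E1A M s la f : isX f -> aut s la (efac1 M f) = efac1 M (aut s la f).
Proof. by move=> _; apply: aut_gpoch. Qed.
Lemma E2A M s la f : isX f -> aut s la (efac2 M f) = efac2 M (aut s la f).
Proof. by move=> Xf; rewrite /efac2 rmorphM /= aut_gpoch (aut_gD _ _ Xf) rmorphM /= aut_Z. Qed.

Lemma gpoch_comm f M : (1 - f) * gpoch (q * f) q M = (1 - q ^+ M * f) * gpoch f q M.
Proof. by rewrite [q * f]mulrC -gpochSl gpochS mulrC [f * _]mulrC. Qed.

Lemma E1S M f : isX f -> (1 - f) * efac1 M (q * f) = (1 - sc n (q0 ^+ M) * f) * efac1 M f.
Proof. by move=> _; rewrite rmorphXn /= sc_Q; apply: gpoch_comm. Qed.

Lemma E2S M f : isX f -> (1 - f) * efac2 M (q * f) = (1 - sc n (t * q0 ^+ M) * f) * efac2 M f.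
Proof.
move=> Xf; rewrite rmorphM rmorphXn /= sc_Q sc_Z /efac2.
have := gpoch_comm (z * f) M; have := gD_q Xf.
rewrite [z * (q * f)]mulrCA [z * q ^+ M]mulrC -[q ^+ M * z * f]mulrA.
move: (gD (q * f)) (gD f) (gpoch (q * (z * f)) q M) (gpoch (z * f) q M) => d1 d2 g1 g2 e1 e2.
by rewrite [LHS]mulrCA -e1 [LHS]mulrCA [LHS]mulrA e2 [RHS]mulrA.
Qed.

Lemma E1_succ M f : efac1 M.+1 f = (1 - sc n (q0 ^+ M) * f) * efac1 M f.
Proof. by rewrite /efac1 gpochS rmorphXn /= sc_Q mulrC [f * _]mulrC. Qed.
Lemma E2_succ M f : efac2 M.+1 f = (1 - sc n (t * q0 ^+ M) * f) * efac2 M f.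
Proof.
rewrite /efac2 gpochS rmorphM rmorphXn /= sc_Q sc_Z.
by rewrite [z * f * _]mulrAC; ring.
Qed.

Variables (N : nat) (sp : 'I_n).
Hypothesis N0 : (0 < N)%N.
Hypothesis Nsp : (N <= sp)%N.
Local Notation I Ef := (CT (wgt N sp Ef)).

Lemma prod_oi (F : 'I_n -> gser n) :
  \prod_(i : 'I_n | (i < N)%N) F i = \prod_(k < N) F (oi sp k).
Proof.
have Nn : (N <= n)%N by exact: leq_trans Nsp (ltnW (ltn_ord sp)).
rewrite (big_ord_narrow Nn); apply: eq_bigr => k _; congr F.
by apply/val_inj; rewrite /= (oiE N0 Nsp).
Qed.

(** [Ef'] is [Ef] with [q A] in place of [A]. The extra factors [1 - A y_i] are expanded by
    [L_expand], and [shiftJ] with [h = 1] supplies the recursion that lets [gauss_sum] evaluate the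
    result. *)
Lemma I_rec (Ef Ef' : gser n -> gser n) (A : gser 0) :
  (forall s la f, isX f -> aut s la (Ef f) = Ef (aut s la f)) ->
  (forall f, isX f -> (1 - f) * Ef (q * f) = (1 - sc n A * f) * Ef f) ->
  (forall f, Ef' f = (1 - sc n A * f) * Ef f) ->
  (1 - q0 * A) * I Ef' = (1 - q0 * A * t ^+ N) * I Ef.
Proof.
move=> EA ES E'; pose J l := Lw N sp Ef (pre sp l).
have -> : I Ef = J 0%N by rewrite /J /Lw /pre big_ord0 mul1r.
have h1 : symm N sp 1 by move=> k _; apply: sw1.
have Jr l : (l < N)%N ->
    J l.+1 * (1 - q0 * A * t ^+ (N - l.+1)) = - q0 * J l * (1 - t ^+ l.+1).
  move=> lN; have := shiftJ N0 (Nsp := Nsp) EA ES h1 (c := 1) _ lN.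
  rewrite !mulr1 !mul1r -/(J l) -/(J l.+1) [om _ _]rmorph1 [sc n 1]rmorph1 => /(_ erefl) h.
  have -> : - q0 * J l * (1 - t ^+ l.+1) = - q0 * (J l * (1 - t ^+ l.+1)) by ring.
  rewrite -h.
  have qV : q0 * X (-1) (0 : {ffun 'I_0 -> int}) = 1 by apply: q_qV.
  have -> : 1 - q0 * A * t ^+ (N - l.+1) =
      q0 * X (-1) (0 : {ffun 'I_0 -> int}) - q0 * A * t ^+ (N - l.+1) by rewrite qV.
  ring.
rewrite -(gauss_sum (erefl (q0 * A)) Jr).
congr (_ * _).
have -> : I Ef' = Lw N sp Ef (\prod_(i < N) (1 - sc n A * yn sp i) * 1).
  rewrite mulr1 /Lw /wgt mulrA; congr (CT (_ * _)).
  rewrite -(prod_oi (fun i => 1 - sc n A * (x i / x sp))) -big_split /=.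
  by apply: eq_bigr => i _; rewrite E'; apply/esym/mulrA.
rewrite (L_expand A N0 Nsp EA (leqnn N) h1).
by apply: eq_bigr => l _; rewrite mulr1.
Qed.
End Norm.

(** * The constant term of the nonsymmetric weight *)

Lemma telescope_step (R : comNzRingType) (a b c u v w x q A : R) :
  b * u = c * v -> (1 - q * (A * w)) * a = (1 - q * (A * w) * x) * b ->
  a * (u * (1 - q * A * w)) = c * (v * (1 - q * A * x * w)).
Proof.
move=> IH h; have -> : a * (u * (1 - q * A * w)) = u * ((1 - q * (A * w)) * a) by ring.
rewrite h (_ : u * _ = b * u * (1 - q * (A * w) * x)); last by ring.
by rewrite IH; ring.
Qed.

Section Limit.
Variables (n N : nat) (sp : 'I_n).
Hypothesis N0 : (0 < N)%N.
Hypothesis Nsp : (N <= sp)%N.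
Implicit Types (f g : gser n).
Local Notation q := (Q n).
Local Notation z := (Z n).
Local Notation t := (Z 0).
Local Notation q0 := (Q 0).
Local Notation I Ef := (CT (wgt N sp Ef)).

Lemma I_iter (E : nat -> gser n -> gser n) (A : gser 0) M :
  (forall M s la f, isX f -> aut s la (E M f) = E M (aut s la f)) ->
  (forall M f, isX f -> (1 - f) * E M (q * f) = (1 - sc n (A * q0 ^+ M) * f) * E M f) ->
  (forall M f, E M.+1 f = (1 - sc n (A * q0 ^+ M) * f) * E M f) ->
  I (E M) * gpoch (q0 * A) q0 M = I (E 0%N) * gpoch (q0 * A * t ^+ N) q0 M.
Proof.
move=> EA ES E'; elim: M => [|M IH]; first by rewrite /gpoch !big_ord0.
have := I_rec N0 Nsp (EA M) (ES M) (E' M); rewrite !gpochS.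
exact: telescope_step IH.
Qed.

Lemma I_lim (E : nat -> gser n -> gser n) (A : gser 0) :
  (forall M s la f, isX f -> aut s la (E M f) = E M (aut s la f)) ->
  (forall M f, isX f -> (1 - f) * E M (q * f) = (1 - sc n (A * q0 ^+ M) * f) * E M f) ->
  (forall M f, E M.+1 f = (1 - sc n (A * q0 ^+ M) * f) * E M f) ->
  (forall f, isX f -> gcvg (fun M => E M f) (pinf f)) -> ismon A ->
  I (@pinf n) * pinf (q0 * A) = I (E 0%N) * pinf (q0 * A * t ^+ N).
Proof.
move=> EA ES E' El mA.
have mq : ismon (q0 * A) by apply: ismonM => //; apply: ismonQ.
have mt : ismon (q0 * A * t ^+ N) by apply: ismonM => //; apply/ismonXn/ismonZ.
have cI : gcvg (fun M => I (E M)) (I (@pinf n)).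
  apply: CT_cvg; rewrite /wgt; apply: gcvgM; last exact: gcvg_cst.
  apply: gcvg_prod => i _; apply: gcvgM; last exact: gcvg_cst.
  by apply: El; apply: isX_xx.
apply: gcvg_unique (gcvgM cI (pinf_cvg mq)) _.
by apply: gcvg_eq (gcvgM (gcvg_cst _) (pinf_cvg mt)) => M; rewrite (I_iter M EA ES E').
Qed.

Lemma I_lim1 : I (@pinf n) * pinf q0 = I (fun=> 1) * pinf (q0 * t ^+ N).
Proof.
have ES M f : isX f -> (1 - f) * efac1 M (q * f) = (1 - sc n (1 * q0 ^+ M) * f) * efac1 M f.
  by rewrite mul1r; apply: E1S.
have E' M f : efac1 M.+1 f = (1 - sc n (1 * q0 ^+ M) * f) * efac1 M f.
  by rewrite mul1r; apply: E1_succ.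
have El f : isX f -> gcvg (fun M => efac1 M f) (pinf f).
  by move=> Xf; apply: pinf_cvg; apply: isX_mon.
have := I_lim (@E1A n) ES E' El (ismon1 0); rewrite mulr1.
have -> : efac1 (n := n) 0 = fun=> 1 by apply/funext => f; rewrite /efac1 /gpoch big_ord0.
by [].
Qed.

Lemma I_lim2 : I (@pinf n) * pinf (q0 * t) = I (@gD n) * pinf (q0 * t ^+ N.+1).
Proof.
have El f : isX f -> gcvg (fun M => efac2 M f) (pinf f).
  move=> Xf; have -> : pinf f = pinf (z * f) * gD f.
    by rewrite gD.unlock mulrCA divrr ?pinfz_unit // mulr1.
  by apply: gcvgM; [apply: pinf_cvg; apply: ismonzX | apply: gcvg_cst].
have := I_lim (@E2A n) (@E2S n) (@E2_succ n) El (ismonZ 0).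
have -> : efac2 (n := n) 0 = @gD n by apply/funext => f; rewrite /efac2 /gpoch big_ord0 mul1r.
by rewrite -[_ * t ^+ N]mulrA -exprS.
Qed.
End Limit.

Section Consts.
Variable n : nat.
Implicit Types (f g : gser n).
Local Notation q := (Q n).
Local Notation z := (Z n).
Local Notation t := (Z 0).
Local Notation q0 := (Q 0).
Local Notation qi b := (X b (0 : {ffun 'I_n -> int})).
Definition ct_dlt N := CT (dlt n N).

Lemma pair_split (F : 'I_n * 'I_n -> gser n) p (o : 'I_n) : o = p :> nat ->
  \prod_(e : 'I_n * 'I_n | (e.1 < e.2 < p.+1)%N) F e =
  \prod_(l : 'I_n | (l < p)%N) F (l, o) * \prod_(e : 'I_n * 'I_n | (e.1 < e.2 < p)%N) F e.
Proof.
move=> op; rewrite [LHS](bigID (fun e : 'I_n * 'I_n => e.2 == o)) /=; congr (_ * _).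
  rewrite (reindex_onto (fun i => (i, o)) fst) /=; last first.
    by case=> i j /andP[_ /eqP /= ->].
  by apply: eq_bigl => i; rewrite !eqxx !andbT op ltnSn andbT.
by apply: eq_bigl => -[i j] /=; rewrite -val_eqE /= op; lia.
Qed.

Lemma wgt_gD N (sp : 'I_n) : sp = N :> nat -> wgt N sp (@gD n) = dlt n N.+1.
Proof. by move=> spN; rewrite /wgt [RHS](pair_split _ spN). Qed.

Definition dge (sp : 'I_n) (k : int) : idx n -> Prop := fun c => k <= c.2 sp.

Lemma dgeM sp k l f g : supported (dge sp k) f -> supported (dge sp l) g ->
  supported (dge sp (k + l)) (f * g).
Proof. by apply: supportedM => u v; rewrite /dge /= ffunE; apply: lerD. Qed.

Lemma dge_le sp k l f : l <= k -> supported (dge sp k) f -> supported (dge sp l) f.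
Proof. by move=> lk h c /h; apply: le_trans. Qed.

(** Multiplying a series without [x sp] by such an [f] does not change its constant term. *)
Definition near1 sp f := supported (dge sp 1) (f - 1).

Lemma near1_ge0 sp f : near1 sp f -> supported (dge sp 0) f.
Proof.
move=> h; rewrite -[f](subrK 1); apply: supportedD; first exact: dge_le h.
by move=> c; rewrite /nz goneE; case: (c =P 0) => // ->; rewrite /dge ffunE.
Qed.

Lemma near1_1 sp : near1 sp 1.
Proof. by rewrite /near1 subrr; apply: supported0. Qed.

Lemma near1M sp f g : near1 sp f -> near1 sp g -> near1 sp (f * g).
Proof.
move=> hf hg; rewrite /near1 (_ : _ - 1 = (f - 1) * g + (g - 1)); last by ring.
apply: supportedD => //; rewrite -[1]addr0; apply: dgeM => //; exact: near1_ge0.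
Qed.

Lemma near1_prod sp I (r : seq I) (P : pred I) (F : I -> gser n) :
  (forall i, P i -> near1 sp (F i)) -> near1 sp (\prod_(i <- r | P i) F i).
Proof. by move=> h; elim/big_rec: _ => [|i f Pi hf]; [exact: near1_1|apply: near1M; [exact: h|]]. Qed.

Lemma X_dge sp b (al : {ffun 'I_n -> int}) k : k <= al sp -> supported (dge sp k) (X b al).
Proof. exact: supported_mon. Qed.

Lemma dge_Xn sp f k : supported (dge sp 0) f -> supported (dge sp 0) (f ^+ k).
Proof.
move=> h; elim: k => [|k IH]; first exact/near1_ge0/near1_1.
by rewrite exprS -[0]addr0; apply: dgeM.
Qed.

Lemma q_dge sp : supported (dge sp 0) q.
Proof. by apply: X_dge; rewrite ffunE. Qed.
Lemma z_dge sp : supported (dge sp 0) z.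
Proof. by apply: supported_mon; rewrite /dge ffunE. Qed.

Lemma near1_pinf sp f : ismon f -> supported (dge sp 1) f -> near1 sp (pinf f).
Proof.
move=> mf hf; apply: gcvg_supp (gcvg_sub 1 (pinf_cvg mf)) _ => M.
apply: near1_prod => k _; rewrite /near1 addrAC subrr sub0r; apply: supportedN.
by rewrite -[1]addr0; apply: dgeM => //; apply/dge_Xn/q_dge.
Qed.

Lemma near1_gD sp f : isX f -> supported (dge sp 1) f -> near1 sp (gD f).
Proof.
move=> Xf hf; rewrite gD.unlock; apply: near1M.
  by apply: near1_pinf => //; apply: isX_mon.
have hz : near1 sp (pinf (z * f)).
  apply: near1_pinf; first exact: ismonzX.
  by rewrite -[1]add0r; apply: dgeM => //; apply: z_dge.
have zp : zpos (pinf (z * f) - 1).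
  apply: gcvg_supp (gcvg_sub 1 (pinf_cvg (ismonzX Xf))) _ => M.
  by apply/gpoch_zpos/zposM/zposZ.
set p := pinf (z * f) in hz zp *; have pu : p \is a GRing.unit by apply: pinfz_unit.
have pE : p = 1 - (1 - p) by rewrite subKr.
have zp' : zpos (1 - p) by rewrite -opprB; apply: supportedN.
have h0 : supported (dge sp 0) p^-1.
  rewrite pE; apply: supported_neumann => //.
  - by rewrite /dge ffunE.
  - by move=> u v; rewrite /dge /= ffunE; apply: addr_ge0.
  - by rewrite -opprB; apply: supportedN; apply: dge_le hz.
rewrite /near1 (_ : _ - 1 = - ((p - 1) * p^-1)); last first.
  by rewrite mulrBl divrr // mul1r opprB.
by apply: supportedN; rewrite -[1]addr0; apply: dgeM.
Qed.

Lemma dlt_deg N (sp : 'I_n) : (N <= sp)%N -> supported (fun c => c.2 sp = 0) (dlt n N).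
Proof.
(* Only [x sp] is rescaled, and it does not occur in [dlt n N]. *)
move=> Nsp; pose la (j : 'I_n) : int := (j == sp)%:R.
have la0 (k : 'I_n) : (k < N)%N -> la k = 0.
  by move=> kN; rewrite /la -val_eqE ltn_eqF //=; apply: leq_trans kN Nsp.
have E : aut 1%g la (dlt n N) = qi 0 * dlt n N.
  rewrite X00 mul1r rmorph_prod; apply: eq_bigr => -[i j] /= /andP[ij jN].
  by rewrite aut_pr0 ?perm1 // !la0 // (ltn_trans ij jN).
move=> c /(shear_supp E); rewrite /shear (bigD1 sp) //= /la eqxx mul1r big1 ?addr0 //.
by move=> j /negPf ->; rewrite mul0r.
Qed.

(** With [Ef = 1] the variable [x sp] enters only through [q x_sp / x_i], thus with nonnegative
    exponents, and every correction to 1 has positive degree in it. *)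
Lemma wgt_1 N (sp : 'I_n) : (N <= sp)%N -> CT (wgt N sp (fun=> 1)) = ct_dlt N.
Proof.
move=> Nsp; rewrite /wgt; set P := \prod_(_ | _) _.
have hP : near1 sp P.
  apply: near1_prod => i iN; rewrite mul1r; apply: near1_gD; first exact: isX_qxx.
  rewrite -[1]add0r; apply: dgeM; first exact: q_dge.
  rewrite !xE XV XM; apply: X_dge; rewrite !ffunE eqxx.
  by rewrite -val_eqE gtn_eqF ?subr0 //; apply: leq_trans iN Nsp.
rewrite -[P](subrK 1) mulrDl mul1r raddfD /= -[RHS]add0r; congr (_ + _).
have h : supported (dge sp 1) ((P - 1) * dlt n N).
  rewrite -[1]addr0; apply: dgeM => // c /(dlt_deg Nsp) E; by rewrite /dge E.
apply: gserP => c; apply/eqP/negPn/negP => /h.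
by rewrite /dge /= ffunE.
Qed.

Lemma ct_dlt_rec N : (0 < N < n)%N ->
  ct_dlt N.+1 * (pinf q0 * pinf (q0 * t ^+ N.+1)) = ct_dlt N * pinf (q0 * t ^+ N) * pinf (q0 * t).
Proof.
case/andP=> N0 Nn; pose sp := Ordinal Nn; have Nsp : (N <= sp)%N by [].
have e1 := I_lim1 N0 Nsp; have e2 := I_lim2 N0 Nsp.
rewrite (wgt_1 Nsp) in e1; rewrite wgt_gD // -/(ct_dlt _) in e2.
by rewrite mulrCA -e2 mulrCA mulrA e1.
Qed.

Lemma ct_dlt_val N : (0 < N <= n)%N ->
  ct_dlt N * (pinf q0 ^+ N.-1 * pinf (q0 * t ^+ N)) = pinf (q0 * t) ^+ N.
Proof.
case: N => // N /= Nn; elim: N Nn => [|N IH] Nn.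
  rewrite expr0 mul1r !expr1 /ct_dlt /dlt big1 ?CT1 ?mul1r // => -[i j] /=; lia.
have IHN := IH (ltnW Nn); have := ct_dlt_rec (N := N.+1); rewrite Nn => /(_ isT) E.
rewrite [pinf (q0 * t) ^+ N.+2]exprSr -IHN /= exprSr.
by rewrite -mulrA mulrCA E; ring.
Qed.
End Consts.

(** * The coefficients of the power sum *)

Local Notation t := (Z 0).
Local Notation q0 := (Q 0).
Local Notation qi0 b := (X b (0 : {ffun 'I_0 -> int})).

Section Top.
Variable N : nat.
Hypothesis N0 : (0 < N)%N.
Local Notation n := N.+1.
Implicit Types (m : int).
Let sp : 'I_n := ord_max.
Let Nsp : (N <= sp)%N. Proof. exact: leqnn. Qed.
Local Notation D := (dlt n n).

(* [(x_0 ... x_(N-1))^-m x_N^(N m)] *)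
Definition ymono m : gser n := X 0 [ffun l : 'I_n => if (l < N)%N then - m else N%:Z * m].
Definition acoef m := CT (ymono m * D).

Lemma acoefE m : acoef m = Lw N sp (@gD n) (ymono m).
Proof. by rewrite /Lw wgt_gD. Qed.

Lemma X_prod (I : Type) (r : seq I) (al : I -> {ffun 'I_n -> int}) :
  \prod_(i <- r) X 0 (al i) = X 0 (\sum_(i <- r) al i).
Proof.
elim: r => [|i r IH]; first by rewrite !big_nil X00.
by rewrite !big_cons IH XM addr0.
Qed.

(** Closes the recursion: [N] applications of [shiftJ] lead from [m] to [m - 1]. *)
Lemma preN_ymono : pre sp N = ymono (-1).
Proof.
rewrite /pre /ymono; have E (i : 'I_N) : yn sp i = X 0 (ex (oi sp i) - ex sp).
  by rewrite /yn !xE XV XM oppr0 addr0.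
rewrite (eq_bigr _ (fun i _ => E i)) X_prod; congr X; apply/ffunP => l.
rewrite sum_ffunE ffunE; case: ltnP => lN.
  rewrite (bigD1 (Ordinal lN)) //= !ffunE big1 ?addr0 => [|k kl].
    rewrite -!val_eqE /= (oiE N0 Nsp) // eqxx ltn_eqF //.
  rewrite !ffunE -!val_eqE /= (oiE N0 Nsp) // [(l : nat) == N]ltn_eqF // subr0.
  by case: eqP => // E'; case/eqP: kl; apply/val_inj.
have {}lN : l = sp by apply/val_inj/anti_leq; rewrite /= lN -ltnS ltn_ord.
rewrite (eq_bigr (fun=> -1)) => [|k _]; first by rewrite sumr_const card_ord mulNrn natz mulrN1.
by rewrite !ffunE lN eqxx -val_eqE /= (oiE N0 Nsp) // gtn_eqF // sub0r.
Qed.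

Lemma ymonoM m m' : ymono m * ymono m' = ymono (m + m').
Proof.
rewrite XM addr0; congr X; apply/ffunP => l; rewrite !ffunE.
by case: ifP => _; [rewrite opprD | rewrite mulrDr].
Qed.

Lemma ymono_sym m : symm N sp (ymono m).
Proof.
move=> k kN; rewrite /sw /swp aut_X /shear big1 ?addr0 => [|j _]; last by rewrite mul0r.
congr X; apply/ffunP => l; rewrite !ffunE tpermV.
by rewrite tperm_lt ?(oiE N0 Nsp) ?(ltnW kN).
Qed.

Let Nn : (N <= n)%N. Proof. exact: leqnSn. Qed.

Lemma ymono_om (NN : (N <= n)%N) m : om NN (ymono m) = sc n (qi0 m) * ymono m.
Proof.
have lN : (N.-1 < n)%N by rewrite prednK // leqnSn.
rewrite sc_X /om aut_X XM !add0r; congr X.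
  rewrite /shear (bigD1 (Ordinal lN)) //= big1 => [|j jN].
    rewrite /cycla /= prednK // eqxx ffunE /= prednK // leqnn addr0; ring.
  rewrite /cycla; case: eqP => [E|]; last by rewrite mul0r.
  by case/eqP: jN; apply/val_inj => /=; rewrite -[LHS]/(j.+1.-1) E.
apply/ffunP => l; rewrite !ffunE -[l in RHS](permKV (cyc NN)) cyc_lt //.
Qed.

Lemma acoef_rec m : acoef (m - 1) * \prod_(l < N) (t ^+ (N - l) - qi0 (m - 1)) =
  acoef m * \prod_(l < N) (1 - qi0 m * t ^+ l.+1).
Proof.
pose J l := Lw N sp (@gD n) (pre sp l * ymono m).
have J0 : J 0%N = acoef m by rewrite acoefE /J /pre big_ord0 mul1r.
have JN : J N = acoef (m - 1) by rewrite acoefE /J preN_ymono ymonoM addrC.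
have Jr l : (l < N)%N ->
   J l.+1 * (t ^+ (N - l) - qi0 (m - 1)) = J l * (1 - qi0 m * t ^+ l.+1).
  move=> lN.
  have EA (s : {perm 'I_n}) la f : isX f -> aut s la (gD f) = gD (aut s la f) by apply: aut_gD.
  have ES f : isX f -> (1 - f) * gD (Q n * f) = (1 - sc n t * f) * gD f.
    by move=> Xf; rewrite sc_Z gD_q.
  have := shiftJ N0 (Nsp := Nsp) EA ES (ymono_sym m) (ymono_om _ m) lN.
  by rewrite -/(J l) -/(J l.+1) -exprS XM addr0 -subSn.
rewrite -J0 -JN; suff H l : (l <= N)%N ->
   J l * \prod_(k < l) (t ^+ (N - k) - qi0 (m - 1)) = J 0%N * \prod_(k < l) (1 - qi0 m * t ^+ k.+1).
  exact: H.
elim: l => [|l IH] lN; first by rewrite !big_ord0.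
rewrite !big_ord_recr /= [RHS]mulrA -IH ?(ltnW lN) //.
by rewrite mulrCA Jr // mulrCA mulrA.
Qed.

Definition tri m : int := ((m * (m - 1)) %/ 2)%Z.
Definition sg m : gser 0 := ((-1) ^ (N%:Z * m) : int)%:~R * qi0 (N%:Z * tri m).
(** The part of the right-hand side that obeys the recursion of [acoef]. The second argument has an
    extra [q] because the factors [1 - t^(l+1) q^m] of the products in the formula cancel the
    denominator of the bracket. *)
Definition bcoef m : gser 0 := sg m *
  \prod_(l < N) (pinf (t ^+ l.+1 * qi0 (1 - m)) * pinf (t ^+ l.+1 * qi0 m * q0)).

Lemma triS m : tri m = tri (m - 1) + (m - 1).
Proof.
rewrite /tri (_ : m * (m - 1) = (m - 1) * 2 + (m - 1) * (m - 1 - 1)); last by ring.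
by rewrite divzMDl // addrC.
Qed.

Lemma sgS m : sg m = sg (m - 1) * \prod_(l < N) (- qi0 (m - 1)).
Proof.
rewrite prodr_const card_ord /sg -[- qi0 _]mulN1r exprMn XX mulrACA XM mul0rn addr0.
have -> : N%:Z * tri m = N%:Z * tri (m - 1) + (m - 1) *+ N.
  by rewrite triS mulrDr intMn.
set A := X _ _.
suff -> : ((-1) ^ (N%:Z * m) : int)%:~R =
    ((-1) ^ (N%:Z * (m - 1)) : int)%:~R * (-1) ^+ N :> gser 0 by [].
have -> : (-1 : gser 0) ^+ N = ((-1) ^+ N : int)%:~R by rewrite rmorphXn rmorphN1.
rewrite -intrM; congr _%:~R.
have -> : N%:Z * m = N%:Z * (m - 1) + N%:Z by ring.
by rewrite exprzDr ?unitrN1.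
Qed.

Lemma qi0_unit b : qi0 b \is a GRing.unit. Proof. exact: X_unit. Qed.
Lemma ismon_tq l b : ismon (t ^+ l * qi0 b).
Proof. by apply: ismonM; [apply/ismonXn/ismonZ | apply: ismonX]. Qed.
Lemma zpos_tq l b : zpos (t ^+ l.+1 * qi0 b).
Proof. exact/zposM/zposZX. Qed.

Lemma bcoef_rec m : bcoef (m - 1) * \prod_(l < N) (t ^+ (N - l) - qi0 (m - 1)) =
  bcoef m * \prod_(l < N) (1 - qi0 m * t ^+ l.+1).
Proof.
rewrite (reindex_inj rev_ord_inj) /= /bcoef (sgS m) -!mulrA -!big_split /=; congr (_ * (_ * _)).
apply: eq_bigr => l _; rewrite subKn ?ltn_ord //.
set u := t ^+ l.+1.
have e1 : pinf (u * qi0 m) = (1 - u * qi0 m) * pinf (u * qi0 m * q0).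
  exact/pinfS/ismon_tq.
have e2 : pinf (u * qi0 (1 - m)) = (1 - u * qi0 (1 - m)) * pinf (u * qi0 (1 - (m - 1))).
  rewrite pinfS; last exact: ismon_tq.
  by rewrite -mulrA XM addr0 (_ : 1 - m + 1 = 1 - (m - 1)) //; ring.
have e3 : qi0 (m - 1) * qi0 (1 - m) = 1.
  by rewrite XM addr0 (_ : m - 1 + (1 - m) = 0) ?X00 //; ring.
have e4 : u * qi0 (m - 1) * q0 = u * qi0 m by rewrite -mulrA XM addr0 subrK.
rewrite e4 e1 e2; move: (pinf _) (pinf _) => a b.
rewrite (_ : u - qi0 (m - 1) = - qi0 (m - 1) * (1 - u * qi0 (1 - m))); first by ring.
rewrite mulrBr mulr1 mulNr mulrCA mulrA -mulrA [X in _ = _ - - X]mulrC.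
by rewrite opprK addrC mulrC e3 mulr1.
Qed.

Lemma bcoef0 : bcoef 0 = \prod_(l < N) (pinf (t ^+ l.+1 * q0) * pinf (t ^+ l.+1 * q0)).
Proof.
have t0 : tri 0 = 0 by [].
rewrite /bcoef /sg t0 !mulr0 expr0z X00 !mul1r.
by apply: eq_bigr => l _; rewrite subr0 mulr1.
Qed.

(** Both sequences satisfy one first-order recursion whose multipliers are units on either side, so
    the induction runs upwards and downwards from 0. *)
Lemma acoef_bcoef m : acoef m * bcoef 0 = acoef 0 * bcoef m.
Proof.
have P k : \prod_(l < N) (1 - qi0 k * t ^+ l.+1) \is a GRing.unit.
  apply: rpred_prod => l _; apply: zpos_unit; rewrite mulrC; exact: zpos_tq.
have R k : \prod_(l < N) (t ^+ (N - l) - qi0 k) \is a GRing.unit.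
  apply: rpred_prod => l _.
  rewrite (_ : _ - _ = - qi0 k * (1 - t ^+ (N - l.+1).+1 * qi0 (- k))).
    by rewrite unitrM unitrN qi0_unit /=; apply/zpos_unit/zpos_tq.
  have e3 : qi0 k * qi0 (- k) = 1 by rewrite XM addr0 subrr X00.
  by rewrite subnSK // mulrBr mulr1 addrC mulNr opprK mulrCA e3 mulr1.
elim/int_rect: m => [|k IH|k IH]; first by rewrite mulrC.
- have := acoef_rec (k.+1)%:Z; have := bcoef_rec (k.+1)%:Z.
  rewrite (_ : (k.+1)%:Z - 1 = k%:Z) => [e1 e2|]; last by lia.
  apply: (mulIr (P (k.+1)%:Z)); rewrite mulrAC -e2 -[RHS]mulrA -e1.
  by rewrite [RHS]mulrA -IH mulrAC.
- have := acoef_rec (- k%:Z); have := bcoef_rec (- k%:Z).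
  rewrite (_ : - k%:Z - 1 = - (k.+1)%:Z) => [e1 e2|]; last by lia.
  apply: (mulIr (R (- (k.+1)%:Z))); rewrite mulrAC e2 -[RHS]mulrA e1.
  by rewrite [RHS]mulrA -IH mulrAC.
Qed.

Lemma acoef0 : acoef 0 = ct_dlt n n.
Proof.
rewrite /acoef /ct_dlt (_ : ymono 0 = 1) ?mul1r // /ymono -[RHS]X00; congr X.
by apply/ffunP => l; rewrite !ffunE oppr0 mulr0 if_same.
Qed.

(* [x_i^(n m) (x_0 ... x_N)^-m] *)
Definition pmono m (i : 'I_n) : gser n :=
  X 0 [ffun l => (if l == i then n%:Z * m else 0) - m].

Lemma pmono_last m : pmono m sp = ymono m.
Proof.
congr X; apply/ffunP => l; rewrite !ffunE -val_eqE /=.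
have := ltn_ord l; rewrite ltnS leq_eqVlt => /predU1P[->|lN].
  by rewrite eqxx ltnn intS mulrDl mul1r addrC addrA addNr add0r.
by rewrite lN ltn_eqF // sub0r.
Qed.

(** Here all [n] variables are rotated, whereas the recursion in [m] rotates only the first [N]. *)
Lemma pmono_step m (i j : 'I_n) : j = i.+1 :> nat ->
  CT (pmono m i * D) = qi0 m * CT (pmono m j * D).
Proof.
move=> ji; have iN : (i.+1 < n)%N by rewrite -ji ltn_ord.
have cij : cyc (leqnn n) i = j by apply/val_inj; rewrite /= cycE cycnS.
suff E : om (leqnn n) (pmono m i) = sc n (qi0 m) * pmono m j.
  by rewrite -CT_scM -[LHS](CT_om (leqnn n)) (omM _ (pmono m i) D) E om_dlt mulrA.
rewrite sc_X /om aut_X XM !add0r; congr X.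
  rewrite /shear (bigD1 sp) //= big1 => [|k kN].
    by rewrite /cycla eqxx ffunE -val_eqE /= gtn_eqF // sub0r mulN1r opprK addr0.
  rewrite /cycla; case: eqP => [[E]|]; last by rewrite mul0r.
  by case/eqP: kN; apply/val_inj.
apply/ffunP => l; rewrite !ffunE -cij -[l in RHS](permKV (cyc (leqnn n))).
by rewrite (inj_eq perm_inj).
Qed.

Lemma sum_pmono m : CT ((\sum_i pmono m i) * D) = acoef m * \sum_(j < n) qi0 m ^+ j.
Proof.
have H d (i : 'I_n) : (i + d = N)%N -> CT (pmono m i * D) = qi0 m ^+ d * acoef m.
  elim: d i => [|d IH] i iN.
    have -> : i = sp by apply/val_inj; rewrite addn0 in iN.
    by rewrite pmono_last expr0 [RHS]mul1r.
  have jN : (i.+1 < n)%N by lia.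
  by rewrite (pmono_step m (j := Ordinal jN)) // IH /= ?addSnnS // exprS -[RHS]mulrA.
rewrite mulr_suml raddf_sum /= [RHS]mulrC mulr_suml [RHS](reindex_inj rev_ord_inj) /=.
by apply: eq_bigr => i _; apply: H; rewrite subSS subnKC // -ltnS.
Qed.
End Top.

(** * Symmetrization *)

Section Poincare.
Variable n : nat.
Implicit Types (f g G : gser n) (i j k l o : 'I_n).

Definition Pol (tau : gser n) p : gser n :=
  \prod_(e : 'I_n * 'I_n | (e.1 < e.2 < p)%N) (x e.1 - tau * x e.2).
Definition Mn p : gser n := \prod_(l : 'I_n | (l < p)%N) x l ^+ l.
Definition EP p : {poly gser n} := \prod_(l : 'I_n | (l < p)%N) ('X + (x l)%:P).
Definition asym p G :=
  forall i j, (i < p)%N -> (j < p)%N -> i != j -> swp i j G = - G.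
(** The factorial [[p]_s!] up to a sign independent of [s], which therefore cancels when [s = z] is
    compared with [s = 1]. *)
Definition Ff (s : gser 0) p : gser 0 := \prod_(k < p) ((-1) ^+ k * tnum s k.+1).

Lemma ord_split (R : comNzRingType) (F : 'I_n -> R) p o : o = p :> nat ->
  \prod_(l : 'I_n | (l < p.+1)%N) F l = F o * \prod_(l : 'I_n | (l < p)%N) F l.
Proof.
move=> op; rewrite (bigD1 o) /= ?op //; congr (_ * _).
by apply: eq_bigl => l; rewrite -val_eqE /= op; lia.
Qed.

Lemma size_EP p : (p <= n)%N -> size (EP p) = p.+1.
Proof.
move=> pn; rewrite /EP (big_ord_narrow pn).
have -> : \prod_(i < p) ('X + (x (widen_ord pn i))%:P) =
    \prod_(i <- [seq - x (widen_ord pn i) | i : 'I_p]) ('X - i%:P) :> {poly gser n}.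
  by rewrite big_image /=; apply: eq_bigr => i _; rewrite polyCN opprK.
by rewrite size_prod_XsubC size_image card_ord.
Qed.

Lemma lead_EP p : (p <= n)%N -> (EP p)`_p = 1.
Proof.
move=> pn; have /monicP : EP p \is monic.
  apply: monic_prod => l _; rewrite -[(x l)%:P]opprK -polyCN; exact: monicXsubC.
by rewrite lead_coefE size_EP.
Qed.

Lemma swp_EP p i j (k : nat) : (i < p)%N -> (j < p)%N -> swp i j (EP p)`_k = (EP p)`_k.
Proof.
move=> ip jp; rewrite -coef_map; suff -> : map_poly (swp i j) (EP p) = EP p by [].
rewrite /EP rmorph_prod.
rewrite [RHS](reindex_inj (@perm_inj _ (tperm i j))) /=.
apply: eq_big => [l|l _]; first by rewrite tperm_lt.
by rewrite rmorphD /= map_polyX map_polyC /= swp_x.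
Qed.

(** The factors with the last variable are expanded by [horner_tnum] into powers [(- x_o)^k] times
    functions symmetric in all [p + 1] variables. By induction the rest contributes [Mn p];
    antisymmetry then kills every [k < p], and [k = p] leaves the coefficient [(-1)^p [p+1]_s]. *)
Lemma poinc (s : gser 0) p G : (p <= n)%N -> asym p G ->
  CT (G * Pol (sc n s) p) = Ff s p * CT (G * Mn p).
Proof.
elim: p G => [|p IH] G pn aG.
  have -> : Pol (sc n s) 0 = 1 by rewrite /Pol big_pred0 // => e; rewrite ltn0 andbF.
  have -> : Mn 0 = 1 by rewrite /Mn big_pred0.
  by rewrite /Ff big_ord0 mul1r.
pose o := Ordinal pn; have op : o = p :> nat by [].
rewrite /Pol (pair_split _ op) /= -/(Pol _ p).
have E : \prod_(l : 'I_n | (l < p)%N) (x l - sc n s * x o) =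
    \sum_(k < p.+1) sc n (tnum s k.+1) * ((- x o) ^+ k * (EP p.+1)`_k.+1).
  have := @horner_tnum _ (sc n s) (x o) (EP p) p; rewrite size_EP ?(ltnW pn) // => /(_ (leqnn _)) h.
  transitivity (EP p).[- (sc n s * x o)].
    by rewrite /EP horner_prod; apply: eq_bigr => l _; rewrite !hornerE addrC.
  rewrite h; apply: eq_bigr => k _; rewrite /EP (ord_split _ op) -/(EP p) [_ * EP p]mulrC.
  by rewrite -mulrA /tnum rmorph_sum; congr (_ * _); apply: eq_bigr => u _; rewrite rmorphXn.
rewrite E {E} mulr_suml mulr_sumr raddf_sum /=.
have T (k : 'I_p.+1) :
  CT (G * (sc n (tnum s k.+1) * ((- x o) ^+ k * (EP p.+1)`_k.+1) * Pol (sc n s) p)) =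
  tnum s k.+1 * (Ff s p * CT (G * ((- x o) ^+ k * (EP p.+1)`_k.+1) * Mn p)).
  rewrite -IH ?(ltnW pn) // => [|i j ip jp ij].
    by rewrite -CT_scM; congr CT; ring.
  have hA : swp i j ((- x o) ^+ k) = (- x o) ^+ k.
    by rewrite rmorphXn rmorphN /= swp_x tpermD // -val_eqE /= ltn_eqF.
  have hC : swp i j (EP p.+1)`_k.+1 = (EP p.+1)`_k.+1.
    by apply: swp_EP; rewrite ltnS ltnW.
  have hG : swp i j G = - G by apply: aG; rewrite // ltnS ltnW.
  by rewrite (swpM i j G) (swpM i j (_ ^+ k)) hA hC hG mulNr.
rewrite (eq_bigr _ (fun (k : 'I_p.+1) _ => T k)) big_ord_recr /= big1 ?add0r => [|k _].
  rewrite lead_EP // mulr1 /Ff big_ord_recr /= -/(Ff s p) /Mn (ord_split _ op) -/(Mn p).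
  have -> : CT (G * (- x o) ^+ p * Mn p) = (-1) ^+ p * CT (G * (x o ^+ o * Mn p)).
    rewrite -CT_scM rmorphXn rmorphN1 exprNn; congr CT; ring.
  ring.
have kp := ltn_ord k; pose kk : 'I_n := widen_ord (ltnW pn) k.
have ko : kk != o by rewrite -val_eqE /= ltn_eqF.
(* [x_k] and [x_o] now carry the same exponent. *)
rewrite (_ : CT _ = 0) ?mulr0 //; apply: (@CT_antisym _ (tperm kk o) (fun=> 0)).
pose R' := \prod_(l : 'I_n | (l < p)%N && (l != kk)) x l ^+ l.
have hM : Mn p = x kk ^+ k * R' by rewrite /Mn (bigD1 kk) //= kp.
have hR : swp kk o R' = R'.
  rewrite /R' rmorph_prod; apply: eq_bigr => l /andP[lp lk] /=.
  rewrite rmorphXn /= swp_x tpermD 1?eq_sym // -val_eqE /= ltn_eqF //.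
move: hM hR; move: (Mn p) R' => M R' -> hR.
have hC : swp kk o (EP p.+1)`_k.+1 = (EP p.+1)`_k.+1.
  by apply: swp_EP; rewrite ?ltnS //= ltnW.
have hG : swp kk o G = - G by apply: aG; rewrite //= ltnS ltnW.
move: hC hG; move: (EP _)`_ _ => C hC hG; rewrite -/(swp kk o).
have hx : swp kk o ((- x o) ^+ k) = (- x kk) ^+ k.
  by rewrite rmorphXn rmorphN /= swp_x tpermR.
have hx' : swp kk o (x kk ^+ k) = x o ^+ k by rewrite rmorphXn /= swp_x tpermL.
have -> : swp kk o (G * ((- x o) ^+ k * C) * (x kk ^+ k * R')) =
    - G * ((- x kk) ^+ k * C) * (x o ^+ k * R').
  rewrite (swpM kk o (G * _)) (swpM kk o G) (swpM kk o (_ ^+ k) C) (swpM kk o (_ ^+ k) R').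
  by rewrite hR hC hG hx hx'.
rewrite [(- x kk) ^+ k]exprNn [(- x o) ^+ k]exprNn; ring.
Qed.
End Poincare.

Section Symm.
Variable n : nat.
Implicit Types (f g G : gser n) (i j k l : 'I_n).
Local Notation z := (Z n).

Definition Delta : gser n := \prod_i \prod_(j | i != j) gD (x i / x j).
Definition ks i j : gser n := gK (x i / x j) * gK (x j / x i) * ((x j)^-1 * (x i)^-1).
Definition Sp : gser n := \prod_(e : 'I_n * 'I_n | (e.1 < e.2 < n)%N) ks e.1 e.2.
Definition Vp : gser n := \prod_(e : 'I_n * 'I_n | (e.1 < e.2 < n)%N) (x e.2 - x e.1).

Lemma sub_xx (s : gser n) i j : 1 - s * (x j / x i) = (x i - s * x j) * (x i)^-1.
Proof. by rewrite mulrBl divrr ?x_unit // mulrA. Qed.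

(** [Delta'] and [Delta] share the antisymmetric factor [Vp * Sp] and differ only in [Pol s n], with
    [s = z] and [s = 1]. *)
Lemma dlt_VS : dlt n n = Vp * Sp * Pol z n.
Proof.
rewrite /dlt /Vp /Sp /Pol -!big_split; apply: eq_bigr => -[i j] _ /=.
rewrite prE /ks -[x i / x j]mul1r !sub_xx !mul1r; ring.
Qed.

Lemma Delta_VS : Delta = Vp * Sp * Pol 1 n.
Proof.
rewrite /Delta; under eq_bigr => i _ do rewrite (bigID (fun j => (i < j)%N)) /=.
rewrite big_split /= [X in _ * X](exchange_big_dep xpredT) //= -big_split /=.
rewrite /Vp /Sp /Pol -!big_split /=.
have -> : \prod_(e : 'I_n * 'I_n | (e.1 < e.2 < n)%N)
    ((x e.2 - x e.1) * ks e.1 e.2 * (x e.1 - 1 * x e.2)) =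
    \prod_(i : 'I_n) \prod_(j : 'I_n | (i < j)%N) (gD (x i / x j) * gD (x j / x i)).
  rewrite pair_big_dep /=; apply: eq_big => [[i j]|[i j] _] /=; first by rewrite ltn_ord andbT.
  rewrite (gD_K (isX_xx i j)) (gD_K (isX_xx j i)) /ks.
  by rewrite -[x i / x j]mul1r -[x j / x i]mul1r !sub_xx !mul1r; ring.
apply: eq_bigr => i _; rewrite [RHS]big_split /=; congr (_ * _).
  apply: eq_bigl => j; case: ltnP => ij; rewrite ?andbF ?andbT // -val_eqE /= ltn_eqF //.
apply: eq_bigl => j; rewrite -leqNgt leq_eqVlt -val_eqE /=; case: ltnP; case: eqP; lia.
Qed.

Lemma swp_Sp i j : swp i j Sp = Sp.
Proof.
pose s k := tperm i j k; have sK k : s (s k) = k by apply: tpermK.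
have ksC a b : ks a b = ks b a by rewrite /ks mulrC [gK _ * _]mulrC [(x b)^-1 * _]mulrC mulrC.
have h1 a b : swp i j (ks a b) = ks (s a) (s b).
  rewrite /ks !swpM !swp_xV (swp_gK i j (isX_xx a b)) (swp_gK i j (isX_xx b a)) !swp_xx //.
pose h (e : 'I_n * 'I_n) := if (s e.1 < s e.2)%N then (s e.1, s e.2) else (s e.2, s e.1).
have hP (e : 'I_n * 'I_n) : (e.1 < e.2 < n)%N ->
    ((h e).1 < (h e).2 < n)%N && (h (h e) == e).
  case: e => a b; rewrite /h /= ltn_ord andbT => ab.
  have : s a != s b by rewrite (can_eq sK) -val_eqE /= ltn_eqF.
  rewrite -val_eqE /= neq_ltn; case: (ltnP (s a) (s b)) => /= sab.
    by rewrite !sK ab sab ltn_ord eqxx.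
  by move=> sba; rewrite !sK sba ltn_ord [(b < a)%N]ltnNge (ltnW ab) /= eqxx.
rewrite /Sp rmorph_prod [RHS](reindex_onto h h) /= => [|e /hP/andP[_ /eqP]//].
apply: eq_big => [e|e _]; last by rewrite h1 /h; case: ifP => //= _; rewrite ksC.
apply/idP/idP => [/hP//|/andP[/hP/andP[h2 _] /eqP E]].
by rewrite E in h2.
Qed.

Lemma swp_Vp i j : i != j -> swp i j Vp = - Vp.
Proof.
move=> ij; pose A := Vandermonde n (\row_k x k : 'rV[gser n]_n).
have VE : Vp = \det A.
  rewrite det_Vandermonde pair_big_dep /=.
  by apply: eq_big => [[a b]|[a b] _] /=; rewrite ?ltn_ord ?andbT // !mxE.
rewrite VE -det_map_mx /=.
have -> : map_mx (swp i j) A = col_perm (tperm i j) A.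
  by apply/matrixP => a b; rewrite !mxE rmorphXn /= swp_x.
by rewrite col_permE det_mulmx det_perm odd_permV odd_tperm ij /= expr1 mulrN1.
Qed.

Lemma poinc_sym f : (forall i j, swp i j f = f) ->
  n`!%:R * CT (f * dlt n n) = (\prod_(k < n) tnum (Z 0) k.+1) * CT (f * Delta).
Proof.
move=> hf; pose G := f * (Vp * Sp).
have aG : asym n G.
  by move=> i j _ _ ij; rewrite /G (swpM i j f) (swpM i j Vp) hf swp_Sp swp_Vp // mulNr mulrN.
have e1 := poinc (Z 0) (leqnn n) aG; have e2 := poinc 1 (leqnn n) aG.
rewrite sc_Z in e1; rewrite rmorph1 in e2.
rewrite dlt_VS Delta_VS [f * (Vp * Sp * Pol z n)]mulrA e1.
rewrite [f * (Vp * Sp * Pol 1 n)]mulrA e2.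
rewrite /Ff !big_split /=; set s := \prod_(_ < _) _.
have -> : \prod_(k < n) tnum (1 : gser 0) k.+1 = n`!%:R.
  rewrite fact_prod natr_prod big_add1 big_mkord; apply: eq_bigr => k _.
  by rewrite /tnum (eq_bigr (fun=> 1)) ?sumr_const ?card_ord // => ? _; rewrite expr1n.
ring.
Qed.
End Symm.

(** * Translation to the definitions of the statement *)

Lemma evlimE (s : nat -> int) v :
  (exists N, forall M, (N <= M)%N -> s M = v) -> evlim s = v.
Proof.
move=> [N h]; rewrite /evlim.
have := epsilon_spec (inhabits 0) (fun v => exists N, forall M, (N <= M)%N -> s M = v).
case; first by exists v, N.
by move=> N' h'; rewrite -(h' (N + N')%N) ?leq_addl // h ?leq_addr.
Qed.

Section Iface.
Variable n : nat.
Implicit Types (f g : gser n) (F H : idx n -> int) (u : ser n).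

Definition tos F : ser n := fun a b al => F (Posz a, b, [ffun i => al i]).
Definition ofs u : idx n -> int := fun c =>
  match c.1.1 with Posz a => u a c.1.2 (fun i => c.2 i) | Negz _ => 0 end.

Lemma ffun_fun (al : 'I_n -> int) : (fun i => [ffun i => al i] i) = al.
Proof. by apply/funext => i; rewrite ffunE. Qed.

Lemma ofsK u : tos (ofs u) = u.
Proof.
apply/funext => a; apply/funext => b; apply/funext => al.
by rewrite /tos /ofs /= ffun_fun.
Qed.

Lemma tosK F : weak F -> ofs (tos F) = F.
Proof.
move=> [F0 _]; apply/funext => -[[a b] al]; rewrite /ofs /tos /=.
have -> : [ffun i => al i] = al by apply/ffunP => i; rewrite ffunE.
by case: a => // a; apply/esym/eqP/negPn/negP => /F0.
Qed.

Lemma weak_gser f : weak f. Proof. exact/gsup_wsup/gvalP. Qed.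

Lemma wsupp_weak u : wsupp u -> weak (ofs u).
Proof.
move=> hu; split=> [[[[a|a] b] al]|]; rewrite /nz /ofs /= ?eqxx //.
have h (a : nat) : exists b0 : int, forall (a' : nat) b al, (a' <= a)%N -> b < b0 -> u a' b al = 0.
  elim: a => [|a [b0 h]].
    by have [b0 h] := hu 0%N; exists b0 => a' b al; rewrite leqn0 => /eqP ->; apply: h.
  have [b1 h1] := hu a.+1; exists (Num.min b0 b1) => a' b al.
  rewrite leq_eqVlt lt_min => /predU1P[->|aa] /andP[? ?]; first exact: h1.
  exact: h.
move=> a; have [b0 hb] := h (absz a); exists b0 => -[[[a'|a'] b] al]; rewrite /nz /ofs /= ?eqxx //.
move=> nu aa; rewrite leNgt; apply/negP => bb; case/eqP: nu; apply: hb => //; lia.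
Qed.

Lemma weak_wsupp F : weak F -> wsupp (tos F).
Proof.
move=> [_ h] a; have [b0 hb] := h (Posz a); exists b0 => b al bb.
apply/eqP/negPn/negP => /hb /= /(_ (lexx _)); rewrite leNgt => /negP; exact.
Qed.

Lemma vwinE N : vwin n N = [seq (fun i => be i) | be : {ffun 'I_n -> int} <- fvwin n N].
Proof.
rewrite /vwin /fvwin -[RHS]map_comp; apply: eq_map => s /=.
by apply/funext => i; rewrite ffunE.
Qed.

(** The weak hypothesis on [u] makes room for the inverse chosen by [sinv], of which only [wsupp] is
    known. *)
Lemma smul_conv f u : weak (ofs u) -> smul (tos f) u = tos (conv f (ofs u)).
Proof.
move=> wu; apply/funext => a; apply/funext => b; apply/funext => al.
set c : idx n := (Posz a, b, [ffun i => al i]).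
have [L hL] := gsup_fin c (gvalP f) wu.
apply: evlimE; exists L => M LM.
pose r : seq (idx n) := [seq (ab.1, ab.2, al1) |
   ab <- [seq (Posz a1, b1) | a1 <- index_iota 0 a.+1, b1 <- zwin M], al1 <- fvwin n M].
have ur : uniq r.
  apply: allpairs_uniq; rewrite ?fvwin_uniq //.
    apply: allpairs_uniq; rewrite ?zwin_uniq ?iota_uniq //.
    by move=> [? ?] [? ?] _ _ /= [-> ->].
  by case=> [[? ?] ?] [[? ?] ?] _ _ /= [-> -> ->].
rewrite /tos -/c /conv (fsumE ur) => [|v].
  rewrite /r !big_allpairs_dep big_mkord.
  apply: eq_bigr => a1 _; apply: eq_bigr => b1 _; rewrite vwinE big_map.
  apply: eq_bigr => al1 _; have aa : (a1 <= a)%N by rewrite -ltnS ltn_ord.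
  congr (f (_, _, _) * _); first by apply/ffunP => i; rewrite ffunE.
  rewrite /ofs /= subzn //; congr (u _ _ _).
  by apply/funext => i; rewrite !ffunE.
rewrite mulf_eq0 negb_or => /andP[fv uv].
have vb := box_le LM (hL v fv uv).
have v0 : 0 <= v.1.1 by case: (gvalP f) => h _; apply: h.
have v1 : 0 <= (c - v).1.1 by case: wu => h _; apply: h.
case: v vb v0 v1 {fv uv} => [[va vb] val]; rewrite mem_box /= => /and3P[_ h2 h3] v0 v1.
apply/allpairsP; exists (va, vb, val); split; [|by rewrite mem_fvwin|by []].
apply/(allpairsP (f := fun a b => (Posz a, b))); exists (absz va, vb) => /=; split.
- by rewrite mem_index_iota; lia.
- by rewrite mem_zwin.
- by congr (_, _); lia.
Qed.

Lemma tosM f g : tos (f * g) = smul (tos f) (tos g).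
Proof. by rewrite smul_conv tosK //; apply: weak_gser. Qed.
Lemma tosD f g : tos (f + g) = sadd (tos f) (tos g).
Proof. by []. Qed.
Lemma tosB f g : tos (f - g) = ssub (tos f) (tos g).
Proof. by []. Qed.
Lemma tos_mon (a : nat) b (al : 'I_n -> int) (h : 0 <= (Posz a, b, [ffun i => al i]).1.1) :
  tos (mon h) = smono a b al.
Proof.
apply/funext => a'; apply/funext => b'; apply/funext => al'.
rewrite /tos /smono [LHS]/(monf _ _) /monf !xpair_eqE eqz_nat.
have -> : ([ffun i => al' i] == [ffun i => al i]) = [forall i, al' i == al i].
  apply/eqP/forallP => [/ffunP E i|E]; first by have := E i; rewrite !ffunE => ->.
  by apply/ffunP => i; rewrite !ffunE; apply/eqP.
by case: (_ && _).
Qed.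

Lemma tos_X b (al : 'I_n -> int) : tos (X b [ffun i => al i]) = smono 0 b al.
Proof. exact: tos_mon. Qed.
Lemma ffun0E : [ffun i => (fun=> 0) i] = 0 :> {ffun 'I_n -> int}.
Proof. by apply/ffunP => i; rewrite !ffunE. Qed.
Lemma tos_qi b : tos (X b 0) = @qpow n b.
Proof. by rewrite -ffun0E tos_X. Qed.
Lemma tos_Q : tos (Q n) = @qS n. Proof. exact: tos_qi. Qed.
Lemma tos_1 : tos (1 : gser n) = @sone n.
Proof. by rewrite -X00 -ffun0E tos_X. Qed.
Lemma tos_Z : tos (Z n) = @zS n.
Proof.
have h : 0 <= ((Posz 1, 0, [ffun i => (fun=> 0) i]) : idx n).1.1 by [].
rewrite -[@zS n](tos_mon h); congr (tos (gval _)).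
by apply: mon_eq; rewrite ffun0E.
Qed.
Lemma tosX f k : tos (f ^+ k) = spow (tos f) k.
Proof. by elim: k => [|k IH]; [exact: tos_1|rewrite exprS tosM IH]. Qed.
Lemma tos_prod (I : Type) (r : seq I) (P : pred I) (F : I -> gser n) :
  tos (\prod_(i <- r | P i) F i) = \big[@smul n/@sone n]_(i <- r | P i) tos (F i).
Proof. by apply: (big_morph (fun f : gser n => tos f)); [exact: tosM|exact: tos_1]. Qed.
Lemma tos_sum (I : Type) (r : seq I) (P : pred I) (F : I -> gser n) :
  tos (\sum_(i <- r | P i) F i) = \big[@sadd n/@szero n]_(i <- r | P i) tos (F i).
Proof. exact: (big_morph (fun f : gser n => tos f)). Qed.
Lemma zpow_mul k l : smul (@zpow n k) (@zpow n l) = @zpow n (k + l).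
Proof.
have h (a : nat) : 0 <= ((Posz a, 0, [ffun i => (fun=> 0) i]) : idx n).1.1 by [].
have E a : @zpow n a = tos (mon (h a)) by rewrite tos_mon.
rewrite !E -tosM; congr (tos (gval _)); apply: gserP => c.
rewrite mon_mulE !monE subr_eq addrC; congr (c == _)%:R.
by rewrite ffun0E; congr (_, _, _); rewrite /= ?addr0.
Qed.
Lemma tos_zpow k : tos (Z n ^+ k) = @zpow n k.
Proof.
elim: k => [|k IH]; first exact: tos_1.
by rewrite exprS tosM IH tos_Z zpow_mul.
Qed.
Lemma tos_poch f g M : tos (gpoch f g M) = poch (tos f) (tos g) M.
Proof.
rewrite /gpoch tos_prod; apply: eq_bigr => k _.
by rewrite tosB tos_1 tosM tosX.
Qed.

Lemma tos_pinf f : ismon f -> tos (pinf f) = pochinf (tos f) (@qS n).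
Proof.
move=> mf; apply/funext => a; apply/funext => b; apply/funext => al.
apply/esym; rewrite /pochinf /slim; apply: evlimE.
have [M0 h] := (pinf_cvg mf).2 (Posz a, b, [ffun i => al i]).
by exists M0 => M /h E; rewrite -tos_Q -tos_poch.
Qed.

(** The chosen inverse is the right one because inverses are unique among series with weak support:
    [convA] allows a weak third factor. *)
Lemma tos_inv f : f \is a GRing.unit -> tos f^-1 = sinv (tos f).
Proof.
move=> uf; rewrite /sinv.
have := epsilon_spec (inhabits (@szero n)) (fun u => wsupp u /\ smul (tos f) u = @sone n).
case.
  exists (tos f^-1); split; first exact/weak_wsupp/weak_gser.
  by rewrite -tosM divrr // tos_1.
move: (epsilon _ _) => u wu; have wo := wsupp_weak wu.
rewrite smul_conv // => E.
have E1 : conv f (ofs u) = (1 : gser n).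
  rewrite -[LHS](tosK (weak_conv (weak_gser f) wo)) E -tos_1 tosK //; exact: weak_gser.
rewrite -[RHS]ofsK; congr (tos _).
transitivity (conv f^-1 (conv f (ofs u))); first by rewrite E1 gvalM mulr1.
rewrite convA //; [|exact: gvalP|exact: gvalP].
have -> : conv f^-1 f = (1 : gser n) by rewrite gvalM mulVr.
by apply/funext => c; rewrite gval1 conv_mon subr0.
Qed.
End Iface.

Section Left.
Variable n : nat.
Implicit Types (k : int).

Definition pk k : gser n := \sum_(i : 'I_n) X 0 [ffun l => if l == i then k else 0].

Lemma tos_xratio (i j : 'I_n) : tos (x i / x j) = xratio i j.
Proof.
rewrite !xE XV XM oppr0 addr0 /xratio -tos_X; congr (tos (gval (X _ _))).
by apply/ffunP => l; rewrite !ffunE; do 2!case: eqP => _.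
Qed.

Lemma tos_gD (i j : 'I_n) :
  tos (gD (x i / x j)) =
  sdiv (pochinf (xratio i j) (@qS n)) (pochinf (smul (@zS n) (xratio i j)) (@qS n)).
Proof.
have Xf := isX_xx i j.
rewrite gD.unlock tosM tos_inv ?pinfz_unit // (tos_pinf (isX_mon Xf)).
by rewrite (tos_pinf (ismonzX Xf)) (tosM (Z n)) tos_Z tos_xratio.
Qed.

Lemma FknE k : Fkn n k = tos (Delta n * pk k).
Proof.
rewrite /Fkn tosM /Delta tos_prod /pk tos_sum; congr (smul _ _).
  apply: eq_bigr => i _; rewrite tos_prod; apply: eq_bigr => j _.
  by rewrite tos_gD.
by apply: eq_bigr => i _; rewrite tos_X.
Qed.

Lemma Fkn_deg k : supported (fun c => \sum_i c.2 i = k) (Delta n * pk k).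
Proof.
(* All variables are multiplied by [q], which fixes every ratio [x_i / x_j]. *)
have E : aut 1%g (fun=> 1) (Delta n * pk k) = X k 0 * (Delta n * pk k).
  rewrite [LHS]rmorphM mulrCA; congr (_ * _).
    rewrite rmorph_prod; apply: eq_bigr => i _; rewrite rmorph_prod; apply: eq_bigr => j _ /=.
    by rewrite (aut_gD _ _ (isX_xx i j)) aut_xx subrr X00 mul1r !perm1.
  rewrite /pk raddf_sum mulr_sumr; apply: eq_bigr => i _ /=.
  rewrite aut_X XM !add0r addr0; congr X.
    rewrite /shear (bigD1 i) //= ffunE eqxx mul1r big1 ?addr0 // => j ji.
    by rewrite ffunE (negPf ji) mulr0.
  by apply/ffunP => l; rewrite !ffunE invg1 perm1.
move=> c /(shear_supp E) <-; rewrite /shear; apply: eq_bigr => i _; by rewrite mul1r.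
Qed.
End Left.

Section Coef.
Variable N : nat.
Local Notation n := N.+1.

(** After the substitution for the last variable, the constant term collects the exponents
    [(d, ..., d)]. *)
Lemma diag_cond (al : 'I_n -> int) :
  [forall j : 'I_n.-1, al (widen_ord (leq_pred n) j) - lastexp n al == 0] =
  [forall i, al i == al ord_max].
Proof.
apply/forallP/forallP => h i; last by rewrite subr_eq0; apply: h.
have := ltn_ord i; rewrite ltnS leq_eqVlt => /predU1P[E|iN].
  by apply/eqP; congr al; apply/val_inj.
have := h (Ordinal iN); rewrite subr_eq0 => /eqP h'.
by apply/eqP; rewrite -[RHS]/(lastexp n al) -h'; congr al; apply/val_inj.
Qed.

Lemma Ck_zero k : ~~ (n%:Z %| k)%Z -> Ck n k = @szero 0.
Proof.
move=> nk; apply/funext => a; apply/funext => b; apply/funext => al.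
rewrite /Ck /cterm /substlast; apply: evlimE; exists 0%N => M _.
rewrite big1_seq // => be /andP[]; rewrite diag_cond => /forallP hb _.
rewrite FknE; apply/eqP/negPn/negP => /Fkn_deg /= E; case/negP: nk.
rewrite -E (eq_bigr (fun=> be ord_max)) => [|i _]; last by rewrite ffunE (eqP (hb i)).
by rewrite sumr_const card_ord -mulr_natr natz dvdz_mull.
Qed.

(** By homogeneity [d = m] is the only diagonal exponent that occurs, and division by
    [(x_0 ... x_N)^m] moves it to 0. *)
Lemma Ck_CT m : Ck n (n%:Z * m) = tos (CT ((\sum_i pmono m i) * Delta n)).
Proof.
apply/funext => a; apply/funext => b; apply/funext => al0.
rewrite /Ck /cterm /substlast; apply: evlimE.
pose cm : {ffun 'I_n -> int} := [ffun=> m].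
have -> : (\sum_i pmono m i) * Delta n = X 0 (- cm) * (Delta n * pk n (n%:Z * m)).
  rewrite mulrCA mulrC; congr (_ * _); rewrite /pk mulr_sumr.
  apply: eq_bigr => i _; rewrite XM addr0; congr X; apply/ffunP => l.
  by rewrite !ffunE addrC.
rewrite FknE; set g := Delta n * _.
exists (absz m) => M mM; rewrite vwinE big_map.
under eq_bigl => be do rewrite diag_cond.
rewrite big_mkcond (bigD1_seq cm) ?fvwin_uniq //=; last first.
  by rewrite mem_fvwin; apply/forallP => i; rewrite ffunE.
rewrite big1 ?addr0 => [|be ne].
  rewrite ifT; last by apply/forallP => i; rewrite !ffunE.
  rewrite {1}/tos [RHS]/tos /= /ctf X_mulE /iota_fun; congr (g _).
  congr (_, _, _); rewrite /= ?subr0 // sub0r opprK.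
  by apply/ffunP => i; rewrite !ffunE.
case: ifP => // /forallP hb; apply/eqP/negPn/negP => /Fkn_deg /= E; case/eqP: ne.
have {}E : n%:Z * be ord_max = n%:Z * m.
  rewrite -E (eq_bigr (fun=> be ord_max)) => [|i _]; last by rewrite ffunE (eqP (hb i)).
  by rewrite sumr_const card_ord intMn.
apply/ffunP => i; rewrite ffunE (eqP (hb i)); apply: mulfI E.
by [].
Qed.
End Coef.

(** * The right-hand side *)

Lemma intz_mulE n (c : int) (f : gser n) u : (c%:~R * f) u = c * f u.
Proof.
rewrite mulrzl; have H (k : nat) : (f *+ k) u = k%:Z * f u.
  elim: k => [|k IH]; first by rewrite mul0r.
  by rewrite mulrS gaddE IH intS mulrDl mul1r.
case: c => k; first exact: H.
by rewrite NegzE mulrNz goppE mulNr; congr (- _); apply: H.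
Qed.

Lemma tos_scale n c (f : gser n) : tos (c%:~R * f) = sscale c (tos f).
Proof.
by apply/funext => a; apply/funext => b; apply/funext => al; rewrite /tos intz_mulE.
Qed.

Lemma tos_div n (f g : gser n) : g \is a GRing.unit -> tos (f / g) = sdiv (tos f) (tos g).
Proof. by move=> ug; rewrite tosM tos_inv. Qed.

Section Right.
Variable N : nat.
Hypothesis N0 : (0 < N)%N.
Local Notation n := N.+1.

Definition Rfac m i : gser 0 :=
  (qi0 m - t ^+ i) * (1 - t ^+ (n - i)) / ((1 - qi0 m * t ^+ (n - i)) * (1 - t ^+ i)).
Definition Rpr m i : gser 0 :=
  (pinf (t ^+ i * qi0 (1 - m)) * pinf (t ^+ i * qi0 m)) /
  (pinf (t ^+ i.+1) * pinf (t ^+ i.-1 * q0)).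
Definition Rmid : gser 0 :=
  pinf t ^+ N / (pinf q0 ^+ (n - 2) * (pinf (q0 * t ^+ N) * gpoch t t N)).
Definition Rexp (m : int) : gser 0 :=
  ((n`!%:Z * (-1) ^ (N%:Z * m))%:~R * qi0 (N%:Z * tri m)) *
  ((1 + \sum_(1 <= l < n) \prod_(1 <= i < l.+1) Rfac m i) *
   (Rmid * \prod_(1 <= i < n) Rpr m i)).

Lemma zposX i : (0 < i)%N -> zpos (t ^+ i : gser 0).
Proof. by case: i => // i _; apply: zposZX. Qed.

Lemma unit_1tX i : (0 < i)%N -> 1 - t ^+ i \is a GRing.unit.
Proof. by move/zposX/zpos_unit. Qed.
Lemma unit_1qtX b i : (0 < i)%N -> 1 - qi0 b * t ^+ i \is a GRing.unit.
Proof. by move=> i0; apply/zpos_unit/zposMl/zposX. Qed.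
Lemma ismont i : ismon (t ^+ i : gser 0). Proof. exact/ismonXn/ismonZ. Qed.
Lemma pinf_t_unit i : (0 < i)%N -> pinf (t ^+ i : gser 0) \is a GRing.unit.
Proof. by move=> i0; apply: pinf_unit; [exact: ismont | exact: zposX]. Qed.
Lemma pinf_tq_unit i : pinf (t ^+ i * q0 : gser 0) \is a GRing.unit.
Proof.
case: i => [|i]; first by rewrite mul1r pinfQ_unit.
by apply: pinf_unit; [apply/ismonM/ismonQ/ismont | apply/zposM/zposZX].
Qed.

Lemma tos_Rfac m i : (0 < i < n)%N -> tos (Rfac m i) =
  sdiv (smul (ssub (@qpow 0 m) (@zpow 0 i)) (ssub (@sone 0) (@zpow 0 (n - i))))
       (smul (ssub (@sone 0) (smul (@qpow 0 m) (@zpow 0 (n - i)))) (ssub (@sone 0) (@zpow 0 i))).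
Proof.
move=> /andP[i0 iN]; have ni : (0 < n - i)%N by rewrite subn_gt0.
rewrite /Rfac tos_div; last by rewrite unitrM unit_1qtX ?unit_1tX.
by rewrite !tosM !tosB !tosM tos_1 !tos_qi !tos_zpow.
Qed.

Lemma tos_Rpr m i : (0 < i)%N -> tos (Rpr m i) =
  sdiv (smul (pochinf (smul (@zpow 0 i) (@qpow 0 (1 - m))) (@qS 0))
             (pochinf (smul (@zpow 0 i) (@qpow 0 m)) (@qS 0)))
       (smul (pochinf (@zpow 0 i.+1) (@qS 0))
             (pochinf (smul (@zpow 0 i.-1) (@qS 0)) (@qS 0))).
Proof.
move=> i0; rewrite /Rpr tos_div; last by rewrite unitrM pinf_t_unit // pinf_tq_unit.
set A := t ^+ i * qi0 (1 - m); set B := t ^+ i * qi0 m; set C := t ^+ i.-1 * q0.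
rewrite (tosM (pinf A) (pinf B)) (tosM (pinf (t ^+ i.+1)) (pinf C)).
rewrite (tos_pinf (ismon_tq i (1 - m))) (tos_pinf (ismon_tq i m)) (tos_pinf (ismont _)).
rewrite (tos_pinf (ismonM (ismont i.-1) (ismonQ 0))).
by rewrite (tosM (t ^+ i) (qi0 (1 - m))) (tosM (t ^+ i) (qi0 m)) (tosM (t ^+ i.-1) q0)
  tos_Q !tos_qi !tos_zpow.
Qed.

Lemma gpoch_t_unit : gpoch t t N \is a GRing.unit.
Proof. exact/gpoch_unit/zposZ. Qed.
Lemma pinf_qt_unit i : pinf (q0 * t ^+ i) \is a GRing.unit.
Proof. by rewrite mulrC pinf_tq_unit. Qed.

Lemma tos_Rmid : tos Rmid =
    sdiv (spow (pochinf (@zS 0) (@qS 0)) N)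
          (smul (spow (pochinf (@qS 0) (@qS 0)) (n - 2))
                (smul (pochinf (smul (@qS 0) (@zpow 0 N)) (@qS 0)) (poch (@zS 0) (@zS 0) N))).
Proof.
rewrite /Rmid tos_div; last first.
  by rewrite !unitrM pinf_qt_unit gpoch_t_unit unitrX ?pinfQ_unit.
rewrite (tosM (pinf q0 ^+ _) (_ * _)) (tosM (pinf (q0 * _)) (gpoch _ _ _)) !tosX tos_poch.
rewrite (tos_pinf (ismonZ 0)) (tos_pinf (ismonQ 0)).
rewrite (tos_pinf (ismonM (ismonQ 0) (ismont N))).
by rewrite (tosM q0 (t ^+ N)) tos_Q tos_Z tos_zpow.
Qed.

Lemma CrhsE m : Crhs n m = tos (Rexp m).
Proof.
rewrite /Rexp /Crhs (tosM (_ * _)) tos_scale tos_qi; congr (smul _ _).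
rewrite (tosM (1 + _)); congr (smul _ _).
  rewrite tosD tos_1 tos_sum; congr (sadd _ _).
  apply: eq_big_nat => l /andP[l1 ln]; rewrite tos_prod.
  apply: eq_big_nat => i /andP[i1 il]; rewrite tos_Rfac // i1 /=.
  exact: leq_ltn_trans ln.
rewrite tosM tos_Rmid tos_prod; congr (smul _ _).
by apply: eq_big_nat => i /andP[i1 _]; rewrite tos_Rpr.
Qed.
End Right.

Lemma final_algebra (R : comUnitRingType) (C T b0 b a c S nf pq pqN pqt pqtN pt Rx M : R) N :
  nf * (a * S) = T * C -> a * b0 = c * b -> c * (pq ^+ N.+1 * pqN) = pqt ->
  Rx * (M * (pq ^+ N * pqtN)) = nf * S * b * pt ->
  pt * (T * b0 * (pq ^+ N.+1 * pqN)) = pqt * (M * (pq ^+ N * pqtN)) ->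
  T \is a GRing.unit -> b0 \is a GRing.unit -> pq ^+ N.+1 * pqN \is a GRing.unit ->
  pt \is a GRing.unit -> C = Rx.
Proof.
set K := pq ^+ N.+1 * pqN; set L := M * _ => e1 e2 e3 e4 e5 uT ub uK up.
apply: (mulIr uT); apply: (mulIr ub); apply: (mulIr uK); apply: (mulIr up).
have -> : C * T * b0 * K * pt = (T * C) * b0 * K * pt by ring.
have -> : Rx * T * b0 * K * pt = Rx * (pt * (T * b0 * K)) by ring.
rewrite e5 -e1 [RHS](_ : _ = pqt * (Rx * L)); last by ring.
rewrite e4 -e3 [LHS](_ : _ = nf * S * (a * b0) * K * pt); last by ring.
by rewrite e2; ring.
Qed.

(** * Comparison of the two sides *)

Section Final.
Variable N : nat.
Hypothesis N0 : (0 < N)%N.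
Local Notation n := N.+1.
Implicit Types m : int.

Local Notation a_ i := (pinf (t ^+ i * q0)).
Definition Mden : gser 0 := \prod_(l < N) (pinf (t ^+ l.+2) * a_ l).
Definition Tall : gser 0 := \prod_(k < n) tnum t k.+1.

Lemma Tall_tfac : (1 - t) ^+ N * Tall = \prod_(l < N) (1 - t ^+ l.+2).
Proof.
rewrite /Tall big_ord_recl /tnum big_ord1 mul1r.
rewrite -[N in _ ^+ N]card_ord -prodr_const -big_split; apply: eq_bigr => l _ /=.
by rewrite /bump add1n -[RHS]opprB subrX1 -mulNr opprB.
Qed.

Lemma bcoef0_sq : bcoef N 0 = (\prod_(l < N) a_ l.+1) * (\prod_(l < N) a_ l.+1).
Proof. by rewrite bcoef0 big_split. Qed.

(** The constants independent of [m]. The products of [a_ l], [a_ l.+1] and [a_ l.+2] differ only in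
    end factors ([e1], [e2]), and [[n]_t!] absorbs the factors [1 - t^(l+2)] that separate
    [pinf (t ^+ l.+2)] from [a_ l.+2]. *)
Lemma const_id :
  pinf t ^+ N * (Tall * bcoef N 0 * (pinf q0 ^+ N * pinf (q0 * t ^+ n))) =
  pinf (q0 * t) ^+ n * (Mden * (pinf q0 ^+ N.-1 * pinf (q0 * t ^+ N))).
Proof.
have pt : pinf t = (1 - t) * a_ 1 by rewrite expr1 pinfS //; apply: ismonZ.
have e1 : a_ 1 * \prod_(l < N) a_ l.+2 = (\prod_(l < N) a_ l.+1) * a_ n.
  transitivity (\prod_(l < N.+1) a_ l.+1); [by rewrite big_ord_recl|by rewrite big_ord_recr].
have e2 : (\prod_(l < N) a_ l) * a_ N = pinf q0 * \prod_(l < N) a_ l.+1.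
  transitivity (\prod_(l < N.+1) a_ l); [by rewrite big_ord_recr|by rewrite big_ord_recl /= mul1r].
have Mi : Mden = (1 - t) ^+ N * Tall * (\prod_(l < N) a_ l.+2) * \prod_(l < N) a_ l.
  rewrite Tall_tfac -!big_split; apply: eq_bigr => l _ /=.
  by rewrite pinfS //; apply: ismont.
rewrite Mi bcoef0_sq pt exprMn [q0 * t]mulrC -{3}[t]expr1 [q0 * t ^+ n]mulrC [q0 * t ^+ N]mulrC.
rewrite -[X in pinf q0 ^+ X](prednK N0) [pinf q0 ^+ _.+1]exprS [a_ 1 ^+ n]exprS.
move: (pinf q0 ^+ _) (a_ 1 ^+ N) ((1 - t) ^+ N) (Tall) => u v w x.
move: e1 e2; move: (a_ 1) (a_ n) (a_ N) (pinf q0) => b1 bn bN pq.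
move: (\prod_(l < N) _) (\prod_(l < N) _) (\prod_(l < N) _) => A B C.
move=> e1 e2; rewrite [RHS](_ : _ = v * w * x * u * (b1 * C) * (A * bN)); last by ring.
by rewrite e1 e2; ring.
Qed.

Lemma gpoch_tfac : gpoch t t N = tfac t N.
Proof. by apply: eq_bigr => k _; rewrite -exprS. Qed.

Lemma Rmid_den : Rmid N * (pinf q0 ^+ N.-1 * pinf (q0 * t ^+ N)) * tfac t N = pinf t ^+ N.
Proof.
rewrite -gpoch_tfac /Rmid (_ : n - 2 = N.-1)%N; last by lia.
rewrite -[LHS]mulrA -[X in _ * X]mulrA divrK // !unitrM.
by rewrite unitrX ?pinfQ_unit // pinf_qt_unit gpoch_t_unit.
Qed.

Lemma Rpr_den m : (\prod_(1 <= i < n) Rpr m i) * Mden =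
  Rr t (qi0 m) N *
  \prod_(l < N) (pinf (t ^+ l.+1 * qi0 (1 - m)) * pinf (t ^+ l.+1 * qi0 m * q0)).
Proof.
rewrite big_add1 big_mkord /Mden /Rr -!big_split; apply: eq_bigr => l _ /=.
rewrite /Rpr divrK; last by rewrite unitrM pinf_t_unit // pinf_tq_unit.
rewrite [pinf (t ^+ l.+1 * qi0 m)]pinfS; last exact: ismon_tq.
by rewrite [t ^+ l.+1 * qi0 m]mulrC mulrCA.
Qed.

Lemma Rsum m : (1 + \sum_(1 <= l < n) \prod_(1 <= i < l.+1) Rfac N m i) * Rr t (qi0 m) N =
  (\sum_(j < n) qi0 m ^+ j) * tfac t N.
Proof.
rewrite -(@qsum _ t (qi0 m)); [|by move=> i; apply: unit_1tX|by move=> i; apply: unit_1qtX].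
congr ((1 + _) * _); rewrite big_add1 big_mkord; apply: eq_bigr => l _.
by rewrite big_add1 big_mkord; apply: eq_bigr => i _; rewrite /Rfac subSS.
Qed.

Lemma Rexp_den m :
  Rexp N m * (Mden * (pinf q0 ^+ N.-1 * pinf (q0 * t ^+ N))) =
  n`!%:R * (\sum_(j < n) qi0 m ^+ j) * bcoef N m * pinf t ^+ N.
Proof.
rewrite /Rexp -Rmid_den /bcoef /sg intrM.
have := Rpr_den m; have := Rsum m.
move: (1 + _) (\sum_(j < n) _) (\prod_(1 <= i < n) _) (\prod_(l < N) _) Mden => s S p b M.
move: (Rmid N) (Rr _ _ _) (tfac _ _) (pinf q0 ^+ _ * _) => r R0 T u e1 e2.
rewrite [n`!%:Z%:~R](_ : _ = n`!%:R) //.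
move: (n`!%:R : gser 0) (((-1) ^ _ : int)%:~R) (X _ _) => nf g xx.
rewrite [LHS](_ : _ = nf * g * xx * s * r * u * (p * M)); last by ring.
rewrite e2 [LHS](_ : _ = nf * g * xx * r * u * b * (s * R0)); last by ring.
by rewrite e1; ring.
Qed.

Lemma pmono_swp m (i j : 'I_n) : swp i j (\sum_k pmono m k) = \sum_k pmono m k.
Proof.
rewrite rmorph_sum [RHS](reindex_inj (@perm_inj _ (tperm i j))) /=.
apply: eq_bigr => k _; rewrite [LHS]aut_X /shear big1 ?addr0 => [|l _]; last by rewrite mul0r.
congr X; apply/ffunP => l; rewrite !ffunE tpermV.
by rewrite -[in RHS](tpermK i j l) (inj_eq perm_inj).
Qed.

Lemma Tall_unit : Tall \is a GRing.unit.
Proof.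
have : (1 - t) ^+ N * Tall \is a GRing.unit.
  by rewrite Tall_tfac; apply: rpred_prod => l _; apply: unit_1tX.
by rewrite unitrM => /andP[].
Qed.

Lemma CT_Rexp m : CT ((\sum_i pmono m i) * Delta n) = Rexp N m.
Proof.
have e1 := poinc_sym (pmono_swp m); rewrite (sum_pmono N0 m) in e1.
have e2 := acoef_bcoef N0 m; rewrite acoef0 in e2.
have e3 := @ct_dlt_val n n; rewrite /= leqnn in e3.
have bu : bcoef N 0 \is a GRing.unit.
  by rewrite bcoef0_sq unitrM andbb; apply: rpred_prod => l _; apply: pinf_tq_unit.
apply: (@final_algebra _ _ Tall (bcoef N 0) (bcoef N m) (acoef N m) (ct_dlt n n)
  (\sum_(j < n) qi0 m ^+ j) n`!%:R (pinf q0) (pinf (q0 * t ^+ n)) (pinf (q0 * t) ^+ n)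
  (pinf (q0 * t ^+ N)) (pinf t ^+ N) (Rexp N m) Mden N.-1).
- exact: e1.
- exact: e2.
- by rewrite prednK //; apply: e3.
- exact: Rexp_den.
- by rewrite prednK //; apply: const_id.
- exact: Tall_unit.
- exact: bu.
- by rewrite unitrM pinf_qt_unit unitrX ?pinfQ_unit.
- by apply/unitrX/pinf_unit; [exact: ismonZ|exact: zposZ].
Qed.
End Final.

Theorem theorem3p1 (n : nat) (hn : (2 <= n)%N) :
  (forall k : int, ~~ (n%:Z %| k)%Z -> Ck n k = @szero 0) /\
  (forall m : int, Ck n (n%:Z * m) = Crhs n m).
Proof.
case: n hn => // N hN; split; first exact: Ck_zero.
by move=> m; rewrite Ck_CT CT_Rexp // CrhsE.
Qed.
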